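(* Let $\zeta$ denote the Riemann zeta function. (i) Let $\mu>1$ and $C=\mathbb{R}_+^*/\mu^{\mathbb{Z}}$, a circle of length $L=\log\mu$. The spectrum of the action of the multiplicative group $\mathbb{R}_+^*$ on the orthogonal complement $(\Sigma_\mu\mathcal{E}(\mathcal{S}_0^{\rm ev}))^\perp$ of $\Sigma_\mu\mathcal{E}(\mathcal{S}_0^{\rm ev})$ in $L^2(C)$ is formed by imaginary parts of zeros of the Riemann zeta function on the critical line; that is, every $s$ in this spectrum satisfies $\zeta(\tfrac12+is)=0$. (ii) Let $s>0$ be such that $\zeta(\frac12+is)=0$. Then any circle $C=\mathbb{R}_+^*/\mu^{\mathbb{Z}}$ whose length $L=\log\mu$ is a (positive) integral multiple of $2\pi/s$ is a $\zeta$-cycle, and the spectrum of the action of $\mathbb{R}_+^*$ on $(\Sigma_\mu\mathcal{E}(\mathcal{S}_0^{\rm ev}))^\perp\subset L^2(C)$ contains $s$.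
   Context: $\mathcal{S}_0^{\rm ev}$ is the linear space of (complex-valued) even Schwartz functions $f$ on $\mathbb{R}$ with $f(0)=0$ and $\int_{\mathbb{R}} f(x)\,dx=0$. For such $f$, the function $\mathcal{E}(f)$ on $\mathbb{R}_+^*=(0,\infty)$ is $\mathcal{E}(f)(u):=u^{1/2}\sum_{n>0} f(nu)$. For $\mu>1$ and a function $g$ on $\mathbb{R}_+^*$ decaying fast enough at $0$ and $\infty$, $(\Sigma_\mu g)(u):=\sum_{k\in\mathbb{Z}} g(\mu^k u)$, viewed as a function on the circle $\mathbb{R}_+^*/\mu^{\mathbb{Z}}$. For $f\in\mathcal{S}_0^{\rm ev}$ the function $\Sigma_\mu\mathcal{E}(f)$ is well defined and bounded, so $\Sigma_\mu\mathcal{E}(\mathcal{S}_0^{\rm ev})$ is a subspace of $L^2(C)$. A circle of length $L=\log\mu>0$ is identified with $C=\mathbb{R}_+^*/\mu^{\mathbb{Z}}$, endowed with the measure induced by the Haar measure $d^*u=du/u$ of $\mathbb{R}_+^*$; $L^2(C)$ is the complex Hilbert space of square integrable functions for this measure. The group $\mathbb{R}_+^*$ acts on $L^2(C)$ by $(\vartheta(\lambda)f)(x)=f(\lambda^{-1}x)$, and this action preserves $\Sigma_\mu\mathcal{E}(\mathcal{S}_0^{\rm ev})$ and its orthogonal complement. The spectrum of the action on the orthogonal complement is the set of $s\in\mathbb{R}$ for which there is a nonzero vector $\xi$ in it with $\vartheta(\lambda)\xi=\lambda^{is}\xi$ for all $\lambda\in\mathbb{R}_+^*$. A $\zeta$-cycle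 is a circle $C$ of length $L=\log\mu$ such that the subspace $\Sigma_\mu\mathcal{E}(\mathcal{S}_0^{\rm ev})$ is not dense in $L^2(C)$. *)

(* Defs.v *)
From HB Require Import structures.
From mathcomp Require Import all_boot all_order all_algebra.
From mathcomp Require Import all_classical all_reals all_analysis.
From mathcomp Require Import complex.

Set Implicit Arguments.
Unset Strict Implicit.
Unset Printing Implicit Defensive.

Import Order.TTheory GRing.Theory Num.Theory.
Import numFieldNormedType.Exports.

Local Open Scope classical_set_scope.
Local Open Scope ring_scope.
Local Open Scope complex_scope.

(* Functions on R_+^* are represented by functions on R whose values outside
   ]0, +oo[ are never used, and functions on the circle C = R_+^* / mu^Z by
   functions on R_+^* invariant under u |-> mu * u.  The interval [1, mu[ is
   a fundamental domain, so that integrating over C against the measure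
   induced by d^*u = du / u is integrating over [1, mu[ against du / u. *)

Section ZetaCycles.
Context {R : realType}.
Local Notation C := R[i].
Local Notation Re := (@complex.Re R).
Local Notation Im := (@complex.Im R).
Local Notation normc := (@ComplexField.Normc.normc R).
Local Notation leb := (@lebesgue_measure R).
Implicit Types (mu s lam : R) (f g h xi : R -> C) (V : set (R -> C)).

Definition Re_fun f : R -> R := fun x => Re (f x).
Definition Im_fun f : R -> R := fun x => Im (f x).

(* The topology on C comes from its numFieldType structure, through C^o. *)
Definition csum (a : nat -> C) : C := limn (series a : nat -> C^o).

Definition cintegral (D : set R) f : C :=
  (\int[leb]_(x in D) Re_fun f x)%R +i* (\int[leb]_(x in D) Im_fun f x)%R.

Definition cexp (z : C) : C :=
  (expR (Re z))%:C * (cos (Im z) +i* sin (Im z)).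

(* t ^ z, for t > 0 *)
Definition cpow (t : R) (z : C) : C := cexp ((ln t)%:C * z).

Definition analytic_at (F : C -> C) (z : C) : Prop :=
  exists r : R, 0 < r /\ exists a : nat -> C, forall w : C,
    normc (w - z) < r ->
    (series (fun n => a n * (w - z) ^+ n) : nat -> C^o) @ \oo --> (F w : C^o).

(* The analytic continuation to C \ {1} of the Dirichlet series; since
   C \ {1} is connected, this determines zeta outside of 1. *)
Definition is_riemann_zeta (zeta : C -> C) : Prop :=
  (forall z : C, z != 1 -> analytic_at zeta z) /\
  (forall z : C, 1 < Re z ->
     (series (fun n => cpow n.+1%:R (- z)) : nat -> C^o) @ \oo
       --> (zeta z : C^o)).

Definition real_schwartz (f : R -> R) : Prop :=
  (forall (n : nat) (x : R), derivable (derive1n n f) x 1) /\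
  (forall m n : nat, exists M : R, forall x : R, `|x ^+ m * derive1n n f x| <= M).

Definition schwartz f : Prop :=
  real_schwartz (Re_fun f) /\ real_schwartz (Im_fun f).

Definition S0ev : set (R -> C) :=
  [set f | [/\ schwartz f, forall x, f (- x) = f x, f 0 = 0
             & cintegral setT f = 0]].

Definition E_map f : R -> C :=
  fun u => (Num.sqrt u)%:C * csum (fun n => f (n.+1%:R * u)).

(* The sum over k in Z, split as k >= 0 and k <= -1. *)
Definition Sigma_map mu g : R -> C :=
  fun u => csum (fun k => g (mu ^+ k * u)) + csum (fun k => g (mu ^- k.+1 * u)).

Definition SigmaE mu : set (R -> C) :=
  [set Sigma_map mu (E_map f) | f in S0ev].

Definition circle_integral mu g : C :=
  cintegral `[1, mu[ (fun u => g u * (u^-1)%:C).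

Definition circle_norm2 mu g : \bar R :=
  (\int[leb]_(u in `[1%R, mu[) ((normc (g u) ^+ 2 / u)%:E))%E.

(* Representatives of the elements of L^2(C). *)
Definition L2 mu : set (R -> C) :=
  [set g | [/\ forall u, 0 < u -> g (mu * u) = g u,
               measurable_fun (`]0, +oo[ : set R) (Re_fun g),
               measurable_fun (`]0, +oo[ : set R) (Im_fun g)
             & (circle_norm2 mu g < +oo)%E]].

(* Equality in L^2(C); d^*u and Lebesgue measure have the same null sets. *)
Definition L2_eq g h : Prop := {ae leb, forall u : R, 0 < u -> g u = h u}.

Definition L2_dot mu g h : C := circle_integral mu (fun u => g u * conjc (h u)).

Definition L2_dense mu V : Prop :=
  forall g, L2 mu g -> forall e : R, 0 < e ->
    exists2 h, V h & (circle_norm2 mu (fun u => g u - h u)%R < e%:E)%E.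

Definition L2_orth mu V : set (R -> C) :=
  [set xi | L2 mu xi /\ forall h, V h -> L2_dot mu xi h = 0].

Definition theta lam g : R -> C := fun x => g (lam^-1 * x).

Definition spectrum V : set R :=
  [set s | exists xi, [/\ V xi, ~ L2_eq xi (fun=> 0) &
     forall lam, 0 < lam ->
       L2_eq (theta lam xi) (fun x => cpow lam (0 +i* s) * xi x)]].

Definition zeta_cycle mu : Prop := 1 < mu /\ ~ L2_dense mu (SigmaE mu).

End ZetaCycles.

(* Main.v *)
Require Import Defs.
From mathcomp Require Import all_boot all_order all_algebra.
From mathcomp Require Import all_classical all_reals all_analysis.
From mathcomp Require Import measurable_realfun complex ring lra.

Set Implicit Arguments.
Unset Strict Implicit.
Unset Printing Implicit Defensive.

Import Order.TTheory GRing.Theory Num.Theory.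
Import numFieldNormedType.Exports.

Local Open Scope classical_set_scope.
Local Open Scope ring_scope.
Local Open Scope complex_scope.

(** When mu^(is) = 1, the character u^(is) descends to the circle, and
    unfolding the sum over the powers of mu turns its integral against
    Sigma_mu E(f) over a fundamental domain into
      int_0^oo E(f)(u) u^(is) du/u
        = zeta(1/2 + is) * int_0^oo f(u) u^(is - 1/2) du
    ([S0ev_pairing]).  Both parts are read off from this identity.

    If zeta(1/2 + is) = 0, then u^(-is) is orthogonal to the whole subspace.
    It is an eigenvector with eigenvalue s, and no element of the subspace is
    closer to it than its own norm, so the subspace is not dense
    ([zero_cycle]).

    Conversely let xi be an eigenvector for s in the orthogonal complement.
    The dilation by mu acts trivially on the circle, which forces
    mu^(is) = 1.  The function u^(is) xi(u) is invariant under every dilation,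
    up to a null set that depends on the dilation; Tonelli's theorem exchanges
    the two quantifiers, so that this function is almost everywhere constant
    ([eigenvector_power]).  Hence xi is a nonzero multiple of u^(-is), and
    zeta(1/2 + is) * int_0^oo f(u) u^(is - 1/2) du = 0 for all admissible f.
    Some f has a nonzero Mellin transform there ([test_function]), whence
    zeta(1/2 + is) = 0 ([spectrum_sub_zeros]).

    The factor zeta(1/2 + is) lies outside of the domain of convergence of
    the Dirichlet series.  Let F be the primitive of f that vanishes at 0; it
    tends to 0 at infinity because the even function f has integral zero.
    Then
      S_N(u) = sum_(n <= N) f(nu) - F(Nu) / u
    converges to sum_n f(nu).  Comparing f(nu) with its mean over
    [(n-1)u, nu] and telescoping bounds S_N(u) by a constant over 1 + u,
    uniformly in N ([riemann_error_dom]).  Dominated convergence applies to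
    the Mellin transforms at z, and dilations act on them by powers: the
    transform of S_N is that of f times
      sum_(n <= N) n^(-z) - N^(1-z) / (1-z)
    ([mellin_riemann_error]).  For Re z > 0 and z != 1 this factor converges,
    to z/(z-1) - z * int_1^oo {x} x^(-z-1) dx.  For Re z > 1 the limit is the
    Dirichlet series.  Its restriction to a horizontal line is real-analytic,
    so on each horizontal line that avoids the pole the identity theorem in
    one real variable carries the equality with zeta to the critical line;
    the point 1/2 is reached by continuity ([zetaN_cvg_half]).

    The test function is the derivative of x^(k+1) exp(-x^2) with k > 0 even:
    it is even, vanishes at 0 and has integral zero.  Its Mellin transform at
    z is 1 - z times that of x^k exp(-x^2).  For k large this weight
    concentrates near a point x0 where x^(is) oscillates too slowly to cancel
    it ([gauss_mellin_neq0]). *)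

(** * Complex sequences and complex powers of positive reals *)

Section ComplexBasics.
Context {R : realType}.
Local Notation C := R[i].
Local Notation Re := (@complex.Re R).
Local Notation Im := (@complex.Im R).
Local Notation normc := (@ComplexField.Normc.normc R).
Implicit Types (z w : C).

Lemma complex_eq z w : Re z = Re w -> Im z = Im w -> z = w.
Proof. by case: z w => [a b] [c d] /= -> ->. Qed.

Lemma ReD z w : Re (z + w) = Re z + Re w. Proof. by case: z w => [??] [??]. Qed.
Lemma ImD z w : Im (z + w) = Im z + Im w. Proof. by case: z w => [??] [??]. Qed.
Lemma ReN z : Re (- z) = - Re z. Proof. by case: z. Qed.
Lemma ImN z : Im (- z) = - Im z. Proof. by case: z. Qed.
Lemma ReM z w : Re (z * w) = Re z * Re w - Im z * Im w.
Proof. by case: z w => [??] [??]. Qed.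
Lemma ImM z w : Im (z * w) = Re z * Im w + Im z * Re w.
Proof. by case: z w => [a b] [c d]. Qed.
Lemma ReC (x : R) : Re x%:C = x. Proof. by []. Qed.
Lemma ImC (x : R) : Im x%:C = 0. Proof. by []. Qed.
Lemma Re1 : Re 1 = 1. Proof. by []. Qed.
Lemma Im1 : Im 1 = 0. Proof. by []. Qed.
Lemma Re_conj z : Re (conjc z) = Re z. Proof. by case: z. Qed.
Lemma Im_conj z : Im (conjc z) = - Im z. Proof. by case: z. Qed.

(** Rewriting rules that reduce an identity between complex numbers to real
    ones. *)
Definition ReImE :=
  (ReD, ImD, ReN, ImN, ReM, ImM, ReC, ImC, Re1, Im1, Re_conj, Im_conj).

Lemma Re_sum (I : Type) (r : seq I) (P : pred I) (F : I -> C) :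
  Re (\sum_(i <- r | P i) F i) = \sum_(i <- r | P i) Re (F i).
Proof. exact: (big_morph Re ReD (erefl _)). Qed.

Lemma Im_sum (I : Type) (r : seq I) (P : pred I) (F : I -> C) :
  Im (\sum_(i <- r | P i) F i) = \sum_(i <- r | P i) Im (F i).
Proof. exact: (big_morph Im ImD (erefl _)). Qed.

Lemma normc_ge0 z : 0 <= normc z.
Proof. by case: z => a b /=; exact: sqrtr_ge0. Qed.

Lemma sqr_normc z : normc z ^+ 2 = Re z ^+ 2 + Im z ^+ 2.
Proof. by case: z => a b /=; rewrite sqr_sqrtr// addr_ge0 ?sqr_ge0. Qed.

Lemma normc_real (x : R) : normc x%:C = `|x|.
Proof. by rewrite /= expr0n /= addr0 sqrtr_sqr. Qed.

Lemma normc_Re_le z : `|Re z| <= normc z.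
Proof.
rewrite -(@ler_pXn2r _ 2) ?nnegrE ?normc_ge0// sqr_normc.
by rewrite real_normK ?num_real// lerDl sqr_ge0.
Qed.

Lemma normc_Im_le z : `|Im z| <= normc z.
Proof.
rewrite -(@ler_pXn2r _ 2) ?nnegrE ?normc_ge0// sqr_normc.
by rewrite real_normK ?num_real// lerDr sqr_ge0.
Qed.

Lemma normc_leReIm z : normc z <= `|Re z| + `|Im z|.
Proof.
rewrite -(@ler_pXn2r _ 2) ?nnegrE ?normc_ge0 ?addr_ge0// sqr_normc sqrrD.
rewrite !real_normK ?num_real// lerD2r lerDl mulrn_wge0 ?mulr_ge0//.
Qed.

Lemma normcM z w : normc (z * w) = normc z * normc w.
Proof. exact: ComplexField.Normc.normcM. Qed.

Lemma normcD_le z w : normc (z + w) <= normc z + normc w.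
Proof. exact: le_normcD. Qed.

Lemma normc_sum_le (I : Type) (r : seq I) (P : pred I) (F : I -> C) :
  normc (\sum_(i <- r | P i) F i) <= \sum_(i <- r | P i) normc (F i).
Proof.
apply: (big_ind2 (fun x y => normc x <= y)) => //.
- by rewrite ComplexField.Normc.normc0.
- move=> x1 x2 y1 y2 h1 h2; apply: le_trans (normcD_le _ _) _; exact: lerD.
Qed.

Lemma normCE z : `|z| = (normc z)%:C.
Proof. by case: z. Qed.

Lemma normc_lt (z : C) (e : R) : (`|z| < e%:C) = (normc z < e).
Proof. by rewrite normCE ltcR. Qed.

(** Convergence of the real and imaginary parts, which is what the theorems on
    real sequences and integrals produce; [ccvgP] relates it to the topology. *)
Definition ccvg (a : nat -> C) (l : C) : Prop :=
  (Re \o a @ \oo --> Re l) /\ (Im \o a @ \oo --> Im l).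

Lemma ccvgP (a : nat -> C) (l : C) :
  ((a : nat -> C^o) @ \oo --> (l : C^o)) <-> ccvg a l.
Proof.
split.
- move=> /cvgrPdist_lt H; split; apply/cvgrPdist_lt => e e0.
    have e0' : 0 < e%:C by rewrite ltcR.
    near=> n; have : `|l - a n| < e%:C by near: n; exact: (H _ e0').
    rewrite normc_lt; apply: le_lt_trans.
    by rewrite /= -ReN -ReD normc_Re_le.
  have e0' : 0 < e%:C by rewrite ltcR.
  near=> n; have : `|l - a n| < e%:C by near: n; exact: (H _ e0').
  rewrite normc_lt; apply: le_lt_trans.
  by rewrite /= -ImN -ImD normc_Im_le.
- move=> [/cvgrPdist_lt Hr /cvgrPdist_lt Hi]; apply/cvgrPdist_lt => -[e e'].
  rewrite ltcE /= => /andP[/eqP -> e0].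
  have e2 : 0 < e / 2 by rewrite divr_gt0.
  near=> n; rewrite normc_lt; apply: le_lt_trans (normc_leReIm _) _.
  rewrite (splitr e) ltrD// ?ReImE.
    by near: n; exact: (Hr _ e2).
  by near: n; exact: (Hi _ e2).
Unshelve. all: by end_near. Qed.

Lemma ccvg_unique (a : nat -> C) (l l' : C) : ccvg a l -> ccvg a l' -> l = l'.
Proof.
move=> [r i] [r' i']; apply: complex_eq.
- exact: (cvg_unique _ r r').
- exact: (cvg_unique _ i i').
Qed.

Lemma ccvg_cst (l : C) : ccvg (fun=> l) l.
Proof. by split; exact: cvg_cst. Qed.

Lemma ccvgD a b (l m : C) : ccvg a l -> ccvg b m ->
  ccvg (fun n => a n + b n) (l + m).
Proof.
move=> [r i] [r' i']; split; rewrite ?ReD ?ImD.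
- rewrite (_ : Re \o _ = (Re \o a) \+ (Re \o b)); first exact: cvgD.
  by apply/funext => n /=; rewrite ReD.
- rewrite (_ : Im \o _ = (Im \o a) \+ (Im \o b)); first exact: cvgD.
  by apply/funext => n /=; rewrite ImD.
Qed.

Lemma ccvgM a b (l m : C) : ccvg a l -> ccvg b m ->
  ccvg (fun n => a n * b n) (l * m).
Proof.
move=> [r i] [r' i']; split; rewrite ?ReM ?ImM.
- rewrite (_ : Re \o _ = ((Re \o a) \* (Re \o b)) \- ((Im \o a) \* (Im \o b))).
    by apply: cvgB; exact: cvgM.
  by apply/funext => n /=; rewrite ReM.
- rewrite (_ : Im \o _ = ((Re \o a) \* (Im \o b)) \+ ((Im \o a) \* (Re \o b))).
    by apply: cvgD; exact: cvgM.
  by apply/funext => n /=; rewrite ImM.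
Qed.

Lemma csumE (a : nat -> C) (l : C) : ccvg (series a) l -> csum a = l.
Proof. by move=> /ccvgP H; apply: (@cvg_lim C^o) => //; exact: norm_hausdorff. Qed.

Lemma ccvg_real (a : nat -> R) (l : R) : a @ \oo --> l ->
  ccvg (fun n => (a n)%:C) l%:C.
Proof. by move=> al; split => //; exact: cvg_cst. Qed.

Lemma cexpD z w : cexp (z + w) = cexp z * cexp w.
Proof.
rewrite /cexp !ReImE expRD; apply: complex_eq; rewrite ?ReImE /=.
  by rewrite cosD; ring.
by rewrite sinD; ring.
Qed.

Lemma cexp0 : cexp (0 : C) = 1.
Proof. by rewrite /cexp /= expR0 cos0 sin0; apply: complex_eq; rewrite !ReImE /=; ring. Qed.

Lemma normc_cexp z : normc (cexp z) = expR (Re z).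
Proof.
rewrite /cexp normcM normc_real ger0_norm ?expR_ge0//=.
by rewrite cos2Dsin2 sqrtr1 mulr1.
Qed.

Lemma cpowD (t : R) z w : cpow t (z + w) = cpow t z * cpow t w.
Proof. by rewrite /cpow mulrDr cexpD. Qed.

Lemma cpow0 (t : R) : cpow t 0 = 1 :> C.
Proof. by rewrite /cpow mulr0 cexp0. Qed.

Lemma cpow_one z : cpow 1 z = 1.
Proof. by rewrite /cpow ln1 mul0r cexp0. Qed.

Lemma cpowMl (t u : R) z : 0 < t -> 0 < u -> cpow (t * u) z = cpow t z * cpow u z.
Proof. by move=> t0 u0; rewrite /cpow lnM// rmorphD mulrDl cexpD. Qed.

Lemma cpowN (t : R) z : cpow t (- z) * cpow t z = 1.
Proof. by rewrite -cpowD addNr cpow0. Qed.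

Lemma normc_cpow (t : R) z : 0 < t -> normc (cpow t z) = t `^ Re z.
Proof. by move=> t0; rewrite /cpow normc_cexp !ReImE mul0r subr0 /powR gt_eqF// mulrC. Qed.

Lemma cpow_neq0 (t : R) z : cpow t z != 0.
Proof.
apply/negP => /eqP H; have := cpowN t z; rewrite H mulr0 => /eqP.
by rewrite eq_sym oner_eq0.
Qed.

Lemma Re_cpow (t : R) z : 0 < t -> Re (cpow t z) = t `^ Re z * cos (Im z * ln t).
Proof.
move=> t0; rewrite /cpow /cexp !ReImE /= /powR gt_eqF//.
by rewrite !mul0r !subr0 !addr0 [ln t * _]mulrC [ln t * Im z]mulrC.
Qed.

Lemma Im_cpow (t : R) z : 0 < t -> Im (cpow t z) = t `^ Re z * sin (Im z * ln t).
Proof.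
move=> t0; rewrite /cpow /cexp !ReImE /= /powR gt_eqF//.
by rewrite !mul0r !subr0 !addr0 [ln t * _]mulrC [ln t * Im z]mulrC.
Qed.

Lemma cpow_real (t x : R) : 0 < t -> cpow t x%:C = (t `^ x)%:C.
Proof.
move=> t0; apply: complex_eq.
  by rewrite Re_cpow// !ReImE mul0r cos0 mulr1.
by rewrite Im_cpow// !ReImE mul0r sin0 mulr0.
Qed.

Lemma conj_cpow (t : R) z : conjc (cpow t z) = cpow t (conjc z).
Proof.
case: z => a b; rewrite /cpow /cexp; apply: complex_eq => /=.
  by rewrite !mul0r !subr0 !addr0 mulrN cosN.
by rewrite !mul0r !subr0 !addr0 mulrN sinN mulrN.
Qed.

End ComplexBasics.

(** * Real integrals: domination and dilation *)

Section RealIntegrals.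
Context {R : realType}.
Local Notation leb := (@lebesgue_measure R).
Implicit Types (D : set R) (f g : R -> R).

Lemma real_dct D (f_ : nat -> R -> R) f g : measurable D ->
  (forall n, measurable_fun D (f_ n)) ->
  (forall x, D x -> (f_ n x) @[n --> \oo] --> f x) ->
  leb.-integrable D (EFin \o g) ->
  (forall n x, D x -> `|f_ n x| <= g x) ->
  leb.-integrable D (EFin \o f) /\
  (\int[leb]_(x in D) f_ n x) @[n --> \oo] --> \int[leb]_(x in D) f x.
Proof.
move=> mD mf ff ig fg.
have mfl : measurable_fun D f by exact: (measurable_fun_cvg mf ff).
have [|||||intf _ H] := @dominated_convergence _ _ R leb D mD
  (fun n => EFin \o f_ n) (EFin \o f) (EFin \o g).
- by move=> n; apply/measurable_EFinP; exact: mf.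
- exact/measurable_EFinP.
- by apply: aeW => x Dx; apply: cvg_EFin; [exact: nearW|exact: ff].
- by [].
- by apply: aeW => x n Dx /=; rewrite lee_fin fg.
split => //.
apply: (@fine_cvg _ _ _ _ (fun n => (\int[leb]_(x in D) (f_ n x)%:E)%E)).
rewrite fineK//; exact: integrable_fin_num.
Qed.

Lemma le_real_integrable D f g : measurable D -> measurable_fun D f ->
  (forall x, D x -> `|f x| <= g x) -> leb.-integrable D (EFin \o g) ->
  leb.-integrable D (EFin \o f).
Proof.
move=> mD mf fg; apply: le_integrable => //; first exact/measurable_EFinP.
by move=> x Dx /=; rewrite lee_fin (le_trans (fg x Dx))// ler_norm.
Qed.

Lemma measurable_scale (a : R) : measurable_fun [set: R] (fun x : R => a * x).
Proof. by apply: measurable_funM => //; exact: measurable_cst. Qed.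

(** The dilated and rescaled measure agrees with Lebesgue measure on
    intervals, hence everywhere by uniqueness. *)
Lemma lebesgue_measure_scale (a : R) (A : set (measurableTypeR R)) : 0 < a -> measurable A ->
  leb A = (a%:E * leb ((fun x : R => a * x)%R @^-1` A))%E.
Proof.
move=> a0 mA.
pose phi : measurableTypeR R -> measurableTypeR R := fun x => a * x.
have mphi : measurable_fun setT phi by exact: measurable_scale.
pose m' := mscale (NngNum (ltW a0)) (pushforward leb phi).
change (leb A = m' mphi A); apply: lebesgue_measure_unique => //.
move=> _ [[c d]] /= _ <-.
rewrite /m' /mscale /pushforward /=.
rewrite (_ : pushforward leb phi _ = leb `]c / a, d / a]%classic); last first.
  congr (leb _); apply/seteqP; split => x /=; rewrite !in_itv /=;
  by rewrite ltr_pdivrMr// ler_pdivlMr// ![x * _]mulrC.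
rewrite !lebesgue_measure_itv/= !lte_fin ltr_pM2r ?invr_gt0//.
by case: ifPn => // _; rewrite ?mule0// -!EFinB -EFinM -mulrBl mulrCA divff ?mulr1// gt_eqF.
Qed.

Lemma ge0_integral_scale (a : R) (D : set (measurableTypeR R)) (f : R -> \bar R) : 0 < a ->
  measurable D -> measurable_fun D f -> (forall x, D x -> 0 <= f x)%E ->
  (\int[leb]_(x in D) f x =
   a%:E * \int[leb]_(x in (fun x => a * x)%R @^-1` D) f (a * x)%R)%E.
Proof.
move=> a0 mD mf f0.
pose phi : measurableTypeR R -> measurableTypeR R := fun x => a * x.
have mphi : measurable_fun setT phi by exact: measurable_scale.
pose m' := mscale (NngNum (ltW a0)) (pushforward leb phi).
rewrite (eq_measure_integral (m' mphi)); last first.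
  by move=> A mA _; exact: lebesgue_measure_scale.
rewrite ge0_integral_mscale//= ge0_integral_pushforward//.
by move=> y /set_mem /f0.
Qed.

(** A signed integrand is split into its positive and negative parts, to which
    the change of variables for nonnegative functions applies. *)
Lemma integral_scale (a : R) (D : set (measurableTypeR R)) f : 0 < a ->
  measurable D -> leb.-integrable D (EFin \o f) ->
  leb.-integrable ((fun x => a * x) @^-1` D) (EFin \o (fun x => f (a * x))) /\
  \int[leb]_(x in D) f x = a * \int[leb]_(x in (fun x => a * x) @^-1` D) f (a * x).
Proof.
move=> a0 mD intf.
have mf : measurable_fun D f by apply/measurable_EFinP; exact: measurable_int intf.
have mphi := @measurable_scale a.
have mD' : measurable ((fun x => a * x) @^-1` D).
  by rewrite -[X in measurable X]setTI; exact: mphi.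
have mD2 : (@measurable _ (measurableTypeR R)) ((fun x => a * x) @^-1` D) := mD'.
have mf' : measurable_fun ((fun x => a * x) @^-1` D) (fun x => f (a * x)).
  apply: (measurable_comp mD) => //; first by move=> _ [x /= Dx <-].
have if' : leb.-integrable ((fun x => a * x) @^-1` D) (EFin \o (fun x => f (a * x))).
  apply/integrableP; split; first exact/measurable_EFinP.
  move/integrableP : intf => [_].
  rewrite (ge0_integral_scale a0) //; last first.
    by do 2 apply: measurableT_comp => //.
  move=> h; rewrite ltNge; apply/negP; rewrite leye_eq => /eqP E.
  by move: h; rewrite /= E mulry gtr0_sg// mul1e ltxx.
split => //; rewrite /Rintegral integralE [in RHS]integralE.
have mE : measurable_fun D (EFin \o f) by exact/measurable_EFinP.
rewrite (ge0_integral_scale a0 mD (measurable_funepos mE)); last by [].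
rewrite (ge0_integral_scale a0 mD (measurable_funeneg mE)); last by [].
have Ep : (fun x => ((EFin \o f)^\+)%E (a * x)) = ((EFin \o (fun x => f (a * x)%R))^\+)%E.
  by apply/funext => x; rewrite !funeposE.
have En : (fun x => ((EFin \o f)^\-)%E (a * x)) = ((EFin \o (fun x => f (a * x)%R))^\-)%E.
  by apply/funext => x; rewrite !funenegE.
rewrite Ep En.
have ip := integrable_pos_fin_num mD2 if'.
have im := integrable_neg_fin_num mD2 if'.
have fineZB (x y : \bar R) : x \is a fin_num -> y \is a fin_num ->
    fine (a%:E * x - a%:E * y)%E = a * fine (x - y)%E.
  by case: x y => [x||] [y||] //= _ _; rewrite mulrBr.
exact: fineZB ip im.
Qed.

End RealIntegrals.

(** * The fundamental theorem of calculus on the half-line *)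

Section ImproperFTC.
Context {R : realType}.
Local Notation leb := (@lebesgue_measure R).
Local Notation pos := (`]0, +oo[%classic : set R).
Implicit Types (f g F G : R -> R).

Lemma integral_is_derive G g (a b : R) : a < b ->
  (forall x : R, a <= x <= b -> is_derive x 1 G (g x)) ->
  (forall x : R, a <= x <= b -> {for x, continuous g}) ->
  leb.-integrable `[a, b] (EFin \o g) /\
  \int[leb]_(x in `[a, b]) g x = G b - G a.
Proof.
move=> ab dG cg.
have cw : {within `[a, b], continuous g}.
  by apply: continuous_in_subspaceT => x /set_mem; rewrite /= in_itv; exact: cg.
have cG x : a <= x <= b -> {for x, continuous G}.
  move=> /dG [dx _]; apply: differentiable_continuous; exact/derivable1_diffP.
split; first exact: continuous_compact_integrable (@segment_compact _ a b) cw.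
rewrite /Rintegral (@continuous_FTC2 _ _ G)//.
- split=> [x /[!in_itv]/= /andP[ax xb]||].
  + by case: (dG x); rewrite ?ltW.
  + by apply: cvg_at_right_filter; apply: cG; rewrite lexx ltW.
  + by apply: cvg_at_left_filter; apply: cG; rewrite lexx ltW.
- move=> x /[!in_itv]/= /andP[ax xb]; rewrite derive1E.
  by case: (dG x) => [|_ ->]; rewrite ?ltW.
Qed.

(** Compact intervals that exhaust the open half-line, so that an improper
    integral is a limit of integrals of continuous functions over segments. *)
Definition exhaust (n : nat) : set R := `[n.+1%:R^-1, n.+2%:R]%classic.

Lemma exhaust_lt n : n.+1%:R^-1 < n.+2%:R :> R.
Proof.
by rewrite (@le_lt_trans _ _ 1)// ?ltr1n// invf_le1// ?ltr0n// ler1n.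
Qed.

Lemma exhaust_pos n x : exhaust n x -> 0 < x.
Proof. by rewrite /exhaust /= in_itv /= => /andP[+ _]; apply: lt_le_trans; rewrite invr_gt0. Qed.

Lemma exhaust_itv n (x : R) : n.+1%:R^-1 <= x <= n.+2%:R -> 0 < x.
Proof. by move=> h; apply: (@exhaust_pos n); rewrite /exhaust /= in_itv. Qed.

Lemma exhaustP x : 0 < x -> exists N, forall n, (N <= n)%N -> exhaust n x.
Proof.
move=> x0; exists (Num.truncn x + Num.truncn x^-1)%N => n Nn; rewrite /exhaust /= in_itv /=.
have h1 := @truncnS_gt R x; have h2 := @truncnS_gt R x^-1.
apply/andP; split.
  rewrite -[leRHS]invrK lef_pV2 ?posrE ?invr_gt0 ?ltr0n//.
  by apply: ltW; apply: lt_le_trans h2 _; rewrite ler_nat ltnS (leq_trans (leq_addl _ _) Nn).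
by apply: ltW; apply: lt_le_trans h1 _; rewrite ler_nat ltnS ltnW// ltnS (leq_trans (leq_addr _ _) Nn).
Qed.

Lemma measurable_pos : (@measurable _ (measurableTypeR R)) pos.
Proof. exact: measurable_itv. Qed.

Lemma measurable_exhaust n : (@measurable _ (measurableTypeR R)) (exhaust n).
Proof. exact: measurable_itv. Qed.

Lemma bigcup_exhaust : \bigcup_n exhaust n = pos.
Proof.
apply/seteqP; split => x.
  by move=> [n _ /exhaust_pos]; rewrite /= in_itv /= andbT.
rewrite /= in_itv /= andbT => /exhaustP[N /(_ N (leqnn N)) h].
by exists N.
Qed.

Lemma measurable_pos_continuous f :
  (forall x : R, 0 < x -> {for x, continuous f}) -> measurable_fun pos f.
Proof.
move=> cf; apply: open_continuous_measurable_fun.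
  exact: interval_open.
by move=> x /set_mem; rewrite /= in_itv /= andbT => /cf.
Qed.

(** A nonnegative function with a bounded primitive is integrable: monotone
    convergence along the exhaustion, where every partial integral is an
    increment of the primitive.  This is the source of the two basic
    integrable functions, [dom] here and x^(-b-1) on [1, +oo[ below. *)
Lemma ge0_integrable_primitive G g (M : R) :
  (forall x : R, 0 < x -> is_derive x 1 G (g x)) ->
  (forall x : R, 0 < x -> {for x, continuous g}) ->
  (forall x : R, 0 < x -> 0 <= g x) ->
  (forall x : R, 0 < x -> `|G x| <= M) ->
  leb.-integrable pos (EFin \o g).
Proof.
move=> dG cg g0 GM.
have mg := measurable_pos_continuous cg.
apply/integrableP; split; first exact/measurable_EFinP.
rewrite (eq_integral (fun x : measurableTypeR R => (g x)%:E)); last first.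
  move=> x /set_mem; rewrite /= in_itv /= andbT => /g0 gx0.
  by rewrite /= ger0_norm.
rewrite -bigcup_exhaust.
have h : (\int[leb]_(x in exhaust n) (g x)%:E)%E @[n --> \oo] -->
    (\int[leb]_(x in \bigcup_n exhaust n) (g x)%:E)%E.
  apply: (@ge0_nondecreasing_set_cvg_integral _ (measurableTypeR R) R exhaust (fun x => (g x)%:E) leb).
  - move=> n m nm; apply/subsetPset => x; rewrite /exhaust /= !in_itv /= => /andP[h1 h2].
    apply/andP; split.
      by apply: le_trans h1; rewrite lef_pV2 ?posrE// ler_nat.
    by apply: le_trans h2 _; rewrite ler_nat.
  - by move=> i; exact: measurable_itv.
  - move=> i; apply/measurable_EFinP; apply: measurable_funS mg => //.
    by move=> x /exhaust_pos; rewrite /= in_itv /= andbT.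
  - by move=> i x /exhaust_pos /g0; rewrite lee_fin.
apply: (@le_lt_trans _ _ (M + M)%:E); last exact: ltry.
rewrite -(cvg_lim _ h)//; apply: lime_le; first by apply/cvg_ex; eexists; exact: h.
apply: nearW => n.
have [ig E] := integral_is_derive (exhaust_lt n)
  (fun x h' => dG x (exhaust_itv h')) (fun x h' => cg x (exhaust_itv h')).
rewrite -[leLHS]fineK; last exact: (integrable_fin_num (measurable_exhaust n) ig).
rewrite -/(Rintegral _ _ _) E.
rewrite lee_fin (le_trans (ler_norm _))// (le_trans (ler_normB _ _))//.
by rewrite lerD// GM// invr_gt0.
Qed.

(** The common dominator of the Mellin integrands on the line Re z = 1/2: it is
    the product of |u^(z-1)| with a function of size 1/(1+u).  It is
    integrable at both ends, and x * dom x, which dominates E(f), tends to 0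
    at both ends. *)
Definition dom (x : R) : R := (Num.sqrt x * (1 + x))^-1.

Lemma dom_ge0 x : 0 < x -> 0 <= dom x.
Proof. by move=> x0; rewrite invr_ge0 mulr_ge0 ?sqrtr_ge0// addr_ge0// ltW. Qed.

Lemma derivable_continuous f (x l : R) : is_derive x 1 f l -> {for x, continuous f}.
Proof. by move=> [dx _]; apply: differentiable_continuous; exact/derivable1_diffP. Qed.

(** The primitive is 2 atan(sqrt x). *)
Lemma integrable_dom : leb.-integrable pos (EFin \o dom).
Proof.
apply: (@ge0_integrable_primitive (fun x => 2 * atan (Num.sqrt x)) dom (2 * pi)).
- move=> x x0.
  have ds := is_derive1_sqrt x0; have da := is_derive1_atan (Num.sqrt x).
  apply: is_derive_eq.
  rewrite sqr_sqrtr ?ltW//.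
  rewrite /dom; change (2 * ((1 + x)^-1 / (2 * Num.sqrt x)) = (Num.sqrt x * (1 + x))^-1).
  have s0 : Num.sqrt x != 0 by rewrite gt_eqF// sqrtr_gt0.
  have x1 : 1 + x != 0 by rewrite gt_eqF// addr_gt0.
  by field; rewrite s0 x1.
- move=> x x0; apply: continuousV.
    by rewrite gt_eqF// mulr_gt0 ?sqrtr_gt0// addr_gt0.
  apply: continuousM; first exact: sqrt_continuous.
  by apply: continuousD; [exact: cvg_cst|exact: cvg_id].
- exact: dom_ge0.
- move=> x x0; rewrite normrM ger0_norm// ler_pM2l// ler_norml.
  have := @atan_ltpi2 R (Num.sqrt x); have := @atan_gtNpi2 R (Num.sqrt x).
  have := @pi_gt0 R; rewrite /= => ? ? ?; apply/andP; split; lra.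
Qed.

Lemma id_dom_le_sqrt (x : R) : 0 < x -> x * dom x <= Num.sqrt x.
Proof.
move=> x0; rewrite /dom -{1}(sqr_sqrtr (ltW x0)) expr2 invfM mulrACA divff ?gt_eqF ?sqrtr_gt0//.
rewrite mul1r ler_pdivrMr ?addr_gt0// ler_peMr ?sqrtr_ge0// lerDl; exact: ltW.
Qed.

Lemma id_dom_le_sqrtV (x : R) : 0 < x -> x * dom x <= (Num.sqrt x)^-1.
Proof.
move=> x0; rewrite /dom invfM mulrCA ler_piMr ?invr_ge0 ?sqrtr_ge0//.
by rewrite ler_pdivrMr ?addr_gt0// mul1r lerDr.
Qed.

Lemma cvg_sqrt_harmonic : Num.sqrt (n.+1%:R^-1 : R) @[n --> \oo] --> (0 : R).
Proof.
rewrite -[X in _ --> X](@sqrtr0 R).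
by apply: continuous_cvg; [exact: sqrt_continuous|exact: cvg_harmonic].
Qed.

(** The bound by x * dom x makes the boundary terms vanish at 0 and at infinity.
    All integrations by parts on the half-line are instances. *)
Lemma FTC0 G g (K : R) :
  (forall x : R, 0 < x -> is_derive x 1 G (g x)) ->
  (forall x : R, 0 < x -> {for x, continuous g}) ->
  leb.-integrable pos (EFin \o g) ->
  (forall x : R, 0 < x -> `|G x| <= K * (x * dom x)) ->
  \int[leb]_(x in pos) g x = 0.
Proof.
move=> dG cg ig GK.
have mg := measurable_pos_continuous cg.
have K0 : 0 <= K.
  have := le_trans (normr_ge0 _) (GK 1 ltr01).
  by rewrite pmulr_lge0// mul1r invr_gt0 mulr_gt0 ?sqrtr_gt0// addr_gt0.
have [||||_ h] := @real_dct R pos (fun n => g \_ (exhaust n)) g (fun x => `|g x|) measurable_pos.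
- move=> n; apply: (measurable_restrict g _ _).1; [exact: measurable_itv|exact: measurable_itv|].
  by apply: measurable_funS mg; [exact: measurable_itv|exact: subIsetl].
- move=> x; rewrite /= in_itv /= andbT => /exhaustP[N hN].
  apply: cvg_near_cst; exists N => // n /= Nn.
  by rewrite patchE mem_set//; exact: hN.
- exact: (integrable_norm ig).
- by move=> n x _; rewrite patchE; case: ifPn; rewrite ?normr0.
have E n : \int[leb]_(x in pos) (g \_ (exhaust n)) x = G n.+2%:R - G n.+1%:R^-1.
  apply: etrans (esym (@Rintegral_mkcondr _ (measurableTypeR R) R leb pos (exhaust n) g)) _.
  rewrite setIidr; last by move=> x /exhaust_pos; rewrite /= in_itv /= andbT.
  exact: (integral_is_derive (exhaust_lt n)
    (fun x h' => dG x (exhaust_itv h')) (fun x h' => cg x (exhaust_itv h'))).2.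
suff H : \int[leb]_(x in pos) (g \_ (exhaust n)) x @[n --> \oo] --> (0 : R).
  exact: (cvg_unique _ h H).
rewrite (eq_cvg _ _ E).
apply/norm_cvg0P.
apply: (@squeeze_cvgr _ _ _ _ (fun=> 0) (fun n => (K + K) * Num.sqrt (n.+1%:R^-1))).
- apply: nearW => n; rewrite normr_ge0/= (le_trans (ler_normB _ _))// mulrDl lerD//.
    apply: le_trans (GK _ _) _ => //; rewrite ler_wpM2l//.
    apply: le_trans (id_dom_le_sqrtV _) _ => //.
    by rewrite -sqrtrV ?ler0n// ler_sqrt ?invr_gt0// lef_pV2 ?posrE// ler_nat.
  apply: le_trans (GK _ _) _; first by rewrite invr_gt0.
  by rewrite ler_wpM2l// id_dom_le_sqrt// invr_gt0.
- exact: cvg_cst.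
- rewrite -[X in _ --> X](mulr0 (K + K)); apply: cvgM; first exact: cvg_cst.
  exact: cvg_sqrt_harmonic.
Qed.

End ImproperFTC.

(** * Complex-valued integrals and derivatives *)

Section ComplexIntegrals.
Context {R : realType}.
Local Notation C := R[i].
Local Notation Re := (@complex.Re R).
Local Notation Im := (@complex.Im R).
Local Notation normc := (@ComplexField.Normc.normc R).
Local Notation leb := (@lebesgue_measure R).
Local Notation pos := (`]0, +oo[%classic : set R).
Implicit Types (D : set R) (f g : R -> C).

Definition cmeasurable D f := measurable_fun D (Re_fun f) /\ measurable_fun D (Im_fun f).

Definition cintegrable D f :=
  leb.-integrable D (EFin \o Re_fun f) /\ leb.-integrable D (EFin \o Im_fun f).

Lemma cmeasurable_cst D (c : C) : cmeasurable D (fun=> c).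
Proof. by split; exact: measurable_cst. Qed.

Lemma cmeasurableD D f g : cmeasurable D f -> cmeasurable D g ->
  cmeasurable D (fun x => f x + g x).
Proof.
move=> [rf jf] [rg jg]; split.
- rewrite (_ : Re_fun _ = Re_fun f \+ Re_fun g); first exact: measurable_funD.
  by apply/funext => x; rewrite /Re_fun ReD.
- rewrite (_ : Im_fun _ = Im_fun f \+ Im_fun g); first exact: measurable_funD.
  by apply/funext => x; rewrite /Im_fun ImD.
Qed.

Lemma cmeasurableM D f g : cmeasurable D f -> cmeasurable D g ->
  cmeasurable D (fun x => f x * g x).
Proof.
move=> [rf jf] [rg jg]; split.
- rewrite (_ : Re_fun _ = (Re_fun f \* Re_fun g) \- (Im_fun f \* Im_fun g)).
    by apply: measurable_funB; exact: measurable_funM.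
  by apply/funext => x; rewrite /Re_fun ReM.
- rewrite (_ : Im_fun _ = (Re_fun f \* Im_fun g) \+ (Im_fun f \* Re_fun g)).
    by apply: measurable_funD; exact: measurable_funM.
  by apply/funext => x; rewrite /Im_fun ImM.
Qed.

Lemma cmeasurable_conj D f : cmeasurable D f -> cmeasurable D (fun x => conjc (f x)).
Proof.
move=> [rf jf]; split.
- by rewrite (_ : Re_fun _ = Re_fun f)//; apply/funext => x; rewrite /Re_fun Re_conj.
- rewrite (_ : Im_fun _ = \- Im_fun f); first exact: measurable_funN.
  by apply/funext => x; rewrite /Im_fun Im_conj.
Qed.

Lemma cmeasurable_real D (f : R -> R) : measurable_fun D f ->
  cmeasurable D (fun x => (f x)%:C).
Proof. by split => //; exact: measurable_cst. Qed.

Lemma cmeasurable_sum D (F : nat -> R -> C) n : (forall i, cmeasurable D (F i)) ->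
  cmeasurable D (fun x => \sum_(0 <= i < n) F i x).
Proof.
move=> mF; elim: n => [|n ih].
  rewrite (_ : (fun _ => _) = fun=> 0); first exact: cmeasurable_cst.
  by apply/funext => x; rewrite big_nil.
rewrite (_ : (fun _ => _) = fun x => \sum_(0 <= i < n) F i x + F n x).
  exact: cmeasurableD.
by apply/funext => x; rewrite big_nat_recr.
Qed.

Lemma cmeasurableS D D' f : (@measurable _ (measurableTypeR R)) D' -> D `<=` D' ->
  cmeasurable D' f -> cmeasurable D f.
Proof. by move=> mD' DD' [rf jf]; split; [move: rf|move: jf]; exact: measurable_funS. Qed.

Lemma cintegrable_le D f (g : R -> R) : (@measurable _ (measurableTypeR R)) D -> cmeasurable D f ->
  (forall x, D x -> normc (f x) <= g x) -> leb.-integrable D (EFin \o g) ->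
  cintegrable D f.
Proof.
move=> mD [rf jf] fg ig; split; apply: le_real_integrable ig => // x Dx.
- exact: le_trans (normc_Re_le _) (fg x Dx).
- exact: le_trans (normc_Im_le _) (fg x Dx).
Qed.

Lemma cintegrable_measurable D f : cintegrable D f -> cmeasurable D f.
Proof. by move=> [rf jf]; split; apply/measurable_EFinP; [exact: measurable_int rf|exact: measurable_int jf]. Qed.

Lemma eq_cintegral D f g : (forall x, D x -> f x = g x) ->
  cintegral D f = cintegral D g.
Proof.
move=> fg; rewrite /cintegral.
by congr (_ +i* _); apply: eq_Rintegral => x /set_mem Dx; rewrite /Re_fun /Im_fun fg.
Qed.

Lemma eq_cintegrable D f g : (@measurable _ (measurableTypeR R)) D ->
  (forall x, D x -> f x = g x) -> cintegrable D f -> cintegrable D g.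
Proof.
move=> mD fg [rf jf]; split; [apply: eq_integrable rf|apply: eq_integrable jf] => // x /set_mem Dx.
- by rewrite /= /Re_fun fg.
- by rewrite /= /Im_fun fg.
Qed.

Lemma cintegrableD D f g : (@measurable _ (measurableTypeR R)) D ->
  cintegrable D f -> cintegrable D g -> cintegrable D (fun x => f x + g x).
Proof.
move=> mD [rf jf] [rg jg]; split.
- apply: eq_integrable (integrableD mD rf rg) => // x _.
  by rewrite /= /Re_fun ReD EFinD.
- apply: eq_integrable (integrableD mD jf jg) => // x _.
  by rewrite /= /Im_fun ImD EFinD.
Qed.

Lemma cintegralD D f g : (@measurable _ (measurableTypeR R)) D ->
  cintegrable D f -> cintegrable D g ->
  cintegral D (fun x => f x + g x) = cintegral D f + cintegral D g.
Proof.
move=> mD [rf jf] [rg jg]; apply: complex_eq; rewrite ?ReD ?ImD /=.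
- rewrite -RintegralD//; apply: eq_Rintegral => x _; exact: ReD.
- rewrite -RintegralD//; apply: eq_Rintegral => x _; exact: ImD.
Qed.

Lemma cintegrableZ D f (c : C) : (@measurable _ (measurableTypeR R)) D ->
  cintegrable D f -> cintegrable D (fun x => c * f x).
Proof.
move=> mD [rf jf]; split.
- apply: eq_integrable (integrableB mD (integrableZl mD (Re c) rf) (integrableZl mD (Im c) jf)) => // x _.
  by rewrite /= /Re_fun ReM EFinB !EFinM.
- apply: eq_integrable (integrableD mD (integrableZl mD (Re c) jf) (integrableZl mD (Im c) rf)) => // x _.
  by rewrite /= /Im_fun ImM EFinD !EFinM.
Qed.

Lemma cintegralZ D f (c : C) : (@measurable _ (measurableTypeR R)) D ->
  cintegrable D f -> cintegral D (fun x => c * f x) = c * cintegral D f.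
Proof.
move=> mD [rf jf]; apply: complex_eq; rewrite ?ReM ?ImM /=.
- rewrite -!RintegralZl// -RintegralB//; last 2 first.
  + by apply: eq_integrable (integrableZl mD (Re c) rf) => // x _; rewrite /= EFinM.
  + by apply: eq_integrable (integrableZl mD (Im c) jf) => // x _; rewrite /= EFinM.
  by apply: eq_Rintegral => x _; exact: ReM.
- rewrite -!RintegralZl// -RintegralD//; last 2 first.
  + by apply: eq_integrable (integrableZl mD (Re c) jf) => // x _; rewrite /= EFinM.
  + by apply: eq_integrable (integrableZl mD (Im c) rf) => // x _; rewrite /= EFinM.
  by apply: eq_Rintegral => x _; exact: ImM.
Qed.

Lemma cintegrable0 D : cintegrable D (fun=> 0).
Proof. by split; exact: integrable0. Qed.

Lemma cintegral0 D : cintegral D (fun=> 0) = 0 :> C.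
Proof. by rewrite /cintegral /Re_fun /Im_fun /= /Rintegral integral0. Qed.

Lemma cintegral_sum D (F : nat -> R -> C) n : (@measurable _ (measurableTypeR R)) D ->
  (forall i, cintegrable D (F i)) ->
  cintegrable D (fun x => \sum_(0 <= i < n) F i x) /\
  cintegral D (fun x => \sum_(0 <= i < n) F i x) =
  \sum_(0 <= i < n) cintegral D (F i).
Proof.
move=> mD iF; elim: n => [|n [ih1 ih2]].
  rewrite (_ : (fun _ => _) = fun=> 0); last by apply/funext => x; rewrite big_nil.
  by rewrite big_nil cintegral0; split => //; exact: cintegrable0.
rewrite (_ : (fun _ => _) = fun x => \sum_(0 <= i < n) F i x + F n x).
  rewrite big_nat_recr//= -ih2; split; first exact: cintegrableD.
  exact: cintegralD.
by apply/funext => x; rewrite big_nat_recr.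
Qed.

Lemma cintegral_dct D (F : nat -> R -> C) f (g : R -> R) :
  (@measurable _ (measurableTypeR R)) D ->
  (forall n, cmeasurable D (F n)) ->
  (forall x, D x -> ccvg (F ^~ x) (f x)) ->
  leb.-integrable D (EFin \o g) ->
  (forall n x, D x -> normc (F n x) <= g x) ->
  cintegrable D f /\ ccvg (fun n => cintegral D (F n)) (cintegral D f).
Proof.
move=> mD mF cF ig Fg.
have [i1 c1] := @real_dct R D (fun n => Re_fun (F n)) (Re_fun f) g mD
  (fun n => (mF n).1) (fun x Dx => (cF x Dx).1) ig
  (fun n x Dx => le_trans (normc_Re_le _) (Fg n x Dx)).
have [i2 c2] := @real_dct R D (fun n => Im_fun (F n)) (Im_fun f) g mD
  (fun n => (mF n).2) (fun x Dx => (cF x Dx).2) ig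
  (fun n x Dx => le_trans (normc_Im_le _) (Fg n x Dx)).
by [].
Qed.

Lemma cintegral_scale (a : R) D f : 0 < a -> (@measurable _ (measurableTypeR R)) D ->
  cintegrable D f ->
  cintegrable ((fun x => a * x) @^-1` D) (fun x => f (a * x)) /\
  cintegral D f = a%:C * cintegral ((fun x => a * x) @^-1` D) (fun x => f (a * x)).
Proof.
move=> a0 mD [rf jf].
have [ir er] := integral_scale a0 mD rf; have [ij ej] := integral_scale a0 mD jf.
split; first by [].
by apply: complex_eq; rewrite ?ReM ?ImM /= ?er ?ej mul0r ?subr0 ?addr0.
Qed.

Lemma scale_pos (a : R) : 0 < a -> (fun x => a * x) @^-1` pos = pos.
Proof.
by move=> a0; apply/seteqP; split => x /=; rewrite !in_itv /= !andbT pmulr_rgt0.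
Qed.

Lemma conj_cintegral D f : (@measurable _ (measurableTypeR R)) D -> cintegrable D f ->
  conjc (cintegral D f) = cintegral D (fun x => conjc (f x)).
Proof.
move=> mD [rf jf]; apply: complex_eq; rewrite ?Re_conj ?Im_conj /=.
  by apply: eq_Rintegral => x _; rewrite /Re_fun Re_conj.
rewrite -mulN1r -RintegralZl//.
by apply: eq_Rintegral => x _; rewrite /Im_fun Im_conj mulN1r.
Qed.

Definition cderiv f (x : R) (l : C) :=
  is_derive x 1 (Re_fun f) (Re l) /\ is_derive x 1 (Im_fun f) (Im l).

Definition ccont f (x : R) := {for x, continuous (Re_fun f)} /\ {for x, continuous (Im_fun f)}.

Lemma cderiv_cont f x l : cderiv f x l -> ccont f x.
Proof. by move=> [rf jf]; split; apply: derivable_continuous; eassumption. Qed.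

Lemma ccontM f g x : ccont f x -> ccont g x -> ccont (fun u => f u * g u) x.
Proof.
move=> [rf jf] [rg jg]; split.
- rewrite (_ : Re_fun _ = (fun y => Re_fun f y * Re_fun g y - Im_fun f y * Im_fun g y)).
    by apply: continuousB; exact: continuousM.
  by apply/funext => y; rewrite /Re_fun ReM.
- rewrite (_ : Im_fun _ = (fun y => Re_fun f y * Im_fun g y + Im_fun f y * Re_fun g y)).
    by apply: continuousD; exact: continuousM.
  by apply/funext => y; rewrite /Im_fun ImM.
Qed.

Lemma ccontD f g x : ccont f x -> ccont g x -> ccont (fun u => f u + g u) x.
Proof.
move=> [rf jf] [rg jg]; split.
- rewrite (_ : Re_fun _ = (fun y => Re_fun f y + Re_fun g y)).
    exact: continuousD.
  by apply/funext => y; rewrite /Re_fun ReD.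
- rewrite (_ : Im_fun _ = (fun y => Im_fun f y + Im_fun g y)).
    exact: continuousD.
  by apply/funext => y; rewrite /Im_fun ImD.
Qed.

Lemma ccont_real (f : R -> R) x : {for x, continuous f} -> ccont (fun u => (f u)%:C) x.
Proof. by move=> cf; split => //; exact: cvg_cst. Qed.

Lemma ccont_cst (c : C) x : ccont (fun=> c) x.
Proof. by split; exact: cvg_cst. Qed.

Lemma cderivM f g x (a b : C) : cderiv f x a -> cderiv g x b ->
  cderiv (fun u => f u * g u) x (a * g x + f x * b).
Proof.
move=> [rf jf] [rg jg]; split.
- rewrite (_ : Re_fun _ = (Re_fun f * Re_fun g - Im_fun f * Im_fun g)); last first.
    by apply/funext => y; rewrite /Re_fun ReM.
  apply: is_derive_eq (is_deriveB (is_deriveM rf rg) (is_deriveM jf jg)) _; rewrite !ReImE /Re_fun /Im_fun /GRing.scale /=; ring.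
- rewrite (_ : Im_fun _ = (Re_fun f * Im_fun g + Im_fun f * Re_fun g)); last first.
    by apply/funext => y; rewrite /Im_fun ImM.
  apply: is_derive_eq (is_deriveD (is_deriveM rf jg) (is_deriveM jf rg)) _; rewrite !ReImE /Re_fun /Im_fun /GRing.scale /=; ring.
Qed.

Lemma cderivD f g x (a b : C) : cderiv f x a -> cderiv g x b ->
  cderiv (fun u => f u + g u) x (a + b).
Proof.
move=> [rf jf] [rg jg]; split.
- rewrite (_ : Re_fun _ = (Re_fun f + Re_fun g)); last first.
    by apply/funext => y; rewrite /Re_fun ReD.
  by apply: is_derive_eq; rewrite ReD.
- rewrite (_ : Im_fun _ = (Im_fun f + Im_fun g)); last first.
    by apply/funext => y; rewrite /Im_fun ImD.
  by apply: is_derive_eq; rewrite ImD.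
Qed.

Lemma cderiv_real (f : R -> R) (x l : R) : is_derive x 1 f l -> cderiv (fun u => (f u)%:C) x l%:C.
Proof. by move=> df; split => //; exact: is_derive_cst. Qed.

Lemma cderiv_cst (c : C) x : cderiv (fun=> c) x 0.
Proof. by split; exact: is_derive_cst. Qed.

Lemma cpowE (u : R) (z : C) :
  cpow u z = (expR (Re z * ln u) * cos (Im z * ln u)) +i* (expR (Re z * ln u) * sin (Im z * ln u)).
Proof.
case: z => a b; rewrite /cpow /cexp; apply: complex_eq => /=;
by rewrite !mul0r !subr0 !addr0 ![ln u * _]mulrC.
Qed.

Lemma cpowB1 (u : R) (z : C) : 0 < u -> cpow u (z - 1) = (u^-1)%:C * cpow u z.
Proof.
move=> u0; rewrite cpowD mulrC; congr (_ * _).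
rewrite (_ : - 1 = (- 1)%:C); last by rewrite rmorphN.
by rewrite cpow_real// powR_inv1// ltW.
Qed.

Lemma cderiv_cpow (z : C) (x : R) : 0 < x ->
  cderiv (fun u => cpow u z) x (z * cpow x (z - 1)).
Proof.
move=> x0; have dl := is_derive1_ln x0; rewrite cpowB1//.
have dE : is_derive x 1 (fun u : R => expR (Re z * ln u)) (Re z * x^-1 * expR (Re z * ln x)).
  apply: is_derive_eq; rewrite /GRing.scale /=; ring.
split.
- rewrite (_ : Re_fun _ = (fun u => expR (Re z * ln u) * cos (Im z * ln u))); last first.
    by apply/funext => y; rewrite /Re_fun cpowE.
  apply: is_derive_eq; rewrite cpowE; case: z {dE} => a b; rewrite /GRing.scale /=; ring.
- rewrite (_ : Im_fun _ = (fun u => expR (Re z * ln u) * sin (Im z * ln u))); last first.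
    by apply/funext => y; rewrite /Im_fun cpowE.
  apply: is_derive_eq; rewrite cpowE; case: z {dE} => a b; rewrite /GRing.scale /=; ring.
Qed.

Lemma ccont_cpow (z : C) (x : R) : 0 < x -> ccont (fun u => cpow u z) x.
Proof. by move=> /(cderiv_cpow z) /cderiv_cont. Qed.

Lemma cFTC0 f g (K : R) :
  (forall x : R, 0 < x -> cderiv f x (g x)) ->
  (forall x : R, 0 < x -> ccont g x) ->
  cintegrable pos g ->
  (forall x : R, 0 < x -> normc (f x) <= K * (x * dom x)) ->
  cintegral pos g = 0.
Proof.
move=> df cg [rg jg] fK; apply: complex_eq => /=.
- apply: (@FTC0 R (Re_fun f) _ K) => // x x0; first exact: (df x x0).1.
    exact: (cg x x0).1.
  exact: le_trans (normc_Re_le _) (fK x x0).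
- apply: (@FTC0 R (Im_fun f) _ K) => // x x0; first exact: (df x x0).2.
    exact: (cg x x0).2.
  exact: le_trans (normc_Im_le _) (fK x x0).
Qed.

Lemma cmeasurable_pos_cont f : (forall x : R, 0 < x -> ccont f x) -> cmeasurable pos f.
Proof. by move=> cf; split; apply: measurable_pos_continuous => x /cf[]. Qed.

Lemma cintegral_is_derive f g (a b : R) : a < b ->
  (forall x : R, a <= x <= b -> cderiv f x (g x)) ->
  (forall x : R, a <= x <= b -> ccont g x) ->
  cintegrable `[a, b] g /\ cintegral `[a, b] g = f b - f a.
Proof.
move=> ab df cg.
have [ir er] := integral_is_derive ab (fun x h => (df x h).1) (fun x h => (cg x h).1).
have [ij ej] := integral_is_derive ab (fun x h => (df x h).2) (fun x h => (cg x h).2).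
by split => //; apply: complex_eq; rewrite /= ?er ?ej !ReImE.
Qed.

End ComplexIntegrals.

(** * Summation over dilates and its Mellin transform *)

Section Tame.
Context {R : realType}.
Local Notation C := R[i].
Local Notation Re := (@complex.Re R).
Local Notation normc := (@ComplexField.Normc.normc R).
Local Notation leb := (@lebesgue_measure R).
Local Notation pos := (`]0, +oo[%classic : set R).
Implicit Types (f g F G : R -> R).

(** The primitive of K/(1+t)^2 is -K/(1+t), and the mean value theorem applied
    to +-G + K/(1+t) shows that G varies less than this primitive. *)
Lemma derive_dominated_increment G g (K x y : R) :
  (forall t : R, is_derive t 1 G (g t)) ->
  (forall t : R, 0 <= t -> `|g t| <= K / (1 + t) ^+ 2) ->
  0 <= x -> x <= y -> `|G y - G x| <= K * ((1 + x)^-1 - (1 + y)^-1).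
Proof.
move=> dG gK x0; rewrite le_eqVlt => /predU1P[->|xy].
  by rewrite !subrr normr0 mulr0.
have main (e : R) : `|e| = 1 -> e * (G y - G x) <= K * ((1 + x)^-1 - (1 + y)^-1).
  move=> e1.
  pose H := fun t : R => e * G t + K * (1 + t)^-1.
  have dH (t : R) : 0 <= t -> is_derive t 1 H (e * g t - K / (1 + t) ^+ 2).
    move=> t0; have t1 : 1 + t != 0 by rewrite gt_eqF// ltr_pwDl.
    rewrite /H; apply: is_derive_eq.
    by rewrite /GRing.scale /=; field.
  have [||c] := @MVT_segment R H (fun t => e * g t - K / (1 + t) ^+ 2) x y (ltW xy).
  - move=> t /[!in_itv]/= /andP[xt _]; apply: dH; exact: le_trans x0 (ltW xt).
  - apply: continuous_in_subspaceT => t /set_mem; rewrite /= in_itv /= => /andP[xt _].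
    by apply: derivable_continuous (dH t _); exact: le_trans x0 xt.
  rewrite in_itv /= => /andP[xc _] E.
  have c0 : 0 <= c := le_trans x0 xc.
  have : H y - H x <= 0.
    rewrite E; apply: mulr_le0_ge0; last by rewrite subr_ge0 ltW.
    rewrite subr_le0 (le_trans (ler_norm _))// normrM e1 mul1r; exact: gK.
  rewrite /H; lra.
rewrite ler_norml; apply/andP; split.
- by have := main (-1); rewrite normrN1 => /(_ erefl); lra.
- by have := main 1; rewrite normr1 => /(_ erefl); lra.
Qed.

(** What the summation formula uses of an even Schwartz function with integral
    zero: quadratic decay of f and of its derivative on the half-line, and a
    primitive F that vanishes both at 0 and at infinity. *)
Record tame f F (K : R) : Prop := Tame {
  tame_deriv : exists2 f' : R -> R, (forall t : R, is_derive t 1 f (f' t))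
     & forall t : R, 0 <= t -> `|f' t| <= K / (1 + t) ^+ 2;
  tame_bound : forall t : R, 0 <= t -> `|f t| <= K / (1 + t) ^+ 2;
  tame_prim : forall t : R, is_derive t 1 F (f t);
  tame_prim0 : F 0 = 0;
  tame_prim_oo : F x @[x --> +oo] --> (0 : R) }.

Section tame.
Variables (f F : R -> R) (K : R).
Hypothesis tf : tame f F K.

Lemma tame_incr x y : 0 <= x -> x <= y -> `|f y - f x| <= K * ((1 + x)^-1 - (1 + y)^-1).
Proof. by case: (tame_deriv tf) => f' df bf; exact: derive_dominated_increment df bf. Qed.

Lemma tame_prim_bound v : 0 <= v -> `|F v| <= K * (v / (1 + v)).
Proof.
move=> v0; have := derive_dominated_increment (tame_prim tf) (tame_bound tf) (lexx 0) v0.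
rewrite (tame_prim0 tf) subr0 addr0 invr1 => /le_trans; apply.
have v1 : 1 + v != 0 by rewrite gt_eqF// ltr_pwDl.
by rewrite le_eqVlt; apply/orP; left; apply/eqP; field.
Qed.

Lemma tame_K_ge0 : 0 <= K.
Proof.
have := le_trans (normr_ge0 _) (tame_bound tf (lexx 0)).
by rewrite addr0 expr1n divr1.
Qed.

(** The sum of the dilates minus 1/u times the integral of f over [0, Nu]. *)
Definition riemann_error N (u : R) := \sum_(0 <= i < N) f (i.+1%:R * u) - F (N%:R * u) / u.

Lemma riemann_error_telescope N u : 0 < u ->
  riemann_error N u = \sum_(0 <= i < N) (f (i.+1%:R * u) - (F (i.+1%:R * u) - F (i%:R * u)) / u).
Proof.
move=> u0; rewrite /riemann_error sumrB -mulr_suml telescope_sumr//.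
by rewrite mul0r (tame_prim0 tf) subr0.
Qed.

Lemma telescope_inv_le N (u : R) : 0 < u ->
  \sum_(0 <= i < N) ((1 + i%:R * u)^-1 - (1 + i.+1%:R * u)^-1) <= 1.
Proof.
move=> u0; rewrite -[leLHS]opprK -sumrN.
under eq_bigr do rewrite opprB.
rewrite telescope_sumr// mul0r addr0 invr1 opprB lerBlDr lerDl invr_ge0.
by rewrite addr_ge0// mulr_ge0// ltW.
Qed.

(** The mean of f over [iu, (i+1)u] is a value of f there, and its distance to
    f((i+1)u) is at most the increment of -K/(1+t) over this interval; these
    increments add up to at most K. *)
Lemma riemann_error_le N u : 0 < u -> `|riemann_error N u| <= K.
Proof.
move=> u0; rewrite riemann_error_telescope// (le_trans (ler_norm_sum _ _ _))//.
rewrite -[leRHS]mulr1 (le_trans _ (ler_wpM2l tame_K_ge0 (telescope_inv_le N u0)))//.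
rewrite mulr_sumr; apply: ler_sum => i _.
have i0 : 0 <= i%:R * u by rewrite mulr_ge0// ltW.
have ii : i%:R * u < i.+1%:R * u by rewrite ltr_pM2r// ltr_nat.
have [||c] := @MVT_segment R F f (i%:R * u) (i.+1%:R * u) (ltW ii).
- by move=> t _; exact: (tame_prim tf).
- apply: continuous_in_subspaceT => t _; exact: derivable_continuous (tame_prim tf t).
rewrite in_itv /= => /andP[ic ci] ->.
have -> : i.+1%:R * u - i%:R * u = u by rewrite -natr1; ring.
rewrite mulfK ?gt_eqF// (le_trans (tame_incr _ ci))// ?(le_trans i0)//.
rewrite ler_wpM2l ?tame_K_ge0// lerD2r lef_pV2 ?posrE ?lerD2l//.
  by rewrite ltr_pwDl// (le_trans i0).
by rewrite ltr_pwDl.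
Qed.

(** 1/(1+t)^2 is at most 1/u times the increment of -1/(1+x) over the interval of
    length u that ends at t, so this sum telescopes too. *)
Lemma sum_tame_le N u : 0 < u -> \sum_(0 <= i < N) `|f (i.+1%:R * u)| <= K / u.
Proof.
move=> u0; have K0 := tame_K_ge0.
apply: (@le_trans _ _ (K / u * \sum_(0 <= i < N) ((1 + i%:R * u)^-1 - (1 + i.+1%:R * u)^-1))).
  rewrite mulr_sumr; apply: ler_sum => i _.
  apply: le_trans (tame_bound tf _) _; first by rewrite mulr_ge0// ltW.
  set a := 1 + i%:R * u; have a0 : 0 < a by rewrite ltr_pwDl// mulr_ge0// ltW.
  have -> : 1 + i.+1%:R * u = a + u by rewrite /a -natr1; ring.
  have au : 0 < a + u by rewrite addr_gt0.
  have -> : K / u * (a^-1 - (a + u)^-1) = K * (a * (a + u))^-1.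
    by field; rewrite !gt_eqF.
  rewrite ler_wpM2l// lef_pV2 ?posrE ?exprn_gt0 ?mulr_gt0// expr2.
  by rewrite ler_wpM2r ?(ltW au)// lerDl ltW.
rewrite -[leRHS]mulr1 ler_wpM2l//; last exact: telescope_inv_le.
by rewrite divr_ge0// ltW.
Qed.

(** Uniform in N, this is the domination that lets the limit be taken under the
    Mellin integral: the bound by K serves near 0, and for u large the two
    terms of the error are each at most K/u. *)
Lemma riemann_error_dom N u : 0 < u -> `|riemann_error N u| <= 3 * K / (1 + u).
Proof.
move=> u0; rewrite ler_pdivlMr ?addr_gt0// mulrDr mulr1.
have h1 := riemann_error_le N u0.
have h2 : `|riemann_error N u| * u <= 2 * K.
  rewrite -ler_pdivlMr// (le_trans (ler_normB _ _))//.
  have -> : 2 * K / u = K / u + K / u by ring.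
  rewrite lerD// ?(le_trans (ler_norm_sum _ _ _)) ?sum_tame_le//.
  rewrite normrM normfV (gtr0_norm u0) ler_pM2r ?invr_gt0//.
  have N0 : 0 <= N%:R * u by rewrite mulr_ge0// ltW.
  rewrite (le_trans (tame_prim_bound N0))// ler_piMr ?tame_K_ge0//.
  by rewrite ler_pdivrMr ?mul1r ?lerDr// ltr_pwDl.
lra.
Qed.

Definition dilation_sum (u : R) := limn (series (fun i => f (i.+1%:R * u))).

Lemma cvg_dilation_sum u : 0 < u -> series (fun i => f (i.+1%:R * u)) @ \oo --> dilation_sum u.
Proof.
move=> u0; apply: normed_cvg.
apply: nondecreasing_is_cvgn.
  by apply: nondecreasing_series => n _ _ /=.
exists (K / u) => _ [n _ <-]; exact: sum_tame_le.
Qed.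

(** F tends to 0 at infinity, so the correction term disappears in the limit. *)
Lemma cvg_riemann_error u : 0 < u -> riemann_error N u @[N --> \oo] --> dilation_sum u.
Proof.
move=> u0; rewrite -[X in _ --> X]subr0.
apply: cvgB; first exact: cvg_dilation_sum.
rewrite -[X in _ --> X](mul0r u^-1); apply: cvgM; last exact: cvg_cst.
apply: (cvg_comp (fun N : nat => N%:R * u) F _ (tame_prim_oo tf)).
apply/cvgryPge => A.
by near do rewrite -ler_pdivrMr//; exact: nbhs_infty_ger.
Unshelve. all: by end_near. Qed.

Lemma dilation_sum_dom u : 0 < u -> `|dilation_sum u| <= 3 * K / (1 + u).
Proof.
move=> u0; have h : `|riemann_error N u| @[N --> \oo] --> `|dilation_sum u| by apply: cvg_norm; exact: cvg_riemann_error.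
rewrite -(cvg_lim _ h)//; apply: limr_le; first by apply/cvg_ex; eexists; exact: h.
by apply: nearW => n; exact: riemann_error_dom.
Qed.

Lemma cont_tame y : {for y, continuous f}.
Proof. by case: (tame_deriv tf) => f' df _; exact: derivable_continuous (df y). Qed.

Lemma cont_prim y : {for y, continuous F}.
Proof. exact: derivable_continuous (tame_prim tf y). Qed.

Lemma measurable_tame_scale (g : R -> R) a : (forall y, {for y, continuous g}) ->
  measurable_fun pos (fun u => g (a * u)).
Proof.
move=> cg; apply: measurableT_comp.
  by apply: continuous_measurable_fun => y; exact: cg.
apply: (@measurable_funS _ _ (measurableTypeR R) (measurableTypeR R) setT) => //.
Qed.

Lemma measurable_inv : measurable_fun pos (fun u : R => u^-1).
Proof.
apply: measurable_pos_continuous => x x0; apply: continuousV.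
  by rewrite gt_eqF.
exact: cvg_id.
Qed.

Lemma measurable_riemann_error N : measurable_fun pos (riemann_error N).
Proof.
apply: measurable_funB.
  apply: measurable_sum => i; apply: measurable_tame_scale; exact: cont_tame.
apply: measurable_funM; last exact: measurable_inv.
by apply: measurable_tame_scale; exact: cont_prim.
Qed.

Lemma measurable_dilation_sum : measurable_fun pos dilation_sum.
Proof.
apply: (@measurable_fun_cvg _ _ R pos (fun N => riemann_error N)); last first.
  by move=> x; rewrite /= in_itv /= andbT => /cvg_riemann_error.
exact: measurable_riemann_error.
Qed.

Section mellin.
Local Opaque cintegral.
Variable z : C.
Hypothesis zhalf : Re z = 2^-1.

Definition mellin_of (g : R -> R) (w : C) : C := cintegral pos (fun u => (g u)%:C * cpow u (w - 1)).

Lemma normc_cpow_half u : 0 < u -> normc (cpow u (z - 1)) = (Num.sqrt u)^-1.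
Proof.
move=> u0; rewrite normc_cpow// !ReImE zhalf.
rewrite (_ : 2^-1 - 1 = - 2^-1); last by field.
by rewrite powRN powR12_sqrt// ltW.
Qed.

Lemma cmeasurable_cpow w : cmeasurable pos (fun u : R => cpow u w).
Proof. by apply: cmeasurable_pos_cont => x; exact: ccont_cpow. Qed.

Lemma integrable_domZ (k : R) : leb.-integrable pos (EFin \o (fun x => k * dom x)).
Proof.
exact: (integrableZl (@measurable_pos R) k (@integrable_dom R)).
Qed.

Lemma mellin_bound_le (g : R -> R) (k u : R) : 0 < u -> `|g u| <= k / (1 + u) ->
  normc ((g u)%:C * cpow u (z - 1)) <= k * dom u.
Proof.
move=> u0 gk; rewrite normcM normc_real normc_cpow_half// /dom invfM mulrCA mulrC.
by rewrite ler_wpM2l ?invr_ge0 ?sqrtr_ge0.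
Qed.

Lemma cintegrable_mellin (g : R -> R) (k : R) : measurable_fun pos g ->
  (forall u, 0 < u -> `|g u| <= k / (1 + u)) ->
  cintegrable pos (fun u => (g u)%:C * cpow u (z - 1)).
Proof.
move=> mg gk; apply: (cintegrable_le (@measurable_pos R) _ _ (integrable_domZ k)).
  apply: cmeasurableM; [exact: cmeasurable_real|exact: cmeasurable_cpow].
by move=> u; rewrite /= in_itv /= andbT => u0; exact: mellin_bound_le (gk u u0).
Qed.

Lemma ccvg_mellin_riemann_error :
  ccvg (fun N => mellin_of (riemann_error N.+1) z) (mellin_of dilation_sum z).
Proof.
apply: (cintegral_dct (@measurable_pos R) _ _ (integrable_domZ (3 * K)) _).2.
- move=> n; apply: cmeasurableM; last exact: cmeasurable_cpow.
  by apply: cmeasurable_real; exact: measurable_riemann_error.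
- move=> u; rewrite /= in_itv /= andbT => u0.
  apply: ccvgM; last exact: ccvg_cst.
  apply: ccvg_real; have := cvg_riemann_error u0.
  by rewrite -cvg_shiftS.
- by move=> n u; rewrite /= in_itv /= andbT => u0; exact: mellin_bound_le (riemann_error_dom _ u0).
Qed.

Lemma cmellin_scale (g : R -> R) (a : R) : 0 < a ->
  cintegrable pos (fun u => (g u)%:C * cpow u (z - 1)) ->
  cintegrable pos (fun u => (g (a * u))%:C * cpow u (z - 1)) /\
  mellin_of (fun u => g (a * u)) z = cpow a (- z) * mellin_of g z.
Proof.
move=> a0 ig.
have [] := cintegral_scale a0 (@measurable_pos R) ig; rewrite (scale_pos a0) => ih eh.
pose h := fun x => (g (a * x))%:C * cpow (a * x) (z - 1).
have hE x : pos x -> cpow a (1 - z) * h x = (g (a * x))%:C * cpow x (z - 1).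
  rewrite /= in_itv /= andbT => x0; rewrite /h cpowMl//.
  rewrite (_ : 1 - z = - (z - 1)); last by rewrite opprB.
  rewrite (_ : _ * _ = (cpow a (- (z - 1)) * cpow a (z - 1)) * ((g (a * x))%:C * cpow x (z - 1))); last by ring.
  by rewrite cpowN mul1r.
split; first exact: (eq_cintegrable (@measurable_pos R) hE (cintegrableZ _ (@measurable_pos R) ih)).
rewrite /mellin_of -(eq_cintegral hE) (cintegralZ _ (@measurable_pos R) ih).
rewrite eh -/h mulrA; congr (_ * _).
rewrite (_ : 1 - z = - z + 1); last by rewrite addrC.
rewrite cpowD; congr (_ * _).
by rewrite (_ : 1 = (1 : R)%:C)// cpow_real// powRr1// ltW.
Qed.

Lemma measurable_tame : measurable_fun pos f.
Proof. by apply: measurable_pos_continuous => x _; exact: cont_tame. Qed.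

Lemma tame_dom u : 0 < u -> `|f u| <= K / (1 + u).
Proof.
move=> u0; apply: le_trans (tame_bound tf (ltW u0)) _.
rewrite ler_wpM2l ?tame_K_ge0// lef_pV2 ?posrE ?exprn_gt0 ?addr_gt0//.
by rewrite expr2 ler_peMl ?addr_ge0 ?ltW// ltrDl.
Qed.

Lemma cintegrable_mellin_tame : cintegrable pos (fun u => (f u)%:C * cpow u (z - 1)).
Proof. exact: cintegrable_mellin measurable_tame tame_dom. Qed.

Lemma cintegrable_mellin_prim : cintegrable pos (fun u => (F u / u)%:C * cpow u (z - 1)).
Proof.
apply: (@cintegrable_mellin _ K).
  apply: measurable_funM; last exact: measurable_inv.
  by apply: measurable_pos_continuous => x _; exact: cont_prim.
move=> u u0; rewrite normrM normfV (gtr0_norm u0) ler_pdivrMr// mulrAC -mulrA.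
exact: tame_prim_bound (ltW u0).
Qed.

(** Integration by parts: F(u) u^(z-1) has derivative
    f(u) u^(z-1) + (z-1) (F(u)/u) u^(z-1) and vanishes at both ends. *)
Lemma mellin_prim : mellin_of (fun u => F u / u) z * (1 - z) = mellin_of f z.
Proof.
pose g1 u := (f u)%:C * cpow u (z - 1).
pose g2 u := (z - 1) * ((F u / u)%:C * cpow u (z - 1)).
have i1 : cintegrable pos g1 := cintegrable_mellin_tame.
have i2 : cintegrable pos g2 := cintegrableZ (z - 1) (@measurable_pos R) cintegrable_mellin_prim.
have H : cintegral pos (fun u => g1 u + g2 u) = 0.
  apply: (@cFTC0 R (fun u => (F u)%:C * cpow u (z - 1)) _ K).
  - move=> x x0; have := cderivM (cderiv_real (tame_prim tf x)) (cderiv_cpow (z - 1) x0).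
    rewrite /g1 /g2 [cpow x (z - 1 - 1)]cpowB1//.
    rewrite (_ : (F x)%:C * _ = (z - 1) * ((F x / x)%:C * cpow x (z - 1)))//.
    by rewrite rmorphM/=; ring.
  - move=> x x0; apply: ccontD; apply: ccontM.
    + by apply: ccont_real; exact: cont_tame.
    + exact: ccont_cpow.
    + exact: ccont_cst.
    + apply: ccontM; last exact: ccont_cpow.
      apply: ccont_real; apply: continuousM; first exact: cont_prim.
      by apply: continuousV; [rewrite gt_eqF|exact: cvg_id].
  - exact: cintegrableD.
  - move=> x x0; rewrite normcM normc_real normc_cpow_half//.
    apply: le_trans (ler_wpM2r _ (tame_prim_bound (ltW x0))) _.
      by rewrite invr_ge0 sqrtr_ge0.
    by rewrite /dom invfM -!mulrA [_^-1 * _^-1]mulrC.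
move: H; rewrite (cintegralD (@measurable_pos R) i1 i2).
rewrite /g2 (cintegralZ _ (@measurable_pos R) cintegrable_mellin_prim).
rewrite /mellin_of -/(g1) => /eqP; rewrite addr_eq0 => /eqP ->.
by rewrite mulrC -mulNr opprB.
Qed.

(** The Euler-Maclaurin approximation of zeta, which converges for Re w > 0 and w != 1. *)
Definition zetaN (w : C) (N : nat) : C :=
  \sum_(0 <= i < N.+1) cpow i.+1%:R (- w) - cpow N.+1%:R (1 - w) / (1 - w).

(** Replacing u by u/n multiplies a Mellin transform at z by n^(-z), and by
    [mellin_prim] the correction term contributes N^(1-z)/(1-z) times the
    transform of f. *)
Lemma mellin_riemann_error N : mellin_of (riemann_error N.+1) z = zetaN z N * mellin_of f z.
Proof.
have z1 : 1 - z != 0.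
  apply/negP => /eqP /(congr1 Re); rewrite !ReImE zhalf /= => h; lra.
have N0 : 0 < N.+1%:R :> R by [].
have [iF eF] := cmellin_scale N0 cintegrable_mellin_prim.
pose G1 i u := (f (i.+1%:R * u))%:C * cpow u (z - 1).
have iG i : cintegrable pos (G1 i).
  by apply: (cmellin_scale _ cintegrable_mellin_tame).1.
have [iS eS] := cintegral_sum N.+1 (@measurable_pos R) iG.
have E u : pos u -> (\sum_(0 <= i < N.+1) G1 i u) +
    (- N.+1%:R%:C) * ((F (N.+1%:R * u) / (N.+1%:R * u))%:C * cpow u (z - 1)) =
    (riemann_error N.+1 u)%:C * cpow u (z - 1).
  rewrite /= in_itv /= andbT => u0.
  have -> : (riemann_error N.+1 u)%:C = \sum_(0 <= i < N.+1) (f (i.+1%:R * u))%:C -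
      N.+1%:R%:C * (F (N.+1%:R * u) / (N.+1%:R * u))%:C.
    rewrite /riemann_error rmorphB rmorph_sum; congr (_ - _).
    rewrite -[RHS]rmorphM; congr (_%:C).
    by field; rewrite gt_eqF//= pnatr_eq0.
  by rewrite /G1 -mulr_suml; ring.
have iF' := cintegrableZ (- N.+1%:R%:C) (@measurable_pos R) iF.
rewrite {1}/mellin_of -(eq_cintegral E) (cintegralD (@measurable_pos R) iS iF').
rewrite eS (cintegralZ _ (@measurable_pos R) iF).
rewrite -/(mellin_of (fun u => F (N.+1%:R * u) / (N.+1%:R * u)) z) eF /zetaN mulrBl.
congr (_ + _).
  rewrite mulr_suml; apply: eq_bigr => i _.
  exact: (cmellin_scale _ cintegrable_mellin_tame).2.
rewrite -mellin_prim mulNr; congr (- _).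
rewrite [RHS](_ : _ = cpow N.+1%:R (1 - z) * mellin_of (fun u => F u / u) z); last first.
  by field.
rewrite mulrA; congr (_ * _).
rewrite cpowD; congr (_ * _).
by rewrite (_ : 1 = (1 : R)%:C)// cpow_real// powRr1.
Qed.

(** For the functions at hand this replaces the divergent interchange of the sum
    with the Mellin integral. *)
Theorem mellin_dilation_sum (Z : C) : ccvg (zetaN z) Z ->
  mellin_of dilation_sum z = Z * mellin_of f z.
Proof.
move=> cZ; apply: (ccvg_unique ccvg_mellin_riemann_error).
rewrite (_ : (fun N => _) = (fun N => zetaN z N * mellin_of f z)).
  by apply: ccvgM => //; exact: ccvg_cst.
by apply/funext => N; rewrite mellin_riemann_error.
Qed.

Lemma cintegrable_dilation_sum : cintegrable pos (fun u => (dilation_sum u)%:C * cpow u (z - 1)).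
Proof. exact: cintegrable_mellin measurable_dilation_sum dilation_sum_dom. Qed.

End mellin.
End tame.
End Tame.

(** * The identity theorem in one real variable *)

Section RealAnalytic.
Context {R : realType}.
Local Notation C := R[i].
Local Notation Re := (@complex.Re R).
Local Notation Im := (@complex.Im R).
Local Notation normc := (@ComplexField.Normc.normc R).

Lemma geometric_le (q : R) N : 0 <= q -> q <= 2^-1 ->
  \sum_(0 <= k < N) q ^+ k.+1 <= 2 * q.
Proof.
move=> q0 q2.
suff : \sum_(0 <= k < N) q ^+ k.+1 + 2 * q ^+ N.+1 <= 2 * q.
  by apply: le_trans; rewrite lerDl mulr_ge0// exprn_ge0.
elim: N => [|N ih]; first by rewrite big_nil add0r expr1.
apply: le_trans ih; rewrite big_nat_recr//= -addrA lerD2l.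
rewrite [in X in _ + X]exprS mulrA.
have : 2 * q <= 1 by lra.
have := exprn_ge0 N.+1 q0 => h1 h2.
have := ler_wpM2r h1 h2; lra.
Qed.

(** The terms at a point inside the disc are bounded, so closer to the centre
    the tail is dominated by a geometric series. *)
Lemma power_series_lipschitz (a : nat -> R) (h : R -> R) (r : R) : 0 < r ->
  (forall x : R, `|x| < r -> series (fun n => a n * x ^+ n) @ \oo --> h x) ->
  exists K d : R, [/\ 0 < d, d <= r & forall x, `|x| < d -> `|h x - a 0%N| <= K * `|x|].
Proof.
move=> r0 ah; pose r1 := r / 2.
have r10 : 0 < r1 by rewrite divr_gt0.
have r1r : `|r1| < r by rewrite gtr0_norm// /r1; lra.
have [M aM] : exists M : R, forall n, `|a n * r1 ^+ n| <= M.
  have /cvg_series_cvg_0/cvgP/cvg_seq_bounded : cvgn (series (fun n => a n * r1 ^+ n)).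
    by apply/cvg_ex; exists (h r1); exact: ah.
  move=> [M [_ /(_ (M + 1))]]; rewrite ltrDl ltr01 => /(_ erefl) H.
  by exists (M + 1) => n; exact: H.
have M0 : 0 <= M := le_trans (normr_ge0 _) (aM 0%N).
exists (2 * M / r1), (r1 / 2); split.
- by rewrite divr_gt0.
- by rewrite /r1; lra.
move=> x xd; have xr : `|x| < r by apply: (lt_trans xd); rewrite /r1; lra.
pose q := `|x| / r1.
have q0 : 0 <= q by rewrite divr_ge0// ltW.
have q2 : q <= 2^-1 by rewrite /q ler_pdivrMr// mulrC ltW.
have H : (fun n => `|series (fun n => a n * x ^+ n) n.+1 - a 0%N|) @ \oo --> `|h x - a 0%N|.
  apply: cvg_norm; apply: cvgB; last exact: cvg_cst.
  by rewrite (@cvg_shiftS R (series (fun n => a n * x ^+ n))); exact: ah.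
rewrite -(cvg_lim _ H)//; apply: limr_le; first by apply/cvg_ex; eexists; exact: H.
apply: nearW => n; rewrite /series /= big_nat_recl//= expr0 mulr1 addrAC subrr add0r.
apply: le_trans (ler_norm_sum _ _ _) _.
apply: (@le_trans _ _ (M * \sum_(0 <= k < n) q ^+ k.+1)).
  rewrite mulr_sumr; apply: ler_sum => i _.
  have -> : a i.+1 * x ^+ i.+1 = a i.+1 * r1 ^+ i.+1 * (x / r1) ^+ i.+1.
    by rewrite -mulrA -exprMn [r1 * _]mulrC divfK// gt_eqF.
  rewrite normrM ler_pM// normrX /q normrM normfV (gtr0_norm r10)//.
apply: le_trans (ler_wpM2l M0 (geometric_le n q0 q2)) _.
rewrite /q le_eqVlt; apply/orP; left; apply/eqP; field; lra.
Qed.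

(** Vanishing is only assumed to the right of the centre, because the identity
    theorem below moves leftwards along the line. *)
Lemma power_series_head_eq0 (a : nat -> R) (h : R -> R) (r : R) : 0 < r ->
  (forall x : R, `|x| < r -> series (fun n => a n * x ^+ n) @ \oo --> h x) ->
  (forall x : R, 0 < x < r -> h x = 0) -> a 0%N = 0.
Proof.
move=> r0 ah h0; have [K [d [d0 dr Kd]]] := power_series_lipschitz r0 ah.
apply/eqP; rewrite -normr_le0; apply/ler_addgt0Pl => e e0; rewrite addr0.
have K1 : 0 < `|K| + 1 by rewrite ltr_wpDl.
pose x := Num.min (d / 2) (e / (`|K| + 1)).
have x0 : 0 < x by rewrite /x lt_min !divr_gt0.
have xd : `|x| < d by rewrite gtr0_norm// /x gt_min; apply/orP; left; lra.
have := Kd x xd; rewrite h0 ?sub0r ?normrN; last first.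
  by rewrite x0 (lt_le_trans _ dr)// -(gtr0_norm x0).
move=> /le_trans; apply; rewrite (gtr0_norm x0).
apply: (@le_trans _ _ ((`|K| + 1) * x)).
  by rewrite ler_wpM2r ?(ltW x0)// (le_trans (ler_norm _))// lerDl.
rewrite mulrC -ler_pdivlMr// /x ge_min lexx orbT//.
Qed.

(** Once the constant coefficient is known to vanish, dividing by x gives the
    power series of the remaining coefficients. *)
Lemma power_series_eq0 (a : nat -> R) (h : R -> R) (r : R) : 0 < r ->
  (forall x : R, `|x| < r -> series (fun n => a n * x ^+ n) @ \oo --> h x) ->
  (forall x : R, 0 < x < r -> h x = 0) -> forall n, a n = 0.
Proof.
move=> r0 ah h0 n; elim: n a h ah h0 => [|n ih] a h ah h0.
  exact: power_series_head_eq0 ah h0.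
have a0 := power_series_head_eq0 r0 ah h0.
apply: (ih (fun k => a k.+1) (fun x => if x == 0 then a 1%N else h x / x)); last first.
  by move=> x xr; rewrite h0// mul0r gt_eqF//; case/andP : xr.
move=> x xr; case: eqVneq => [->|x0].
  rewrite -cvg_shiftS; apply: cvg_near_cst; apply: nearW => N.
  rewrite /series /= big_nat_recl//= expr0 mulr1 big1 ?addr0// => i _.
  by rewrite expr0n mulr0.
rewrite (_ : series _ = fun N => series (fun k => a k * x ^+ k) N.+1 / x).
  apply: cvgM; last exact: cvg_cst.
  by rewrite (@cvg_shiftS R (series (fun n => a n * x ^+ n))); exact: ah.
apply/funext => N; rewrite /series /= big_nat_recl//= a0 mul0r add0r mulr_suml.
by apply: eq_bigr => i _; rewrite exprS; field.
Qed.

(** Analyticity in one real variable with complex values, as induced on a line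
    of the plane by a complex power series. *)
Definition canalytic (g : R -> C) (t0 : R) := exists r : R, 0 < r /\ exists a : nat -> C,
  forall t, `|t - t0| < r ->
    ccvg (series (fun n => a n * ((t - t0) ^+ n)%:C)) (g t).

Lemma ReMreal (z : C) (x : R) : Re (z * x%:C) = Re z * x.
Proof. by rewrite !ReImE mulr0 subr0. Qed.

Lemma ImMreal (z : C) (x : R) : Im (z * x%:C) = Im z * x.
Proof. by rewrite !ReImE mulr0 add0r. Qed.

Lemma Re_series (a : nat -> C) x :
  Re \o series (fun n => a n * (x ^+ n)%:C) = series (fun n => Re (a n) * x ^+ n).
Proof.
by apply/funext => N; rewrite /series /= Re_sum; apply: eq_bigr => i _; rewrite ReMreal.
Qed.

Lemma Im_series (a : nat -> C) x :
  Im \o series (fun n => a n * (x ^+ n)%:C) = series (fun n => Im (a n) * x ^+ n).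
Proof.
by apply/funext => N; rewrite /series /= Im_sum; apply: eq_bigr => i _; rewrite ImMreal.
Qed.

Lemma canalytic_local_eq0 g (t0 : R) : canalytic g t0 ->
  (forall t, t0 < t -> g t = 0) ->
  exists2 r : R, 0 < r & forall t, `|t - t0| < r -> g t = 0.
Proof.
move=> [r [r0 [a ag]]] g0; exists r => //.
have ag' x : `|x| < r -> ccvg (series (fun n => a n * (x ^+ n)%:C)) (g (t0 + x)).
  by have := ag (t0 + x); rewrite addrAC subrr add0r.
have a0 n : a n = 0.
  apply: complex_eq.
    apply: (@power_series_eq0 (Re \o a) (fun x => Re (g (t0 + x))) r) => //.
      move=> x /ag'[+ _].
      by rewrite Re_series.
    by move=> x /andP[x0 _]; rewrite g0// ltrDl.
  apply: (@power_series_eq0 (Im \o a) (fun x => Im (g (t0 + x))) r) => //.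
    move=> x /ag'[_].
    by rewrite Im_series.
  by move=> x /andP[x0 _]; rewrite g0// ltrDl.
move=> t tr; apply: ccvg_unique (ag t tr) _.
rewrite (_ : series _ = fun=> 0); first exact: ccvg_cst.
by apply/funext => N; rewrite /series /= big1// => i _; rewrite a0 mul0r.
Qed.

(** At the infimum of the points beyond which g vanishes, the expansion of g is
    zero on the right, hence zero on both sides, so the infimum can be
    lowered unless it is at most A. *)
Lemma canalytic_identity g (A B : R) :
  (forall t, A < t -> canalytic g t) -> (forall t, B < t -> g t = 0) ->
  forall t, A < t -> g t = 0.
Proof.
move=> ag g0 t1 At1; apply: contrapT => gt1.
pose T := [set t : R | A < t /\ forall t', t <= t' -> g t' = 0].
have lbT : lbound T t1.
  move=> t [_ h]; rewrite leNgt; apply/negP => tt1; apply: gt1; apply: h; exact: ltW.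
have T0 : T !=set0.
  exists (Num.max A B + 1); split; first by rewrite ltr_pwDr// le_max lexx.
  by move=> t' h; apply: g0; apply: lt_le_trans h; rewrite ltr_pwDr// le_max lexx orbT.
have hT : has_inf T by split => //; exists t1.
have t1i : t1 <= inf T by apply: lb_le_inf.
have Ai := lt_le_trans At1 t1i.
have gi t : inf T < t -> g t = 0.
  by move=> /(inf_lt T0) [s [_ sT] st]; apply: sT; exact: ltW.
have [r r0 gr] := canalytic_local_eq0 (ag _ Ai) gi.
pose s := Num.max (inf T - r / 2) ((inf T + A) / 2).
have si : s < inf T by rewrite /s gt_max; apply/andP; split; lra.
have Ts : T s.
  split; first by rewrite /s lt_max; apply/orP; right; lra.
  move=> t' st'; have [|h] := ltP (inf T) t'; first exact: gi.
  apply: gr; rewrite ler0_norm ?subr_le0//.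
  have : inf T - r / 2 <= t' by apply: le_trans st'; rewrite /s le_max lexx.
  lra.
have := ge_inf hT.2 Ts; by rewrite leNgt si.
Qed.

Lemma canalytic_cst (c : C) t0 : canalytic (fun=> c) t0.
Proof.
exists 1; split => //; exists (fun n => if n is 0%N then c else 0) => t _.
apply/ccvgP; rewrite -(@cvg_shiftS C^o); apply/ccvgP.
rewrite (_ : (fun _ => _) = fun=> c); first exact: ccvg_cst.
apply/funext => N; rewrite /series /= big_nat_recl//= expr0 mulr1 big1 ?addr0// => i _.
by rewrite mul0r.
Qed.

Lemma canalyticD f g t0 : canalytic f t0 -> canalytic g t0 ->
  canalytic (fun t => f t + g t) t0.
Proof.
move=> [r [r0 [a af]]] [s [s0 [b bg]]].
exists (Num.min r s); split; first by rewrite lt_min r0.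
exists (fun n => a n + b n) => t; rewrite lt_min => /andP[tr ts].
rewrite (_ : series _ = fun N => series (fun n => a n * ((t - t0) ^+ n)%:C) N +
   series (fun n => b n * ((t - t0) ^+ n)%:C) N).
  by apply: ccvgD; [exact: af|exact: bg].
apply/funext => N; rewrite /series /= -big_split/=; apply: eq_bigr => i _.
by rewrite mulrDl.
Qed.

Lemma ccvg_shiftS (a : nat -> C) l : ccvg (fun n => a n.+1) l <-> ccvg a l.
Proof.
by rewrite /ccvg -(@cvg_shiftS R (Re \o a)) -(@cvg_shiftS R (Im \o a)).
Qed.

(** Expand t + c as (t - t0) + (t0 + c): the coefficients are shifted by the
    first term and multiplied by the second. *)
Lemma canalyticX g (c : C) t0 : canalytic g t0 ->
  canalytic (fun t => (t%:C + c) * g t) t0.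
Proof.
move=> [r [r0 [a ag]]]; exists r; split => //.
exists (fun n => (t0%:C + c) * a n + (if n is n'.+1 then a n' else 0)) => t tr.
apply/ccvg_shiftS.
rewrite (_ : (fun _ => _) = fun N =>
   (t0%:C + c) * series (fun n => a n * ((t - t0) ^+ n)%:C) N.+1 +
   (t - t0)%:C * series (fun n => a n * ((t - t0) ^+ n)%:C) N).
  rewrite (_ : _ * g t = (t0%:C + c) * g t + (t - t0)%:C * g t); last first.
    by rewrite rmorphB; ring.
  by apply: ccvgD; apply: ccvgM; (try exact: ccvg_cst); [apply/ccvg_shiftS; exact: ag|exact: ag].
apply/funext => N; rewrite /series /=.
under eq_bigr do rewrite mulrDl.
rewrite big_split/= !mulr_sumr; congr (_ + _).
  by apply: eq_bigr => i _; rewrite mulrA.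
rewrite big_nat_recl//= mul0r add0r; apply: eq_bigr => i _.
by rewrite exprS rmorphM mulrCA.
Qed.

Lemma canalytic_continuous g (t0 : R) (u : nat -> R) : canalytic g t0 ->
  u @ \oo --> t0 -> ccvg (fun n => g (u n)) (g t0).
Proof.
move=> [r [r0 [a ag]]] ut.
have ag' x : `|x| < r -> ccvg (series (fun n => a n * (x ^+ n)%:C)) (g (t0 + x)).
  by have := ag (t0 + x); rewrite addrAC subrr add0r.
have key (h : R -> R) (b : nat -> R) :
    (forall x : R, `|x| < r -> series (fun n => b n * x ^+ n) @ \oo --> h (t0 + x)) ->
    h (u n) @[n --> \oo] --> h t0.
  move=> bh; have [K [d [d0 dr Kd]]] := power_series_lipschitz r0 bh.
  have ht0 : h t0 = b 0%N.
    have := Kd 0; rewrite normr0 mulr0 addr0 => /(_ d0).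
    by rewrite normr_le0 subr_eq0 => /eqP.
  apply/subr_cvg0/norm_cvg0P.
  have u0 : `|u n - t0| @[n --> \oo] --> (0 : R).
    by apply/norm_cvg0P/subr_cvg0.
  apply: (@squeeze_cvgr _ _ _ _ (fun=> 0) (fun n => K * `|u n - t0|)).
  - near=> n; rewrite normr_ge0/= ht0.
    have := Kd (u n - t0); rewrite [t0 + _]addrC subrK; apply.
    near: n; move/cvgrPdist_lt : ut => /(_ d d0); apply: filterS => n; by rewrite distrC.
  - exact: cvg_cst.
  - by rewrite -[X in _ --> X](mulr0 K); apply: cvgM => //; exact: cvg_cst.
split.
- apply: (key (Re \o g) (Re \o a)) => x /ag'[+ _]; by rewrite Re_series.
- apply: (key (Im \o g) (Im \o a)) => x /ag'[_]; by rewrite Im_series.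
Unshelve. all: by end_near. Qed.

(** A unit direction d turns a power series in w - z into one in the real
    parameter with the same radius. *)
Lemma analytic_at_line (F : C -> C) (z d : C) (t0 : R) : normc d = 1 ->
  analytic_at F (z + t0%:C * d) -> canalytic (fun t => F (z + t%:C * d)) t0.
Proof.
move=> d1 [r [r0 [a aF]]]; exists r; split => //.
exists (fun n => a n * d ^+ n) => t tr.
have E : z + t%:C * d - (z + t0%:C * d) = (t - t0)%:C * d by rewrite rmorphB; ring.
have := aF (z + t%:C * d); rewrite E normcM d1 mulr1 normc_real => /(_ tr)/ccvgP.
rewrite (_ : series _ = series (fun n => a n * d ^+ n * ((t - t0) ^+ n)%:C))//.
apply/funext => N; rewrite /series /=; apply: eq_bigr => i _.
by rewrite exprMn rmorphXn/= mulrA mulrAC.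
Qed.

End RealAnalytic.

(** * Continuation of the Dirichlet series by the fractional part *)

Section ZetaContinuation.
Context {R : realType}.
Local Notation C := R[i].
Local Notation Re := (@complex.Re R).
Local Notation normc := (@ComplexField.Normc.normc R).
Local Notation leb := (@lebesgue_measure R).
Local Notation pos := (`]0, +oo[%classic : set R).
Local Notation from1 := (`[1, +oo[%classic : set R).

Lemma measurable_from1 : (@measurable _ (measurableTypeR R)) from1.
Proof. exact: measurable_itv. Qed.

Definition frac_part (x : R) : R := x - (Num.truncn x)%:R.

Definition frac_piece (i : nat) : R -> R :=
  (fun x : R => (x - i.+1%:R : R)) \_ (`[i.+1%:R, i.+2%:R[%classic : set R).

Definition frac_trunc (N : nat) (x : R) := \sum_(0 <= i < N) frac_piece i x.

Lemma frac_part_itv x : 0 <= x -> 0 <= frac_part x <= 1.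
Proof.
move=> /truncn_itv; rewrite /frac_part -natr1 => /andP[h1 h2]; apply/andP; split; lra.
Qed.

(** The pieces on successive intervals [i+1, i+2[ glue to the fractional part,
    cut off at N+1; a sum of pieces is what term by term integration
    handles. *)
Lemma frac_truncE N x : 1 <= x ->
  frac_trunc N x = if x < N.+1%:R then frac_part x else 0.
Proof.
move=> x1; elim: N => [|N ih].
  by rewrite /frac_trunc big_nil ltNge x1.
rewrite /frac_trunc big_nat_recr//= -/(frac_trunc N x) ih /frac_piece patchE.
have [xN|Nx] := ltP x N.+1%:R.
  rewrite (lt_trans xN) ?ltr_nat// memNset ?addr0//= in_itv /=.
  by move=> /andP[]; rewrite leNgt xN.
have [xN2|N2x] := ltP x N.+2%:R.
  by rewrite mem_set ?add0r//= ?in_itv/= ?Nx// /frac_part (@truncn_def _ _ N.+1)// Nx.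
rewrite memNset ?addr0//= in_itv /=.
by move=> /andP[_]; rewrite ltNge N2x.
Qed.

Lemma frac_trunc_bound N x : 1 <= x -> `|frac_trunc N x| <= 1.
Proof.
move=> x1; rewrite frac_truncE//; case: ifP; rewrite ?normr0// => _.
by have /andP[h0 h1] := frac_part_itv (le_trans ler01 x1); rewrite ger0_norm.
Qed.

Lemma cvg_frac_trunc x : 1 <= x -> frac_trunc N x @[N --> \oo] --> frac_part x.
Proof.
move=> x1; apply: cvg_near_cst; exists (Num.truncn x) => // N /= xN.
rewrite frac_truncE// ifT// (lt_le_trans (truncnS_gt _))// ler_nat ltnS//.
Qed.

Lemma measurable_frac_piece i (D : set R) : (@measurable _ (measurableTypeR R)) D ->
  measurable_fun D (frac_piece i).
Proof.
move=> mD; apply: (measurable_restrict _ _ _).1 => //.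
by apply: measurable_funB; [exact: measurable_id|exact: measurable_cst].
Qed.

Lemma measurable_frac_trunc N : measurable_fun from1 (frac_trunc N).
Proof. by apply: measurable_sum => i; apply: measurable_frac_piece; exact: measurable_from1. Qed.

Lemma measurable_frac_part : measurable_fun from1 frac_part.
Proof.
apply: (measurable_fun_cvg measurable_frac_trunc) => x.
by rewrite /= in_itv /= andbT => /cvg_frac_trunc.
Qed.

Lemma from1_pos x : from1 x -> 0 < x /\ 1 <= x.
Proof. by rewrite /= in_itv /= andbT => x1; split => //; exact: lt_le_trans x1. Qed.

(** The criterion by a bounded primitive is stated on ]0, +oo[; it is applied to
    the translate (1+x)^(-b-1), which dominates x^(-b-1) on [1, +oo[ up to a
    power of 2. *)
Lemma integrable_powR_from1 (b : R) : 0 < b ->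
  leb.-integrable from1 (EFin \o (fun x => x `^ (- b - 1))).
Proof.
move=> b0.
have h : leb.-integrable pos (EFin \o (fun x => expR ((- b - 1) * ln (1 + x)))).
  apply: (@ge0_integrable_primitive R (fun x => - b^-1 * expR (- b * ln (1 + x)))
    (fun x => expR ((- b - 1) * ln (1 + x))) b^-1).
  - move=> x x0; have x1 : 0 < 1 + x by rewrite addr_gt0.
    have dl := is_derive1_ln x1.
    have da : is_derive x 1 (fun x : R => ln (1 + x)) (1 + x)^-1.
      by apply: is_derive_eq; rewrite /GRing.scale /=; field; rewrite gt_eqF.
    apply: is_derive_eq; rewrite /GRing.scale /=.
    rewrite mulrBl expRD mul1r expRN lnK ?posrE//.
    by field; rewrite !gt_eqF.
  - move=> x x0; have x1 : 0 < 1 + x by rewrite addr_gt0.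
    have dl := is_derive1_ln x1.
    have da : is_derive x 1 (fun x : R => ln (1 + x)) (1 + x)^-1.
      by apply: is_derive_eq; rewrite /GRing.scale /=; field; rewrite gt_eqF.
    apply: (@derivable_continuous R _ _ ((- b - 1) / (1 + x) * expR ((- b - 1) * ln (1 + x)))).
    by apply: is_derive_eq; rewrite /GRing.scale /=; ring.
  - by move=> x _; exact: expR_ge0.
  - move=> x x0; rewrite normrM normrN (gtr0_norm (expR_gt0 _)) gtr0_norm ?invr_gt0//.
    rewrite ler_piMr ?invr_ge0 ?(ltW b0)// -[leRHS]expR0 ler_expR mulNr oppr_le0 mulr_ge0 ?(ltW b0)//.
    by rewrite ln_ge0// lerDl ltW.
have sub : from1 `<=` pos by move=> x /from1_pos[x0 _]; rewrite /= in_itv /= x0.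
have h1 : leb.-integrable from1 (EFin \o (fun x => expR ((- b - 1) * ln (1 + x)))).
  by apply: integrableS h.
have h2 : leb.-integrable from1 (EFin \o (fun x => expR ((b + 1) * ln 2) * expR ((- b - 1) * ln (1 + x)))).
  exact: (integrableZl measurable_from1 (expR ((b + 1) * ln 2)) h1).
apply: le_real_integrable h2.
- exact: measurable_from1.
- apply: (@measurable_funS _ _ (measurableTypeR R) (measurableTypeR R) pos) => //.
  by apply: measurable_funTS; exact: measurable_powR.
- move=> x /from1_pos[x0 x1]; rewrite ger0_norm ?powR_ge0// -expRD /powR gt_eqF// ler_expR.
  have : ln (1 + x) <= ln 2 + ln x.
    by rewrite -lnM ?posrE// ler_ln ?posrE ?mulr_gt0 ?addr_gt0//; lra.
  have b1 : 0 < b + 1 by lra.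
  by move=> /(ler_wpM2l (ltW b1)); lra.
Qed.

Lemma normc_cpow_from1 (w : C) (x : R) : 1 <= x -> normc (cpow x (- w - 1)) = x `^ (- Re w - 1).
Proof. by move=> x1; rewrite normc_cpow ?(lt_le_trans ltr01)// !ReImE. Qed.

Lemma cmeasurable_cpow1 (w : C) : cmeasurable from1 (fun u : R => cpow u w).
Proof.
apply: (cmeasurableS (@measurable_pos R)); last exact: cmeasurable_cpow.
by move=> x /from1_pos[x0 _]; rewrite /= in_itv /= x0.
Qed.

(** The integral of {x} x^(-w-1) over [1, +oo[, in terms of which zeta
    continues to Re w > 0. *)
Definition fracJ (w : C) : C := cintegral from1 (fun x => (frac_part x)%:C * cpow x (- w - 1)).

Definition fracJN (w : C) (N : nat) : C :=
  cintegral from1 (fun x => (frac_trunc N x)%:C * cpow x (- w - 1)).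

Lemma ccvg_fracJN (w : C) : 0 < Re w -> ccvg (fracJN w) (fracJ w).
Proof.
move=> w0.
apply: (cintegral_dct measurable_from1 _ _ (integrable_powR_from1 w0) _).2.
- move=> N; apply: cmeasurableM; last exact: cmeasurable_cpow1.
  by apply: cmeasurable_real; exact: measurable_frac_trunc.
- move=> x /from1_pos[x0 x1]; apply: ccvgM; last exact: ccvg_cst.
  by apply: ccvg_real; exact: cvg_frac_trunc.
- move=> N x /from1_pos[x0 x1]; rewrite normcM normc_real normc_cpow_from1//.
  by rewrite ler_piMl ?powR_ge0// frac_trunc_bound.
Qed.

Lemma cintegral_patch (D E : set R) (h : R -> R) (g : R -> C) :
  cintegral D (fun x => ((h \_ E) x)%:C * g x) =
  cintegral (D `&` E) (fun x => (h x)%:C * g x).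
Proof.
apply: complex_eq => /=.
  rewrite (@Rintegral_mkcondr _ (measurableTypeR R)); apply: eq_Rintegral => x _.
  by rewrite /Re_fun !patchE; case: ifPn => // _; rewrite mul0r.
rewrite (@Rintegral_mkcondr _ (measurableTypeR R)); apply: eq_Rintegral => x _.
by rewrite /Im_fun !patchE; case: ifPn => // _; rewrite mul0r.
Qed.

Lemma cderiv_eq (f : R -> C) x (a b : C) : cderiv f x a -> a = b -> cderiv f x b.
Proof. by move=> + <-. Qed.

Lemma cintegral_bndo_bndc (a b : R) (f : R -> C) : cmeasurable `[a, b[ f ->
  cintegral `[a, b[ f = cintegral `[a, b] f.
Proof.
move=> [mr mi]; rewrite /cintegral.
by rewrite /Rintegral !integral_itv_bndo_bndc//; exact/measurable_EFinP.
Qed.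

(** On [i+1, i+2] the integrand, times -w, has the primitive
    (x - (i+1)) x^(-w) - x^(1-w)/(1-w). *)
Lemma cintegral_piece (w : C) (i : nat) : w != 0 -> w != 1 ->
  w * cintegral from1 (fun x => (frac_piece i x)%:C * cpow x (- w - 1)) =
  (cpow i.+2%:R (1 - w) - cpow i.+1%:R (1 - w)) / (1 - w) - cpow i.+2%:R (- w).
Proof.
move=> w0 w1; have w1' : 1 - w != 0 by rewrite subr_eq0 eq_sym.
rewrite cintegral_patch setIidr; last first.
  move=> x; rewrite /= !in_itv /= => /andP[+ _]; rewrite andbT; apply: le_trans.
  by rewrite ler1n.
rewrite cintegral_bndo_bndc; last first.
  apply: (cmeasurableS (@measurable_pos R)).
    move=> x; rewrite /= !in_itv /= => /andP[+ _]; rewrite andbT; apply: lt_le_trans.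
    by rewrite ltr0n.
  apply: cmeasurableM; last exact: cmeasurable_cpow.
  apply: cmeasurable_real.
  by apply: measurable_funB; [exact: measurable_id|exact: measurable_cst].
pose A (x : R) := (x - i.+1%:R)%:C * cpow x (- w) + - (1 - w)^-1 * cpow x (1 - w).
pose g (x : R) := (- w) * ((x - i.+1%:R)%:C * cpow x (- w - 1)).
have ii : i.+1%:R < i.+2%:R :> R by rewrite ltr_nat.
have dA x : i.+1%:R <= x <= i.+2%:R -> cderiv A x (g x).
  move=> /andP[ix _]; have x0 : 0 < x by apply: lt_le_trans ix.
  have d1 : is_derive x 1 (fun x : R => x - i.+1%:R) 1.
    by apply: is_derive_eq; rewrite subr0.
  apply: (cderiv_eq (cderivD (cderivM (cderiv_real d1) (cderiv_cpow (- w) x0))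
                  (cderivM (cderiv_cst (- (1 - w)^-1) x) (cderiv_cpow (1 - w) x0)))).
  rewrite /g (_ : 1 - w - 1 = - w); last by ring.
  by rewrite (_ : 1%:C = 1)//; field.
have cg x : i.+1%:R <= x <= i.+2%:R -> ccont g x.
  move=> /andP[ix _]; have x0 : 0 < x by apply: lt_le_trans ix.
  apply: ccontM; first exact: ccont_cst.
  apply: ccontM; last exact: ccont_cpow.
  by apply: ccont_real; apply: continuousB; [exact: cvg_id|exact: cvg_cst].
have [ig eg] := cintegral_is_derive ii dA cg.
have E x : `[i.+1%:R, i.+2%:R]%classic x -> (- w)^-1 * g x = (x - i.+1%:R)%:C * cpow x (- w - 1).
  by move=> _; rewrite /g; field.
rewrite -(eq_cintegral E) (cintegralZ _ _ ig); last exact: measurable_itv.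
rewrite eg /A subrr mul0r add0r.
rewrite (_ : i.+2%:R - i.+1%:R = 1 :> R); last by rewrite -(natr1 i.+1); ring.
by rewrite (_ : 1%:C = 1)//; field; rewrite w0 w1'.
Qed.

Lemma frac_piece_bound i x : 1 <= x -> `|frac_piece i x| <= 1.
Proof.
move=> x1; rewrite /frac_piece patchE; case: ifPn; rewrite ?normr0// => /set_mem.
rewrite /= in_itv /= -(natr1 i.+1) => /andP[h1 h2]; rewrite ger0_norm; lra.
Qed.

Lemma cintegrable_piece (w : C) i : 0 < Re w ->
  cintegrable from1 (fun x => (frac_piece i x)%:C * cpow x (- w - 1)).
Proof.
move=> w0; apply: (cintegrable_le measurable_from1 _ _ (integrable_powR_from1 w0)).
- apply: cmeasurableM; last exact: cmeasurable_cpow1.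
  by apply: cmeasurable_real; apply: measurable_frac_piece; exact: measurable_from1.
- move=> x /from1_pos[x0 x1]; rewrite normcM normc_real normc_cpow_from1//.
  by rewrite ler_piMl ?powR_ge0// frac_piece_bound.
Qed.

Lemma fracJN_sum (w : C) N : 0 < Re w -> fracJN w N =
  \sum_(0 <= i < N) cintegral from1 (fun x => (frac_piece i x)%:C * cpow x (- w - 1)).
Proof.
move=> w0.
rewrite -(cintegral_sum N measurable_from1 (fun i => cintegrable_piece i w0)).2.
apply: eq_cintegral => x _; rewrite -mulr_suml; congr (_ * _).
by rewrite /frac_trunc rmorph_sum.
Qed.

(** Each piece contributes the increment of [zetaN] from one N to the next; at
    N = 0 both sides equal w/(w-1). *)
Lemma zetaN_fracJN (w : C) N : 0 < Re w -> w != 1 ->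
  zetaN w N = w / (w - 1) - w * fracJN w N.
Proof.
move=> w0 w1; have w1' : 1 - w != 0 by rewrite subr_eq0 eq_sym.
have w1'' : w - 1 != 0 by rewrite subr_eq0.
have wn0 : w != 0 by apply/negP => /eqP E; move: w0; rewrite E ltxx.
rewrite fracJN_sum// mulr_sumr.
under eq_bigr do rewrite cintegral_piece//.
elim: N => [|N ih].
  by rewrite /zetaN big_nat1 big_nil !cpow_one; field; rewrite w1' w1''.
rewrite big_nat_recr//= opprD addrA -ih /zetaN [in LHS]big_nat_recr//=.
by ring.
Qed.

Lemma ccvg_zetaN (w : C) : 0 < Re w -> w != 1 ->
  ccvg (zetaN w) (w / (w - 1) - w * fracJ w).
Proof.
move=> w0 w1.
rewrite (_ : zetaN w = fun N => w / (w - 1) + (- w) * fracJN w N); last first.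
  by apply/funext => N; rewrite zetaN_fracJN// mulNr.
rewrite -mulNr; apply: ccvgD; first exact: ccvg_cst.
by apply: ccvgM; [exact: ccvg_cst|exact: ccvg_fracJN].
Qed.

End ZetaContinuation.

(** * Zeta on the critical line *)

Section ZetaIdentity.
Context {R : realType}.
Local Notation C := R[i].
Local Notation Re := (@complex.Re R).
Local Notation Im := (@complex.Im R).
Local Notation normc := (@ComplexField.Normc.normc R).
Local Notation from1 := (`[1, +oo[%classic : set R).

Lemma cvg_series_exp (y : R) : series (exp_coeff y) @ \oo --> expR y.
Proof. exact: is_cvg_series_exp_coeff. Qed.

Lemma exp_partial_sum_le (y : R) N : `|series (exp_coeff y) N| <= expR `|y|.
Proof.
apply: (@le_trans _ _ (series (exp_coeff `|y|) N)).
  apply: le_trans (ler_norm_sum _ _ _) _; apply: ler_sum => i _.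
  by rewrite /exp_coeff /= normrM normrX normfV normr_nat.
rewrite -(cvg_lim _ (@cvg_series_exp `|y|))//; apply: nondecreasing_cvgn_le.
  by apply: nondecreasing_series => n _ _; exact: exp_coeff_ge0.
exact: is_cvg_series_exp_coeff.
Qed.

Lemma exp_coeff_le (y : R) N : 0 <= y -> exp_coeff y N <= expR y.
Proof.
move=> y0; have := le_trans (ler_norm _) (exp_partial_sum_le y N.+1).
rewrite (ger0_norm y0); apply: le_trans.
rewrite /series /= big_nat_recr//= lerDr sumr_ge0// => i _; exact: exp_coeff_ge0.
Qed.

(** Expand x^(-(t - t0)) = exp(-(t - t0) ln x) in powers of t - t0 under the
    integral.  For |t - t0| < r the partial sums are bounded by x^r, and the
    choice r = t0/2 leaves an integrable power of x. *)
Lemma fracJ_canalytic (c : C) (t0 : R) : Re c = 0 -> 0 < t0 ->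
  canalytic (fun t => fracJ (t%:C + c)) t0.
Proof.
move=> c0 t00; pose r := t0 / 2; have r0 : 0 < r by rewrite divr_gt0.
pose w0 : C := t0%:C + c.
pose b k (x : R) : C := (frac_part x * exp_coeff (- ln x) k)%:C * cpow x (- w0 - 1).
have b_meas k : cmeasurable from1 (b k).
  apply: cmeasurableM; last exact: cmeasurable_cpow1.
  apply: cmeasurable_real; apply: measurable_funM; first exact: measurable_frac_part.
  rewrite (_ : (fun _ => _) = (fun x => (- ln x) ^+ k * (k`!%:R)^-1)).
    apply: measurable_funM; last exact: measurable_cst.
    apply: measurable_funX; apply: measurable_funN.
    by apply: measurable_funTS; exact: measurable_ln.
  by apply/funext => x.
have r20 : 0 < t0 - r by rewrite /r; lra.
have Re0 : Re w0 = t0 by rewrite !ReImE c0 addr0.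
have b_int k : cintegrable from1 (b k).
  apply: (@cintegrable_le R _ _ (fun x => r ^- k * x `^ (- (t0 - r) - 1)) measurable_from1 (b_meas k)).
    move=> x /from1_pos[x0 x1]; rewrite normcM normc_real normc_cpow_from1// Re0.
    have /andP[f0 f1] := frac_part_itv (ltW x0).
    rewrite normrM (ger0_norm f0).
    have -> : x `^ (- (t0 - r) - 1) = x `^ r * x `^ (- t0 - 1).
      rewrite -powRD; first by congr (_ `^ _); ring.
      by rewrite (gt_eqF x0) implybT.
    rewrite mulrA ler_wpM2r ?powR_ge0// -[leRHS]mul1r ler_pM//.
    have lx : 0 <= ln x by rewrite ln_ge0.
    have := @exp_coeff_le (r * ln x) k (mulr_ge0 (ltW r0) lx).
    rewrite /exp_coeff /= exprMn /powR gt_eqF// normrM normrX normrN (ger0_norm lx).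
    rewrite ger0_norm ?invr_ge0//.
    by rewrite -mulrA ler_pdivlMl ?exprn_gt0.
  exact: (integrableZl measurable_from1 (r ^- k) (integrable_powR_from1 r20)).
exists r; split => //; exists (fun k => cintegral from1 (b k)) => t tr.
pose F N (x : R) : C := \sum_(0 <= k < N) ((t - t0) ^+ k)%:C * b k x.
have FE N x : 1 <= x -> F N x = (frac_part x * series (exp_coeff (- (t - t0) * ln x)) N)%:C * cpow x (- w0 - 1).
  move=> x1; rewrite /F /b /series /= mulr_sumr rmorph_sum mulr_suml.
  apply: eq_bigr => k _; rewrite mulrA -rmorphM /=; congr (_%:C * _).
  by rewrite /exp_coeff /= mulNr -mulrN exprMn; ring.
have SE N : cintegral from1 (F N) = series (fun n => cintegral from1 (b n) * ((t - t0) ^+ n)%:C) N.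
  have ib k : cintegrable from1 (fun x => ((t - t0) ^+ k)%:C * b k x).
    by apply: cintegrableZ => //; exact: measurable_from1.
  rewrite (cintegral_sum N measurable_from1 ib).2 /series /=; apply: eq_bigr => k _.
  by rewrite (cintegralZ _ measurable_from1 (b_int k)) mulrC.
rewrite (_ : series _ = fun N => cintegral from1 (F N)); last first.
  by apply/funext => N; rewrite SE.
apply: (cintegral_dct measurable_from1 _ _ (integrable_powR_from1 r20) _).2.
- move=> N; apply: cmeasurable_sum => k; apply: cmeasurableM => //; exact: cmeasurable_cst.
- move=> x /from1_pos[x0 x1].
  rewrite (_ : F ^~ x = fun N => (frac_part x * series (exp_coeff (- (t - t0) * ln x)) N)%:C * cpow x (- w0 - 1)); last first.
    by apply/funext => N; rewrite FE.
  rewrite (_ : _ * _ = (frac_part x * expR (- (t - t0) * ln x))%:C * cpow x (- w0 - 1)).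
    apply: ccvgM; last exact: ccvg_cst.
    apply: ccvg_real; apply: cvgM; [exact: cvg_cst|exact: cvg_series_exp].
  rewrite rmorphM -mulrA; congr (_ * _).
  have -> : expR (- (t - t0) * ln x) = x `^ (- (t - t0)) by rewrite /powR gt_eqF.
  rewrite /= -cpow_real// -cpowD; congr (cpow x _).
  by rewrite /w0 rmorphN rmorphB; ring.
- move=> N x /from1_pos[x0 x1]; rewrite FE// normcM normc_real normc_cpow_from1// Re0.
  have /andP[f0 f1] := frac_part_itv (ltW x0).
  have lx : 0 <= ln x by rewrite ln_ge0.
  have -> : x `^ (- (t0 - r) - 1) = x `^ r * x `^ (- t0 - 1).
    rewrite -powRD; first by congr (_ `^ _); ring.
    by rewrite (gt_eqF x0) implybT.
  rewrite ler_wpM2r ?powR_ge0// normrM (ger0_norm f0).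
  rewrite -[leRHS]mul1r ler_pM// (le_trans (exp_partial_sum_le _ _))//.
  rewrite /powR gt_eqF// ler_expR normrM normrN (ger0_norm lx).
  by rewrite ler_wpM2r// ltW.
Qed.

Lemma ccvg_normc0 (a : nat -> C) : normc (a n) @[n --> \oo] --> (0 : R) -> ccvg a 0.
Proof.
move=> h; split; apply/norm_cvg0P;
  apply: (@squeeze_cvgr _ _ _ _ (fun=> 0) (fun n => normc (a n))) => //;
  try exact: cvg_cst; apply: nearW => N; rewrite normr_ge0/=.
- exact: normc_Re_le.
- exact: normc_Im_le.
Qed.

Lemma ccvg_cpow (x : R) (a : nat -> C) (l : C) : ccvg a l ->
  ccvg (fun n => cpow x (a n)) (cpow x l).
Proof.
move=> [ar ai]; split.
- rewrite cpowE/= (_ : Re \o _ = fun n => expR (Re (a n) * ln x) * cos (Im (a n) * ln x)).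
    apply: cvgM; (apply: continuous_cvg; [by [exact: continuous_expR|exact: continuous_cos]|]);
      apply: cvgM => //; exact: cvg_cst.
  by apply/funext => n; rewrite -[LHS]/(Re (cpow x (a n))) cpowE.
- rewrite cpowE/= (_ : Im \o _ = fun n => expR (Re (a n) * ln x) * sin (Im (a n) * ln x)).
    apply: cvgM; (apply: continuous_cvg; [by [exact: continuous_expR|exact: continuous_sin]|]);
      apply: cvgM => //; exact: cvg_cst.
  by apply/funext => n; rewrite -[LHS]/(Im (cpow x (a n))) cpowE.
Qed.

Section zeta.
Variable zeta : C -> C.
Hypothesis zetaP : is_riemann_zeta zeta.

(** For Re w > 1 the correction term N^(1-w) of [zetaN] tends to 0, so its limit
    is the Dirichlet series. *)
Lemma zeta_fracJ_Re_gt1 w : 1 < Re w -> zeta w = w / (w - 1) - w * fracJ w.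
Proof.
move=> w1.
have w0 : 0 < Re w by apply: lt_trans w1.
have wn1 : w != 1 by apply/negP => /eqP E; move: w1; rewrite E /= ltxx.
apply: (ccvg_unique _ (ccvg_zetaN w0 wn1)).
rewrite -[zeta w]addr0.
have h1 := zetaP.2 w w1.
rewrite (_ : zetaN w = fun N => series (fun n => cpow n.+1%:R (- w)) N.+1 +
  (- (1 - w)^-1) * cpow N.+1%:R (1 - w)); last first.
  by apply/funext => N; rewrite /zetaN mulrC mulNr.
apply: ccvgD.
  by apply/ccvg_shiftS; apply/ccvgP.
(* |N^(1-w)| = (1/N)^(Re w - 1), a positive power of a null sequence. *)
rewrite -(mulr0 (- (1 - w)^-1)); apply: ccvgM; first exact: ccvg_cst.
apply: ccvg_normc0.
rewrite (_ : (fun _ => _) = fun N => (N.+1%:R^-1) `^ (Re w - 1)); last first.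
  by apply/funext => N; rewrite normc_cpow// !ReImE -powR_inv1 ?ler0n//
    -powRrM mulN1r opprB.
have w10 : 0 < Re w - 1 by rewrite subr_gt0.
apply: (cvg_at_rightP _ _ _).1 (powR_cvg0 w10) _ _.
by split; [move=> n; rewrite invr_gt0|exact: cvg_harmonic].
Qed.

(** The identity theorem along the line Im w = s, which avoids the pole at 1.
    The equation is multiplied by w - 1 so that both sides are built from
    analytic functions by sums and products with affine functions. *)
Lemma zeta_fracJ_line (s t : R) (w := t%:C + (0 +i* s)) : s != 0 -> 0 < t ->
  (w - 1) * zeta w = w - w * ((w - 1) * fracJ w).
Proof.
move=> s0 t0; rewrite /w; set c : C := 0 +i* s.
pose G (u : R) : C := (u%:C + (c - 1)) * zeta (u%:C + c)
  + ((-1) * (u%:C + c) + (u%:C + c) * ((u%:C + (c - 1)) * fracJ (u%:C + c))).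
have wn1 u : u%:C + c != 1.
  by apply/negP => /eqP /(congr1 Im); rewrite !ReImE /= add0r => /eqP; exact/negP.
suff : G t = 0.
  move=> H; apply/eqP; rewrite -subr_eq0; apply/eqP; apply: etrans _ H.
  by rewrite /G; ring.
apply: (@canalytic_identity R G 0 1) t0.
- move=> u u0; apply: canalyticD; last apply: canalyticD.
  + apply: canalyticX.
    have := @analytic_at_line R zeta c 1 u; rewrite ComplexField.Normc.normc1 mulr1 => /(_ erefl).
    rewrite [c + _]addrC => /(_ (zetaP.1 _ (wn1 u))).
    by under eq_fun do rewrite mulr1 addrC.
  + have : canalytic (fun u : R => (u%:C + c) * -1) u.
      by apply: canalyticX; exact: canalytic_cst.
    by under eq_fun do rewrite mulrC.
  + by do 2 apply: canalyticX; exact: fracJ_canalytic.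
- move=> u u1; rewrite /G zeta_fracJ_Re_gt1; last by rewrite !ReImE /= addr0.
  have w1 : u%:C + c - 1 != 0 by rewrite subr_eq0.
  by rewrite addrA; field.
Qed.

Lemma zeta_half (s : R) (w := (2^-1 : R)%:C + (0 +i* s)) :
  zeta w = w / (w - 1) - w * fracJ w.
Proof.
have wE (x y : R) : x%:C + (0 +i* y) = x +i* y.
  by apply: complex_eq; rewrite !ReImE /= ?addr0 ?add0r.
have wn1 : w - 1 != 0.
  rewrite subr_eq0; apply/negP => /eqP /(congr1 Re); rewrite /w !ReImE /=.
  have : 2^-1 + 0 <> 1 :> R by lra.
  by [].
suff H : (w - 1) * zeta w = w - w * ((w - 1) * fracJ w).
  by apply: (mulfI wn1); rewrite H; field.
have [s0|s0] := eqVneq s 0; last by apply: zeta_fracJ_line.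
(* at the real point 1/2 the identity follows by continuity along the critical line *)
pose h n : R := n.+1%:R^-1.
pose wn n : C := (2^-1 : R)%:C + (0 +i* h n).
have cw : ccvg wn w.
  apply: ccvgD; first exact: ccvg_cst.
  split; first exact: cvg_cst.
  by rewrite s0; exact: cvg_harmonic.
have cJ : ccvg (fun n => fracJ (wn n)) (fracJ w).
  have h2 : 0 < 2^-1 :> R by [].
  apply: (cintegral_dct measurable_from1 _ _ (integrable_powR_from1 h2) _).2.
  - move=> n; apply: cmeasurableM; last exact: cmeasurable_cpow1.
    by apply: cmeasurable_real; exact: measurable_frac_part.
  - move=> x /from1_pos[x0 x1]; apply: ccvgM; first exact: ccvg_cst.
    apply: ccvg_cpow; apply: ccvgD; last exact: ccvg_cst.
    rewrite (_ : (fun _ => _) = fun n => (-1) * wn n); last first.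
      by apply/funext => n; rewrite mulN1r.
    by rewrite -[- w]mulN1r; apply: ccvgM; [exact: ccvg_cst|exact: cw].
  - move=> n x /from1_pos[x0 x1]; rewrite normcM normc_real normc_cpow_from1//.
    have /andP[f0 f1] := frac_part_itv (ltW x0).
    by rewrite !ReImE /= addr0 ger0_norm// ler_piMl ?powR_ge0.
have cz : ccvg (fun n => zeta (wn n)) (zeta w).
  pose d : C := 0 +i* 1.
  have d1 : normc d = 1 by rewrite /= expr0n /= add0r expr1n sqrtr1.
  have wd (y : R) : (2^-1 : R)%:C + y%:C * d = (2^-1 : R)%:C + (0 +i* y).
    by congr (_ + _); apply: complex_eq; rewrite ?ReM ?ImM /= !(mulr0, mul0r, mulr1, subr0, addr0).
  have aw : analytic_at zeta ((2^-1 : R)%:C + (0 : R)%:C * d).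
    rewrite (_ : _ + _ = w); last by rewrite wd /w s0.
    by apply: zetaP.1; rewrite -subr_eq0.
  have := canalytic_continuous (analytic_at_line d1 aw) (@cvg_harmonic R).
  rewrite wd /w s0; rewrite (_ : (fun n => _) = fun n => zeta (wn n))//.
  by apply/funext => n; rewrite wd.
apply: (@ccvg_unique R (fun n => (wn n - 1) * zeta (wn n))).
    by apply: ccvgM => //; apply: ccvgD => //; exact: ccvg_cst.
rewrite (_ : (fun n => _) = fun n => wn n + (-1) * (wn n * ((wn n - 1) * fracJ (wn n)))); last first.
  apply/funext => n; rewrite mulN1r; apply: zeta_fracJ_line => //.
  by rewrite /h gt_eqF.
rewrite -[X in w - X]mul1r -mulNr.
apply: ccvgD => //; apply: ccvgM; first exact: ccvg_cst.
apply: ccvgM => //; apply: ccvgM => //; apply: ccvgD => //; exact: ccvg_cst.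
Qed.

Theorem zetaN_cvg_half (s : R) : ccvg (zetaN (2^-1 +i* s)) (zeta (2^-1 +i* s)).
Proof.
have E : (2^-1 : R)%:C + (0 +i* s) = 2^-1 +i* s.
  by apply: complex_eq; rewrite !ReImE /= ?addr0 ?add0r.
have := zeta_half s; rewrite E => ->; apply: ccvg_zetaN; first by rewrite /= invr_gt0.
by clear E; apply/negP => /eqP /(congr1 Re); rewrite /= => h; lra.
Qed.

End zeta.
End ZetaIdentity.

(** * Unfolding an integral over the circle *)

Section CircleUnfolding.
Context {R : realType}.
Local Notation C := R[i].
Local Notation Re := (@complex.Re R).
Local Notation Im := (@complex.Im R).
Local Notation normc := (@ComplexField.Normc.normc R).
Local Notation leb := (@lebesgue_measure R).
Local Notation pos := (`]0, +oo[%classic : set R).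

Lemma cintegral_itv_cat (a b c : R) (f : R -> C) : a <= b -> b <= c ->
  cintegrable `[a, c[ f ->
  cintegral `[a, c[ f = cintegral `[a, b[ f + cintegral `[b, c[ f.
Proof.
move=> ab bc [rf jf].
have E : `[a, c[%classic = (`[a, b[ `|` `[b, c[)%classic :> set R.
  apply/seteqP; split => x /=; rewrite !in_itv /=.
    by move=> /andP[ax xc]; case: (ltP x b) => h; [left|right]; rewrite ?ax.
  by move=> [/andP[-> h]|/andP[h ->]]; rewrite ?(lt_le_trans h)// ?(le_trans ab).
have D : [disjoint `[a, b[%classic & `[b, c[%classic].
  apply/disj_setPS => x [] /=; rewrite !in_itv /= => /andP[_ h1] /andP[h2 _].
  by move: h1; rewrite ltNge h2.
rewrite E in rf jf; apply: complex_eq; rewrite ?ReD ?ImD /= E.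
  by rewrite Rintegral_setU//; exact: measurable_itv.
by rewrite Rintegral_setU//; exact: measurable_itv.
Qed.

(** Every sum over the powers of mu below is dominated by a geometric series. *)
Lemma csum_geometric (a : nat -> C) (B q : R) : 0 <= q < 1 ->
  (forall k, normc (a k) <= B * q ^+ k) -> ccvg (series a) (csum a).
Proof.
move=> /andP[q0 q1] aB.
have gc : cvgn (series (geometric B q)) by apply: is_cvg_geometric_series; rewrite ger0_norm.
have key (g : C -> R) : (forall z, `|g z| <= normc z) -> cvgn (series (g \o a)).
  move=> gn; apply: normed_cvg; apply: (series_le_cvg _ _ _ gc) => n /=.
  - exact: normr_ge0.
  - exact: le_trans (normc_ge0 _) (aB n).
  - exact: le_trans (gn _) (aB n).
have h : ccvg (series a) (limn (series (Re \o a)) +i* limn (series (Im \o a))).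
  split => /=.
  - rewrite (_ : Re \o _ = series (Re \o a)); first exact: key normc_Re_le.
    by apply/funext => n; rewrite /series /= Re_sum.
  - rewrite (_ : Im \o _ = series (Im \o a)); first exact: key normc_Im_le.
    by apply/funext => n; rewrite /series /= Im_sum.
by rewrite (csumE h).
Qed.

Lemma sqrtr_exp (x : R) k : 0 <= x -> Num.sqrt (x ^+ k) = Num.sqrt x ^+ k.
Proof.
move=> x0; elim: k => [|k ih]; first by rewrite !expr0 sqrtr1.
by rewrite !exprS sqrtrM// ih.
Qed.

Section unfold.
Variables (mu B : R) (phi chi : R -> C).
Hypothesis mu1 : 1 < mu.
Hypothesis mphi : cmeasurable pos phi.
Hypothesis phiB : forall u : R, 0 < u -> normc (phi u) <= B * (u * dom u).
Hypothesis mchi : cmeasurable pos chi.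
Hypothesis chi1 : forall u : R, 0 < u -> normc (chi u) <= 1.
Hypothesis chi_mu : forall u : R, 0 < u -> chi (mu * u) = chi u.

Local Notation fund := (`[1, mu[%classic : set R).

Let mu0 : 0 < mu. Proof. exact: lt_trans mu1. Qed.

Let q := (Num.sqrt mu)^-1.

Let q0 : 0 <= q. Proof. by rewrite invr_ge0 sqrtr_ge0. Qed.

Let q1 : q < 1.
Proof. by rewrite invf_lt1 ?sqrtr_gt0// -[ltLHS]sqrtr1 ltr_sqrt. Qed.

Let B0 : 0 <= B.
Proof.
have := le_trans (normc_ge0 _) (phiB ltr01).
by rewrite pmulr_lge0// mul1r invr_gt0 mulr_gt0 ?sqrtr_gt0// addr_gt0.
Qed.

Lemma fund_bounds u : fund u -> 1 <= u /\ u < mu /\ 0 < u.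
Proof. by rewrite /= in_itv /= => /andP[h1 h2]; do !split => //; exact: lt_le_trans h1. Qed.

(** The decay of phi at infinity makes the terms with positive powers of mu
    geometric. *)
Lemma phi_expand_le u k : fund u -> normc (phi (mu ^+ k * u)) <= B * q ^+ k.
Proof.
move=> /fund_bounds[u1 [_ u0]].
have muk0 : 0 < mu ^+ k by rewrite exprn_gt0.
have v0 : 0 < mu ^+ k * u by rewrite mulr_gt0.
apply: le_trans (phiB v0) _; rewrite ler_wpM2l//.
apply: le_trans (id_dom_le_sqrtV v0) _.
rewrite /q exprVn -sqrtr_exp ?(ltW mu0)// lef_pV2 ?posrE ?sqrtr_gt0//.
by apply: ler_wsqrtr; rewrite ler_peMr// ltW.
Qed.

(** The decay of phi at 0 makes the terms with negative powers of mu
    geometric. *)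
Lemma phi_contract_le u k : fund u -> normc (phi (mu ^- k.+1 * u)) <= B * q ^+ k.
Proof.
move=> /fund_bounds[_ [um u0]].
have muk0 : 0 < mu ^- k.+1 by rewrite invr_gt0 exprn_gt0.
have v0 : 0 < mu ^- k.+1 * u by rewrite mulr_gt0.
apply: le_trans (phiB v0) _; rewrite ler_wpM2l//.
apply: le_trans (id_dom_le_sqrt v0) _.
rewrite /q exprVn -sqrtr_exp ?(ltW mu0)// -sqrtrV ?exprn_ge0 ?(ltW mu0)//.
apply: ler_wsqrtr; rewrite exprSr invfM -mulrA ler_piMr//.
  by rewrite invr_ge0 exprn_ge0// ltW.
by rewrite mulrC ler_pdivrMr// mul1r ltW.
Qed.

Definition partial_Sigma N u : C :=
  series (fun k => phi (mu ^+ k * u)) N + series (fun k => phi (mu ^- k.+1 * u)) N.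

Lemma ccvg_partial_Sigma u : fund u -> ccvg (partial_Sigma ^~ u) (Sigma_map mu phi u).
Proof.
move=> fu; have q01 : 0 <= q < 1 by rewrite q0.
apply: ccvgD; apply: (csum_geometric q01) => k.
- exact: phi_expand_le.
- exact: phi_contract_le.
Qed.

Lemma partial_Sigma_le N u : fund u -> normc (partial_Sigma N u) <= 2 * B / (1 - q).
Proof.
move=> fu.
have geo (a : nat -> C) : (forall k, normc (a k) <= B * q ^+ k) -> normc (series a N) <= B / (1 - q).
  move=> aB; apply: le_trans (normc_sum_le _ _ _) _.
  apply: (@le_trans _ _ (\sum_(0 <= k < N) B * q ^+ k)); first by apply: ler_sum.
  rewrite -mulr_sumr ler_wpM2l//.
  rewrite -[leRHS]mul1r ler_pdivlMr ?subr_gt0//.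
  have : (1 - q) * \sum_(0 <= k < N) q ^+ k = 1 - q ^+ N.
    by rewrite big_mkord -[1 - q]opprB mulNr -subrX1 opprB.
  rewrite mulrC => ->; rewrite lerBlDr lerDl exprn_ge0//.
have -> : 2 * B / (1 - q) = B / (1 - q) + B / (1 - q) by ring.
apply: le_trans (normcD_le _ _) _; apply: lerD; apply: geo => k.
- exact: phi_expand_le.
- exact: phi_contract_le.
Qed.

Let psi u := chi u * phi u * (u^-1)%:C.

Lemma psi_measurable : cmeasurable pos psi.
Proof.
apply: cmeasurableM; first exact: cmeasurableM.
apply: cmeasurable_real; exact: measurable_inv.
Qed.

Lemma psi_bound u : 0 < u -> normc (psi u) <= B * dom u.
Proof.
move=> u0; rewrite /psi !normcM normc_real (gtr0_norm (_ : 0 < u^-1)) ?invr_gt0//.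
rewrite ler_pdivrMr// -mulrA [dom u * u]mulrC -[leRHS]mul1r.
by rewrite ler_pM ?normc_ge0 ?chi1 ?phiB.
Qed.

Lemma psi_integrable : cintegrable pos psi.
Proof.
apply: (cintegrable_le (@measurable_pos R) psi_measurable _ (integrable_domZ B)).
by move=> u; rewrite /= in_itv /= andbT; exact: psi_bound.
Qed.

Lemma cintegrableS (D E : set R) (f : R -> C) :
  (@measurable _ (measurableTypeR R)) D -> (@measurable _ (measurableTypeR R)) E ->
  E `<=` D -> cintegrable D f -> cintegrable E f.
Proof. by move=> mD mE ED [rf jf]; split; [move: rf|move: jf]; apply: integrableS. Qed.

Lemma itv_pos (a b : R) : 0 < a -> `[a, b[%classic `<=` pos.
Proof. by move=> a0 x; rewrite /= !in_itv /= andbT => /andP[+ _]; exact: lt_le_trans. Qed.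

Lemma psi_integrable_itv (a b : R) : 0 < a -> cintegrable `[a, b[ psi.
Proof.
move=> a0; apply: cintegrableS psi_integrable; [exact: measurable_pos|exact: measurable_itv|exact: itv_pos].
Qed.

Lemma psi_scale (a : R) : 0 < a -> (forall u, 0 < u -> chi (a * u) = chi u) ->
  cintegrable fund (fun u => chi u * phi (a * u) * (u^-1)%:C) /\
  cintegral `[a, mu * a[ psi = cintegral fund (fun u => chi u * phi (a * u) * (u^-1)%:C).
Proof.
move=> a0 chia.
have mI : (@measurable _ (measurableTypeR R)) `[a, mu * a[ by exact: measurable_itv.
have [] := cintegral_scale a0 mI (psi_integrable_itv (mu * a) a0).
have -> : (fun x => a * x) @^-1` `[a, mu * a[ = fund.
  apply/seteqP; split => x /=; rewrite !in_itv /=;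
  by rewrite ler_pMr// [mu * a]mulrC ltr_pM2l.
move=> ih ->.
have mF : (@measurable _ (measurableTypeR R)) fund by exact: measurable_itv.
have E u : fund u -> a%:C * psi (a * u) = chi u * phi (a * u) * (u^-1)%:C.
  move=> /fund_bounds[_ [_ u0]]; rewrite /psi chia// mulrCA; congr (_ * _).
  by rewrite -rmorphM; congr (_%:C); field; rewrite !gt_eqF.
split; first exact: (eq_cintegrable mF E (cintegrableZ _ mF ih)).
by rewrite -(cintegralZ _ mF ih); exact: eq_cintegral.
Qed.

Lemma chi_expn k u : 0 < u -> chi (mu ^+ k * u) = chi u.
Proof.
elim: k u => [|k ih] u u0; first by rewrite mul1r.
by rewrite exprS -mulrA chi_mu ?ih// mulr_gt0// exprn_gt0.
Qed.

Lemma chi_expVn k u : 0 < u -> chi (mu ^- k * u) = chi u.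
Proof.
move=> u0; rewrite -(chi_expn k); last by rewrite mulr_gt0// invr_gt0 exprn_gt0.
by rewrite mulrA divff ?mul1r// gt_eqF// exprn_gt0.
Qed.

(** By invariance of chi and of du/u, the integral of a term over [1, mu[ is that
    of psi over the dilate of [1, mu[, and these dilates tile
    [mu^(-N), mu^N[. *)
Lemma cintegral_partial_Sigma N :
  cintegrable fund (fun u => chi u * partial_Sigma N u * (u^-1)%:C) /\
  cintegral fund (fun u => chi u * partial_Sigma N u * (u^-1)%:C) =
  cintegral `[mu ^- N, mu ^+ N[ psi.
Proof.
have mF : (@measurable _ (measurableTypeR R)) fund by exact: measurable_itv.
have muk k : 0 < mu ^+ k by rewrite exprn_gt0.
have muVk k : 0 < mu ^- k by rewrite invr_gt0.
have i1 k := (psi_scale (muk k) (@chi_expn k)).1.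
have e1 k : cintegral `[mu ^+ k, mu ^+ k.+1[ psi =
    cintegral fund (fun u => chi u * phi (mu ^+ k * u) * (u^-1)%:C).
  by rewrite exprS; exact: (psi_scale (muk k) (@chi_expn k)).2.
have i2 k := (psi_scale (muVk k.+1) (@chi_expVn k.+1)).1.
have e2 k : cintegral `[mu ^- k.+1, mu ^- k[ psi =
    cintegral fund (fun u => chi u * phi (mu ^- k.+1 * u) * (u^-1)%:C).
  rewrite -(psi_scale (muVk k.+1) (@chi_expVn k.+1)).2.
  by rewrite (_ : mu * mu ^- k.+1 = mu ^- k)// exprS invfM mulrA divff ?mul1r// gt_eqF.
have [s1 es1] := cintegral_sum N mF i1; have [s2 es2] := cintegral_sum N mF i2.
have E : (fun u => chi u * partial_Sigma N u * (u^-1)%:C) =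
    (fun u => \sum_(0 <= k < N) (chi u * phi (mu ^+ k * u) * (u^-1)%:C) +
      \sum_(0 <= k < N) (chi u * phi (mu ^- k.+1 * u) * (u^-1)%:C)).
  apply/funext => u.
  by rewrite /partial_Sigma /series /= -!mulr_suml -!mulr_sumr; ring.
rewrite E; split; first exact: cintegrableD mF s1 s2.
rewrite (cintegralD mF s1 s2) es1 es2.
under eq_bigr do rewrite -e1; under [X in _ + X]eq_bigr do rewrite -e2.
clear s1 es1 s2 es2 E.
elim: N => [|N ih].
  rewrite !big_nil addr0 expr0 invr1 set_itvco0.
  by rewrite /cintegral !Rintegral_set0.
rewrite !big_nat_recr//= addrACA ih.
have le1 k : mu ^+ k <= mu ^+ k.+1 by rewrite exprS ler_peMl// ltW.
have le2 : mu ^- N.+1 <= mu ^- N by rewrite lef_pV2 ?posrE.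
have le3 : mu ^- N <= mu ^+ N.
  by rewrite (@le_trans _ _ 1)// ?invf_le1// exprn_ege1// ltW.
rewrite [RHS](@cintegral_itv_cat _ (mu ^- N))//; last 2 first.
- exact: le_trans le3 (le1 N).
- exact: psi_integrable_itv.
rewrite (@cintegral_itv_cat (mu ^- N) (mu ^+ N))//; last exact: psi_integrable_itv.
by ring.
Qed.

Lemma mu_pow_exhaust x : 0 < x -> exists N, forall n, (N <= n)%N -> mu ^- n <= x < mu ^+ n.
Proof.
move=> x0.
have mv : `|mu^-1| < 1 by rewrite gtr0_norm ?invr_gt0// invf_lt1.
have /cvgrPdist_lt/(_ (Num.min x x^-1)) := cvg_expr mv.
rewrite lt_min x0 invr_gt0 x0 => /(_ isT)[N _ hN]; exists N => n /hN /=.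
have muVk : 0 < mu ^- n by rewrite invr_gt0 exprn_gt0.
rewrite sub0r normrN exprVn (gtr0_norm muVk) lt_min => /andP[/ltW -> h]/=.
by move: h; rewrite ltf_pV2 ?posrE ?exprn_gt0.
Qed.

(** Both sides of [cintegral_partial_Sigma] converge: the left one by the
    geometric bounds, the right one because the intervals exhaust the
    half-line. *)
Theorem circle_unfolding :
  cintegrable fund (fun u => chi u * Sigma_map mu phi u * (u^-1)%:C) /\
  cintegral fund (fun u => chi u * Sigma_map mu phi u * (u^-1)%:C) = cintegral pos psi.
Proof.
have mF : (@measurable _ (measurableTypeR R)) fund by exact: measurable_itv.
have ifin : leb.-integrable fund (EFin \o (fun=> 2 * B / (1 - q))).
  have h : leb.-integrable `[1, mu] (EFin \o (fun=> 2 * B / (1 - q))).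
    apply: continuous_compact_integrable; first exact: segment_compact.
    by apply: continuous_subspaceT => x; exact: cvg_cst.
  apply: integrableS h => //.
  by move=> x; rewrite /= !in_itv /= => /andP[-> /ltW].
have [||i c] := @cintegral_dct R fund (fun N u => chi u * partial_Sigma N u * (u^-1)%:C)
  (fun u => chi u * Sigma_map mu phi u * (u^-1)%:C) _ mF
  (fun N => cintegrable_measurable (cintegral_partial_Sigma N).1) _ ifin.
- move=> u fu; apply: ccvgM; last exact: ccvg_cst.
  by apply: ccvgM; [exact: ccvg_cst|exact: ccvg_partial_Sigma].
- move=> N u fu; have [u1 [_ u0]] := fund_bounds fu.
  rewrite !normcM normc_real (gtr0_norm (_ : 0 < u^-1)) ?invr_gt0//.
  rewrite ler_pdivrMr// (le_trans _ (ler_peMr _ u1))//; last first.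
    by rewrite divr_ge0 ?mulr_ge0// subr_ge0 ltW.
  by rewrite -[leRHS]mul1r ler_pM ?normc_ge0 ?chi1 ?partial_Sigma_le.
split => //.
apply: ccvg_unique c _.
rewrite (_ : (fun n => _) = fun N => cintegral pos (fun x => (((fun _ : R => (1 : R)) \_ (`[mu ^- N, mu ^+ N[%classic : set R)) x)%:C * psi x)); last first.
  apply/funext => N; rewrite (cintegral_partial_Sigma N).2 cintegral_patch setIidr; last first.
    by apply: itv_pos; rewrite invr_gt0 exprn_gt0.
  by apply: eq_cintegral => x _; rewrite mul1r.
apply: (cintegral_dct (@measurable_pos R) _ _ (integrable_domZ B) _).2.
- move=> N; apply: cmeasurableM; last exact: psi_measurable.
  apply: cmeasurable_real; apply: (measurable_restrict _ _ _).1.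
  + exact: measurable_itv.
  + exact: measurable_itv.
  + exact: measurable_cst.
- move=> x; rewrite /= in_itv /= andbT => x0; have [N hN] := mu_pow_exhaust x0.
  rewrite -[X in ccvg _ X]mul1r; apply: ccvgM; last exact: ccvg_cst.
  apply: (@ccvg_real R _ 1); apply: cvg_near_cst; exists N => // n /= Nn.
  by rewrite patchE mem_set//= in_itv /= hN.
- move=> N x; rewrite /= in_itv /= andbT => x0.
  rewrite normcM normc_real; apply: le_trans (psi_bound x0).
  rewrite ler_piMl ?normc_ge0// patchE.
  by case: ifP; rewrite ?normr1 ?normr0.
Qed.

End unfold.
End CircleUnfolding.

(** * Even Schwartz functions with zero integral *)

Section SchwartzTame.
Context {R : realType}.
Local Notation leb := (@lebesgue_measure R).
Implicit Types f : R -> R.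

Lemma integrable_oneDsqrV : leb.-integrable setT (EFin \o (fun x : R => (oneDsqr x)^-1)).
Proof.
have mf : measurable_fun [set: R] (fun x : R => (oneDsqr x)^-1).
  by apply: continuous_measurable_fun; exact: continuous_oneDsqrV.
have V0 (x : R) : 0 <= (oneDsqr x)^-1.
  by rewrite invr_ge0 (le_trans ler01 (oneDsqr_ge1 x)).
apply/integrableP; split; first exact/measurable_EFinP.
rewrite (eq_integral (fun x : measurableTypeR R => ((oneDsqr x)^-1)%:E)); last first.
  by move=> x _; rewrite /= ger0_norm.
rewrite ge0_symfun_integralT//; last 2 first.
- exact: continuous_oneDsqrV.
- by move=> x; rewrite /= /oneDsqr sqrrN.
rewrite (_ : [set x : R | 0 <= x] = `[0, +oo[%classic); last first.
  by apply/seteqP; split => x; rewrite /= in_itv /= andbT.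
by rewrite integral0y_oneDsqr -EFinM ltry.
Qed.

Lemma rapid_decay_oneDsqr (g : R -> R) :
  (forall m : nat, exists M : R, forall x, `|x ^+ m * g x| <= M) ->
  exists2 K : R, 0 <= K & forall x, `|g x| <= K / oneDsqr x.
Proof.
move=> dg; have [M0 h0] := dg 0%N; have [M2 h2] := dg 2%N.
have K0 : 0 <= M0 + M2.
  by have := le_trans (normr_ge0 _) (h0 0); have := le_trans (normr_ge0 _) (h2 0); lra.
exists (M0 + M2) => // x; have x1 := oneDsqr_ge1 x.
rewrite ler_pdivlMr ?(lt_le_trans ltr01)//.
have := h0 x; have := h2 x; rewrite expr0 mul1r normrM ger0_norm ?sqr_ge0//.
rewrite /oneDsqr => ? ?; rewrite mulrDr mulr1; lra.
Qed.

Lemma oneDsqr_le_sqr (K t : R) : 0 <= K -> 0 <= t -> K / oneDsqr t <= 2 * K / (1 + t) ^+ 2.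
Proof.
move=> K0 t0; have t1 : 0 < 1 + t by rewrite ltr_pwDl.
have o1 : 0 < oneDsqr t by rewrite (lt_le_trans ltr01)// oneDsqr_ge1.
rewrite ler_pdivrMr// mulrAC ler_pdivlMr ?exprn_gt0//.
rewrite [2 * K]mulrC -mulrA ler_wpM2l// /oneDsqr.
have := sqr_ge0 (1 - t); rewrite !expr2; lra.
Qed.

(** Let G(v) be the integral of f up to v.  By evenness G(v) + G(-v) is constant,
    while G tends to the integral of f, which is 0, at +oo and to 0 at -oo;
    so this constant is 0, and G vanishes at 0 as well as at infinity. *)
Lemma schwartz_tame f : real_schwartz f -> (forall x, f (- x) = f x) ->
  \int[leb]_(x in setT) f x = 0 -> exists F K, tame f F K.
Proof.
move=> [df bf] fev f0.
have [K1 K10 fK] := rapid_decay_oneDsqr (fun m => bf m 0%N).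
have [K2 K20 f'K] := rapid_decay_oneDsqr (fun m => bf m 1%N).
have d1 (t : R) : is_derive t 1 f (derive1n 1 f t).
  have dft := df 0%N t; split => //=; by rewrite derive1E.
have cf (t : R) : {for t, continuous f} := derivable_continuous (d1 t).
have mf : measurable_fun [set: R] f by apply: continuous_measurable_fun => t; exact: cf.
have mT : (@measurable _ (measurableTypeR R)) [set: R] by exact: measurableT.
have iK : leb.-integrable setT (EFin \o (fun x : R => K1 / oneDsqr x)).
  exact: (integrableZl mT K1 integrable_oneDsqrV).
have fi : leb.-integrable setT (EFin \o f).
  by apply: (le_real_integrable mT mf _ iK) => x _; exact: fK.
have fiI (I : set R) : (@measurable _ (measurableTypeR R)) I -> leb.-integrable I (EFin \o f).
  by move=> mI; apply: integrableS fi.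
pose G (v : R) := \int[leb]_(x in `]-oo, v]) f x.
have dG (v : R) : is_derive v 1 G (f v).
  have vv : v < v + 1 by rewrite ltrDl.
  have [||dGv GE] := @continuous_FTC1 R f -oo%O v (v + 1) vv _ _ (cf v).
  - by apply: fiI; exact: measurable_itv.
  - exact: ltNyr.
  by split; [exact: dGv|rewrite -derive1E; exact: GE].
have lim (u : nat -> R) (a : R -> R) :
    (forall x : R, exists N, forall n, (N <= n)%N -> (x \in `]-oo, u n]%classic) = (a x == 1)) ->
    (forall x, a x = 0 \/ a x = 1) ->
    G (u n) @[n --> \oo] --> \int[leb]_(x in setT) (a x * f x).
  move=> ua a01.
  have [||||_] := @real_dct R setT (fun n => f \_ (`]-oo, u n]%classic : set R))
    (fun x => a x * f x) (fun x => K1 / oneDsqr x) mT.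
  - move=> n; apply: (measurable_restrict f _ _).1 => //.
    exact: measurable_funTS.
  - move=> x _; apply: cvg_near_cst; have [N hN] := ua x; exists N => // n /= Nn.
    by rewrite patchE hN//; case: (a01 x) => ->; rewrite ?eqxx ?mul1r// eq_sym oner_eq0 mul0r.
  - exact: iK.
  - move=> n x _; rewrite patchE; case: ifP => _; first exact: fK.
    by rewrite normr0 (le_trans _ (fK x)).
  rewrite (_ : (fun n => _) = G \o u)//; apply/funext => n /=.
  apply: etrans (esym (@Rintegral_mkcondr _ (measurableTypeR R) R leb setT _ f)) _.
  by rewrite setTI.
have Gy (u : nat -> R) : u @ \oo --> +oo -> G (u n) @[n --> \oo] --> (0 : R).
  move=> uy; rewrite -f0 (_ : \int[leb]_(x in setT) f x = \int[leb]_(x in setT) (1 * f x)); last first.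
    by apply: eq_Rintegral => x _; rewrite mul1r.
  apply: (lim u (fun=> 1)); last by right.
  move=> x; move/cvgryPge : uy => /(_ x)[N _ hN]; exists N => n Nn.
  by rewrite eqxx mem_set//= in_itv /=; exact: hN.
have GNy (u : nat -> R) : u @ \oo --> +oo -> G (- u n) @[n --> \oo] --> (0 : R).
  move=> uy; rewrite (_ : 0 = \int[leb]_(x in setT) (0 * f x)); last first.
    rewrite (_ : (fun x => 0 * f x) = fun=> 0); last by apply/funext => x; rewrite mul0r.
    by rewrite /Rintegral integral0.
  apply: (lim (fun n => - u n) (fun=> 0)); last by left.
  move=> x; move/cvgryPge : uy => /(_ (- x + 1))[N _ hN]; exists N => n Nn.
  rewrite eq_sym oner_eq0; apply/negbTE/negP => /set_mem; rewrite /= in_itv /=.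
  have := hN n Nn; rewrite /=; lra.
pose F (v : R) := G v - G 0.
have dF (v : R) : is_derive v 1 F (f v).
  by rewrite /F; apply: is_derive_eq; rewrite subr0.
have Fodd (v : R) : F v + F (- v) = 0.
  have dFN (t : R) : is_derive t 1 (fun v => F v + F (- v)) 0.
    have d := dF (- t).
    apply: is_derive_eq; rewrite fev /GRing.scale /=; ring.
  by have /= -> := is_derive_0_is_cst v 0 dFN; rewrite oppr0 /F subrr addr0.
have G00 : G 0 = 0.
  have : (fun n : nat => F n%:R + F (- n%:R)) @ \oo --> (0 - G 0) + (0 - G 0).
    apply: cvgD; apply: cvgB; try exact: cvg_cst.
    - by apply: Gy; exact: cvgr_idn.
    - by apply: GNy; exact: cvgr_idn.
  rewrite (_ : (fun n => _) = fun=> 0); last by apply/funext => n; rewrite Fodd.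
  have h0 : (fun _ : nat => 0 : R) @ \oo --> (0 : R) by exact: cvg_cst.
  have aux (g : R) : 0 = 0 - g + (0 - g) -> g = 0 by move=> ?; lra.
  by move=> h; apply: aux; exact: (cvg_unique _ h0 h).
exists F, (2 * (K1 + K2)); split.
- exists (derive1n 1 f) => // t t0; apply: le_trans (f'K t) _.
  apply: le_trans (oneDsqr_le_sqr K20 t0) _.
  by rewrite ler_wpM2r ?invr_ge0 ?sqr_ge0//; lra.
- move=> t t0; apply: le_trans (fK t) _.
  apply: le_trans (oneDsqr_le_sqr K10 t0) _.
  by rewrite ler_wpM2r ?invr_ge0 ?sqr_ge0//; lra.
- by [].
- by rewrite /F subrr.
- rewrite /F G00; apply/cvg_pinftyP => u uy.
  by under eq_fun do rewrite subr0; exact: Gy.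
Qed.

End SchwartzTame.

(** * The pairing of a character with the image of the summation map *)

Section Pairing.
Context {R : realType}.
Local Notation C := R[i].
Local Notation Re := (@complex.Re R).
Local Notation Im := (@complex.Im R).
Local Notation normc := (@ComplexField.Normc.normc R).
Local Notation pos := (`]0, +oo[%classic : set R).
Local Opaque cintegral.

Lemma S0ev_tame (f : R -> C) : S0ev f ->
  (exists F K, tame (Re_fun f) F K) /\ (exists F K, tame (Im_fun f) F K).
Proof.
move=> [[sr si] fev _ f0]; split.
- apply: schwartz_tame => //; first by move=> x; rewrite /Re_fun fev.
  exact: (congr1 Re f0).
- apply: schwartz_tame => //; first by move=> x; rewrite /Im_fun fev.
  exact: (congr1 Im f0).
Qed.

Lemma normc_cpow_im (s u : R) : 0 < u -> normc (cpow u (0 +i* s)) = 1.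
Proof. by move=> u0; rewrite normc_cpow//= powRr0. Qed.

Section pairing.
Variables (f : R -> C) (F1 F2 : R -> R) (K1 K2 : R).
Hypothesis t1 : tame (Re_fun f) F1 K1.
Hypothesis t2 : tame (Im_fun f) F2 K2.
Variable zeta : C -> C.
Hypothesis zetaP : is_riemann_zeta zeta.
Variables (mu s : R).
Hypothesis mu1 : 1 < mu.
Hypothesis mus : cpow mu (0 +i* s) = 1.

Let z : C := 2^-1 +i* s.
Let I : C := 0 +i* 1.

Let splitE (a b : R) : a +i* b = a%:C + I * b%:C.
Proof. by apply: complex_eq; rewrite ?ReD ?ImD ?ReM ?ImM /= !(mul0r, mul1r, mulr0, subr0, addr0, add0r). Qed.

Lemma E_map_dilation_sum u : 0 < u ->
  E_map f u = (Num.sqrt u)%:C * ((dilation_sum (Re_fun f) u)%:C + I * (dilation_sum (Im_fun f) u)%:C).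
Proof.
move=> u0; rewrite /E_map; congr (_ * _); rewrite -splitE; apply: csumE; split => /=.
- rewrite (_ : Re \o _ = series (fun i => Re_fun f (i.+1%:R * u))).
    exact: (cvg_dilation_sum t1).
  by apply/funext => n; rewrite /series /= Re_sum.
- rewrite (_ : Im \o _ = series (fun i => Im_fun f (i.+1%:R * u))).
    exact: (cvg_dilation_sum t2).
  by apply/funext => n; rewrite /series /= Im_sum.
Qed.

Let phi (u : R) : C := (Num.sqrt u)%:C * ((dilation_sum (Re_fun f) u)%:C + I * (dilation_sum (Im_fun f) u)%:C).

Lemma measurable_sqrt_pos : measurable_fun pos (@Num.sqrt R).
Proof. by apply: measurable_pos_continuous => x _; exact: sqrt_continuous. Qed.

Lemma cmeasurable_E_map : cmeasurable pos phi.
Proof.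
apply: cmeasurableM; first by apply: cmeasurable_real; exact: measurable_sqrt_pos.
apply: cmeasurableD; first by apply: cmeasurable_real; exact: measurable_dilation_sum t1.
apply: cmeasurableM; first exact: cmeasurable_cst.
by apply: cmeasurable_real; exact: measurable_dilation_sum t2.
Qed.

Lemma normcI : normc I = 1.
Proof. by rewrite /= expr0n /= add0r expr1n sqrtr1. Qed.

Lemma E_map_bound u : 0 < u -> normc (phi u) <= (3 * K1 + 3 * K2) * (u * dom u).
Proof.
move=> u0; rewrite /phi normcM normc_real ger0_norm ?sqrtr_ge0//.
have -> : u * dom u = Num.sqrt u / (1 + u).
  rewrite /dom -{1}(sqr_sqrtr (ltW u0)) expr2 invfM mulrACA divff ?mul1r//.
  by rewrite gt_eqF// sqrtr_gt0.
rewrite mulrCA ler_wpM2l ?sqrtr_ge0// mulrDl.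
apply: le_trans (normcD_le _ _) _; rewrite normcM normcI mul1r !normc_real.
by apply: lerD; [exact: (dilation_sum_dom t1)|exact: (dilation_sum_dom t2)].
Qed.

Lemma chi_invariant u : 0 < u -> cpow (mu * u) (0 +i* s) = cpow u (0 +i* s).
Proof. by move=> u0; rewrite (cpowMl _ (lt_trans ltr01 mu1) u0) mus mul1r. Qed.

Lemma Sigma_E_map u : 0 < u -> Sigma_map mu (E_map f) u = Sigma_map mu phi u.
Proof.
move=> u0; have mu0 : 0 < mu := lt_trans ltr01 mu1.
rewrite /Sigma_map; congr (csum _ + csum _); apply/funext => k; apply: E_map_dilation_sum.
  by rewrite mulr_gt0// exprn_gt0.
by rewrite mulr_gt0// invr_gt0 exprn_gt0.
Qed.

(** Unfold the circle, then apply the Mellin identity to the real and the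
    imaginary part of f.  The factor sqrt u of E(f) shifts the exponent is - 1
    to (1/2 + is) - 1. *)
Theorem pairing_zeta :
  cintegrable `[1, mu[ (fun u => cpow u (0 +i* s) * Sigma_map mu (E_map f) u * (u^-1)%:C) /\
  cintegral `[1, mu[ (fun u => cpow u (0 +i* s) * Sigma_map mu (E_map f) u * (u^-1)%:C) =
  zeta z * cintegral pos (fun u => f u * cpow u (z - 1)).
Proof.
have mF : (@measurable _ (measurableTypeR R)) `[1, mu[%classic by exact: measurable_itv.
have chi1 u : 0 < u -> normc (cpow u (0 +i* s)) <= 1 by move=> u0; rewrite normc_cpow_im.
have [iU eU] := circle_unfolding mu1 cmeasurable_E_map E_map_bound
  (cmeasurable_cpow (0 +i* s)) chi1 chi_invariant.
have EF u : `[1, mu[%classic u -> cpow u (0 +i* s) * Sigma_map mu phi u * (u^-1)%:C =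
    cpow u (0 +i* s) * Sigma_map mu (E_map f) u * (u^-1)%:C.
  by rewrite /= in_itv /= => /andP[h _]; rewrite Sigma_E_map// (lt_le_trans ltr01 h).
split; first exact: (eq_cintegrable mF EF iU).
rewrite -(eq_cintegral EF) eU.
have zh : Re z = 2^-1 by [].
have h1 := mellin_dilation_sum t1 zh (zetaN_cvg_half zetaP s).
have h2 := mellin_dilation_sum t2 zh (zetaN_cvg_half zetaP s).
have mP := @measurable_pos R.
have i1 := cintegrable_mellin_tame t1 zh; have i2 := cintegrable_mellin_tame t2 zh.
have j1 := cintegrable_dilation_sum t1 zh; have j2 := cintegrable_dilation_sum t2 zh.
have E1 u : pos u -> (dilation_sum (Re_fun f) u)%:C * cpow u (z - 1) + I * ((dilation_sum (Im_fun f) u)%:C * cpow u (z - 1)) =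
    cpow u (0 +i* s) * phi u * (u^-1)%:C.
  rewrite /= in_itv /= andbT => u0; rewrite /phi.
  have -> : z - 1 = (0 +i* s) + (- 2^-1)%:C.
    have e1 : 2^-1 - 1 = 0 + - 2^-1 :> R by field.
    have e2 : s - 0 = s + 0 :> R by rewrite subr0 addr0.
    by apply: complex_eq; rewrite ?ReD ?ImD; [exact: e1|exact: e2].
  rewrite cpowD cpow_real// powRN powR12_sqrt ?(ltW u0)//.
  have -> : ((Num.sqrt u)^-1)%:C = (Num.sqrt u)%:C * (u^-1)%:C :> C.
    rewrite -rmorphM; congr (_%:C).
    have sn : Num.sqrt u != 0 by rewrite gt_eqF// sqrtr_gt0.
    apply: (mulfI sn); rewrite divff// mulrA -expr2 sqr_sqrtr ?(ltW u0)// divff//.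
    by rewrite gt_eqF.
  by ring.
have E2 u : pos u -> (Re_fun f u)%:C * cpow u (z - 1) + I * ((Im_fun f u)%:C * cpow u (z - 1)) =
    f u * cpow u (z - 1).
  by move=> _; rewrite mulrA -mulrDl -splitE; congr (_ * _); apply: complex_eq.
rewrite -(eq_cintegral E1) -(eq_cintegral E2).
rewrite (cintegralD mP j1 (cintegrableZ I mP j2)) (cintegralD mP i1 (cintegrableZ I mP i2)).
rewrite (cintegralZ I mP j2) (cintegralZ I mP i2).
rewrite /mellin_of in h1 h2; rewrite h1 h2; ring.
Qed.

End pairing.

Theorem S0ev_pairing (zeta : C -> C) (zetaP : is_riemann_zeta zeta) (mu s : R) (f : R -> C) :
  1 < mu -> cpow mu (0 +i* s) = 1 -> S0ev f ->
  cintegrable `[1, mu[ (fun u => cpow u (0 +i* s) * Sigma_map mu (E_map f) u * (u^-1)%:C) /\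
  cintegral `[1, mu[ (fun u => cpow u (0 +i* s) * Sigma_map mu (E_map f) u * (u^-1)%:C) =
  zeta (2^-1 +i* s) * cintegral pos (fun u => f u * cpow u ((2^-1 +i* s) - 1)).
Proof.
move=> mu1 mus /S0ev_tame[[F1 [K1 t1]] [F2 [K2 t2]]].
exact: (pairing_zeta t1 t2 zetaP mu1 mus).
Qed.

End Pairing.

(** * Gaussian functions and their moments *)

Section GaussianTest.
Context {R : realType}.
Local Notation leb := (@lebesgue_measure R).
Local Notation pos := (`]0, +oo[%classic : set R).
Local Opaque cintegral.

(** Polynomials times a Gaussian: a class of Schwartz functions closed under
    differentiation, whose effect on the polynomial is [dgauss]. *)
Definition gauss (P : {poly R}) (x : R) : R := P.[x] * expR (- x ^+ 2).

Definition dgauss (P : {poly R}) : {poly R} := P^`() - 2%:P * 'X * P.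

Lemma horner_dgauss P (x : R) : (dgauss P).[x] = P^`().[x] - 2 * x * P.[x].
Proof. by rewrite /dgauss hornerD hornerN !hornerM hornerC hornerX. Qed.

Lemma is_derive_gauss P (x : R) : is_derive x 1 (gauss P) (gauss (dgauss P) x).
Proof.
have dp := is_derive_poly P x.
have de : is_derive x 1 (fun x : R => expR (- x ^+ 2)) (- (2 * x) * expR (- x ^+ 2)).
  by apply: is_derive_eq; rewrite /GRing.scale /=; ring.
rewrite /gauss; apply: (is_derive_eq (is_deriveM dp de)).
by rewrite horner_dgauss /GRing.scale /=; ring.
Qed.

Lemma derive1n_gauss n P : derive1n n (gauss P) = gauss (iter n dgauss P).
Proof.
elim: n => [|n ih]; first by rewrite derive1n0.
rewrite derive1nS ih; apply/funext => x; rewrite derive1E.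
by have [_ ->] := is_derive_gauss (iter n dgauss P) x.
Qed.

(** exp(x^2) is at least x^(2k)/k!, and |y| <= 1 + y^2 for y = x^k. *)
Lemma monomial_gauss_bound k (x : R) : `|x ^+ k * expR (- x ^+ 2)| <= 1 + k`!%:R.
Proof.
rewrite normrM (gtr0_norm (expR_gt0 _)) expRN ler_pdivrMr ?expR_gt0//.
have e1 : 1 <= expR (x ^+ 2) by rewrite -[leLHS]expR0 ler_expR sqr_ge0.
have := @exp_coeff_le R (x ^+ 2) k (sqr_ge0 x).
rewrite /exp_coeff /= ler_pdivrMr ?ltr0n ?fact_gt0// mulrC -exprM => h.
rewrite mulrDl mul1r; apply: (@le_trans _ _ (1 + (x ^+ (2 * k)))); last exact: lerD.
rewrite mulnC exprM; set y := x ^+ k; rewrite ler_norml expr2.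
have := sqr_ge0 (y - 1); have := sqr_ge0 (y + 1); rewrite !expr2 => h1 h2.
by apply/andP; split; nra.
Qed.

Lemma gauss_bound (P : {poly R}) : exists2 M : R, 0 <= M & forall x : R, `|gauss P x| <= M.
Proof.
exists (\sum_(i < size P) `|P`_i| * (1 + (i`!)%:R)).
  by apply: sumr_ge0 => i _; rewrite mulr_ge0// addr_ge0.
move=> x; rewrite /gauss horner_coef mulr_suml.
apply: le_trans (ler_norm_sum _ _ _) _; apply: ler_sum => i _.
by rewrite -mulrA normrM ler_wpM2l// monomial_gauss_bound.
Qed.

Lemma schwartz_gauss (P : {poly R}) : real_schwartz (gauss P).
Proof.
split.
- move=> n x; rewrite derive1n_gauss.
  by have [] := is_derive_gauss (iter n dgauss P) x.
- move=> m n; rewrite derive1n_gauss.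
  have [M _ hM] := gauss_bound ('X^m * iter n dgauss P); exists M => x.
  by have := hM x; rewrite /gauss hornerM hornerXn mulrA.
Qed.

Lemma real_schwartz0 : real_schwartz (fun=> 0 : R).
Proof.
rewrite (_ : (fun=> 0) = gauss 0); first exact: schwartz_gauss.
by apply/funext => x; rewrite /gauss horner0 mul0r.
Qed.

Lemma sin_le_id (t : R) : 0 <= t -> sin t <= t.
Proof.
rewrite le_eqVlt => /predU1P[<-|t0]; first by rewrite sin0.
have [|c _] := @MVT R sin cos 0 t t0.
  by apply: continuous_subspaceT => x; exact: continuous_sin.
rewrite sin0 !subr0 => ->; by rewrite ler_piMl ?(ltW t0)// cos_le1.
Qed.

(** cos t + t^2/2 has derivative t - sin t, which is nonnegative for t >= 0. *)
Lemma cos_ge_parabola (t : R) : 1 - t ^+ 2 / 2 <= cos t.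
Proof.
wlog t0 : t / 0 <= t.
  move=> H; have [/H//|/ltW] := leP 0 t.
  by rewrite -oppr_ge0 => /H; rewrite sqrrN cosN.
move: t0; rewrite le_eqVlt => /predU1P[<-|t0].
  by rewrite cos0 expr0n /= mul0r subr0.
pose h := fun x : R => cos x + x ^+ 2 / 2.
have dh (x : R) : is_derive x 1 h (- sin x + x).
  by rewrite /h; apply: is_derive_eq; rewrite /GRing.scale /=; field.
have [|c] := @MVT R h (fun x => - sin x + x) 0 t t0 (fun x _ => dh x).
  by apply: continuous_subspaceT => x; exact: derivable_continuous (dh x).
rewrite in_itv /= => /andP[c0 _] E.
have : 0 <= h t - h 0.
  by rewrite E mulr_ge0 ?subr0 ?(ltW t0)// addrC subr_ge0 sin_le_id// ltW.
rewrite /h cos0 expr0n /= mul0r addr0; lra.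
Qed.

(** The right-hand side is (y - 1/y)^2.  Bounding the squared logarithm by even
    powers of y keeps the estimate of the Mellin transform within the
    Gaussian moments. *)
Lemma sqr_ln_le (y : R) : 0 < y -> ln y ^+ 2 <= y ^+ 2 - 2 + y ^- 2.
Proof.
move=> y0.
have -> : y ^+ 2 - 2 + y ^- 2 = (y - y^-1) ^+ 2 by field; rewrite gt_eqF.
have ln_le (x : R) : 0 < x -> ln x <= x - 1.
  move=> x0; have := @le_ln1Dx R (x - 1); rewrite [1 + _]addrC subrK; apply; lra.
have key (x : R) : 1 <= x -> ln x ^+ 2 <= (x - x^-1) ^+ 2.
  move=> x1; have x0 : 0 < x := lt_le_trans ltr01 x1.
  rewrite ler_pXn2r ?nnegrE ?ln_ge0//; last first.
    by rewrite subr_ge0 (le_trans _ x1)// invf_le1.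
  apply: le_trans (ln_le x x0) _; rewrite lerD2l lerN2 invf_le1//.
have [/key//|/ltW y1] := leP 1 y.
have := key y^-1; rewrite invf_ge1// => /(_ y1).
by rewrite lnV// sqrrN invrK -[(y^-1 - y) ^+ 2]sqrrN opprB.
Qed.

(** The integrand of a Mellin transform at 1/2, up to the factor x^(is): its
    integral [gmoment] is Gamma(k/2 + 1/4)/2. *)
Definition gmom (k : nat) (x : R) : R := x ^+ k * expR (- x ^+ 2) * (Num.sqrt x)^-1.

Definition gmoment (k : nat) : R := \int[leb]_(x in pos) gmom k x.

Lemma monomial_gauss_dom k : exists2 M : R, 0 <= M &
  forall x : R, 0 < x -> `|x ^+ k * expR (- x ^+ 2)| <= M / (1 + x).
Proof.
exists ((1 + k`!%:R) + (1 + k.+1`!%:R)); first by rewrite !addr_ge0.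
move=> x x0; rewrite ler_pdivlMr ?addr_gt0// mulrDr mulr1.
apply: lerD; first exact: monomial_gauss_bound.
have -> : `|x ^+ k * expR (- x ^+ 2)| * x = `|x ^+ k.+1 * expR (- x ^+ 2)|.
  by rewrite [x ^+ k.+1]exprSr !normrM (gtr0_norm x0); ring.
exact: monomial_gauss_bound.
Qed.

Lemma cont_gauss_monomial k (x : R) : {for x, continuous (fun x : R => x ^+ k * expR (- x ^+ 2))}.
Proof.
have d := is_derive_gauss 'X^k x.
rewrite (_ : (fun x => _) = gauss 'X^k); first exact: derivable_continuous d.
by apply/funext => y; rewrite /gauss hornerXn.
Qed.

Lemma cont_gmom k (x : R) : 0 < x -> {for x, continuous (gmom k)}.
Proof.
move=> x0; apply: continuousM; first exact: cont_gauss_monomial.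
apply: continuousV; first by rewrite gt_eqF// sqrtr_gt0.
exact: sqrt_continuous.
Qed.

Lemma gmom_gt0 k (x : R) : 0 < x -> 0 < gmom k x.
Proof. by move=> x0; rewrite /gmom !mulr_gt0 ?exprn_gt0 ?expR_gt0 ?invr_gt0 ?sqrtr_gt0. Qed.

Lemma integrable_gmom k : leb.-integrable pos (EFin \o gmom k).
Proof.
have [M M0 hM] := monomial_gauss_dom k.
apply: (le_real_integrable (@measurable_pos R) _ _ (integrable_domZ M)).
  by apply: measurable_pos_continuous => x; exact: cont_gmom.
move=> x; rewrite /= in_itv /= andbT => x0; rewrite /gmom normrM.
rewrite [X in _ * X]gtr0_norm ?invr_gt0 ?sqrtr_gt0// /dom invfM mulrCA mulrC.
by rewrite ler_wpM2l ?invr_ge0 ?sqrtr_ge0// hM.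
Qed.

Lemma gmoment_gt0 k : 0 < gmoment k.
Proof.
pose c : R := expR (- 2 ^+ 2) * (Num.sqrt 2)^-1.
have c0 : 0 < c by rewrite mulr_gt0 ?expR_gt0 ?invr_gt0 ?sqrtr_gt0.
pose I : set R := `[1, 2]%classic.
have mI : (@measurable _ (measurableTypeR R)) I by exact: measurable_itv.
have cle x : I x -> c <= gmom k x.
  rewrite /I /= in_itv /= => /andP[x1 x2]; have x0 : 0 < x := lt_le_trans ltr01 x1.
  rewrite /c /gmom -mulrA -[leLHS]mul1r.
  apply: ler_pM; [exact: ler01|exact: ltW|exact: exprn_ege1|].
  apply: ler_pM; rewrite ?expR_ge0 ?invr_ge0 ?sqrtr_ge0//.
    by rewrite ler_expR lerN2 ler_pXn2r ?nnegrE ?(ltW x0).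
  by rewrite lef_pV2 ?posrE ?sqrtr_gt0//; exact: ler_wsqrtr.
have Ipos : I `<=` pos.
  by move=> x; rewrite /I /= !in_itv /= andbT => /andP[+ _]; exact: lt_le_trans.
have E : \int[leb]_(x in pos) ((fun _ : R => c) \_ I) x = c.
  apply: etrans (esym (@Rintegral_mkcondr _ (measurableTypeR R) R leb pos I _)) _.
  have muI : leb I = 1%:E.
    rewrite /I lebesgue_measure_itv /= lte_fin ltr1n -EFinB; congr (_%:E); lra.
  rewrite setIidr// (Rintegral_cst _ mI).
  by have -> : fine (leb I) = 1; [rewrite muI|rewrite mulr1].
rewrite (lt_le_trans c0)// -{1}E.
have mc : measurable_fun pos ((fun _ : R => c) \_ I).
  apply: (measurable_restrict _ _ _).1; [exact: mI|exact: measurable_pos|exact: measurable_cst].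
have le x : pos x -> ((fun _ : R => c) \_ I) x <= gmom k x.
  rewrite /= in_itv /= andbT => x0; rewrite patchE; case: ifPn => [/set_mem/cle//|_].
  by rewrite ltW// gmom_gt0.
apply: (le_Rintegral (@measurable_pos R) _ (integrable_gmom k) le).
apply: (le_real_integrable (@measurable_pos R) mc _ (integrable_gmom k)) => x px.
rewrite ger0_norm; first exact: le.
by rewrite patchE; case: ifP => // _; exact: ltW.
Qed.

(** Integration by parts against the derivative of exp(-x^2); this is the
    functional equation of Gamma at (k + 1/2)/2. *)
Lemma gmoment_rec k : gmoment k.+2 = (k%:R + 2^-1) / 2 * gmoment k.
Proof.
have [M M0 hM] := monomial_gauss_dom k.
pose G (x : R) := x ^+ k * expR (- x ^+ 2) * Num.sqrt x.
pose g (x : R) := (k%:R + 2^-1) * gmom k x + (- 2) * gmom k.+2 x.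
have mP := @measurable_pos R.
have i1 := integrableZl mP (k%:R + 2^-1) (integrable_gmom k).
have i2 := integrableZl mP (- 2) (integrable_gmom k.+2).
have H : \int[leb]_(x in pos) g x = 0.
  apply: (@FTC0 R G g M).
  - move=> x x0; have ds := is_derive1_sqrt x0.
    have s0 : Num.sqrt x != 0 by rewrite gt_eqF// sqrtr_gt0.
    have d := is_derive_gauss 'X^k x.
    rewrite (_ : gauss 'X^k = (fun x : R => x ^+ k * expR (- x ^+ 2))) in d; last first.
      by apply/funext => y; rewrite /gauss hornerXn.
    apply: (is_derive_eq (is_deriveM d ds)).
    rewrite /g /gmom /GRing.scale /= /gauss horner_dgauss derivXn hornerMn !hornerXn.
    have kx : x ^+ k.-1 *+ k * x = k%:R * x ^+ k.
      by case: (k) => [|j]; rewrite ?mulr0n ?mul0r// -mulr_natl exprSr /=; ring.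
    have rr : Num.sqrt x * Num.sqrt x = x by rewrite -expr2 sqr_sqrtr// ltW.
    move: kx rr s0; set A := x ^+ k.-1 *+ k; set r := Num.sqrt x => kx rr s0.
    set e := expR _.
    rewrite (_ : x ^+ k.+2 = x * x * x ^+ k); last by rewrite !exprS mulrA.
    apply: (mulIf s0).
    transitivity (e * (x ^+ k / 2 + A * (r * r) - 2 * x * x ^+ k * (r * r))); first by field.
    rewrite rr kx; by field.
  - move=> x x0; apply: continuousD; apply: continuousM; try exact: cvg_cst; exact: cont_gmom.
  - apply: eq_integrable (integrableD mP i1 i2) => //.
  - move=> x x0; rewrite /G normrM (ger0_norm (sqrtr_ge0 x)).
    have -> : M * (x * dom x) = M / (1 + x) * Num.sqrt x.
      rewrite /dom -{1}(sqr_sqrtr (ltW x0)) expr2; field.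
      by rewrite !gt_eqF ?sqrtr_gt0 ?addr_gt0.
    by rewrite ler_wpM2r ?sqrtr_ge0// hM.
move: H; rewrite /g RintegralD//.
rewrite !RintegralZl//; try exact: integrable_gmom.
rewrite -!/(gmoment _) => H.
have -> : (k%:R + 2^-1) / 2 * gmoment k = (k%:R + 2^-1) * gmoment k / 2 by ring.
lra.
Qed.

End GaussianTest.

(** * A test function with nonzero Mellin transform *)

Section TestFunction.
Context {R : realType}.
Local Notation C := R[i].
Local Notation Re := (@complex.Re R).
Local Notation normc := (@ComplexField.Normc.normc R).
Local Notation leb := (@lebesgue_measure R).
Local Notation pos := (`]0, +oo[%classic : set R).

Lemma normc_half (s u : R) : 0 < u -> normc (cpow u (2^-1 +i* s - 1)) = (Num.sqrt u)^-1.
Proof. by move=> u0; exact: normc_cpow_half. Qed.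

Lemma cintegrable_gauss_mellin (s : R) k :
  cintegrable pos (fun x : R => (x ^+ k * expR (- x ^+ 2))%:C * cpow x (2^-1 +i* s - 1)).
Proof.
have [M M0 hM] := @monomial_gauss_dom R k.
apply: (@cintegrable_mellin R _ _ _ M) => //.
by apply: measurable_pos_continuous => x _; exact: cont_gauss_monomial.
Qed.

(** The argument of the cosine is s ln(x/x0); this bound is what makes the
    rotated integrand nearly positive around x0. *)
Lemma cos_shift_ge (s x x0 : R) : 0 < x -> 0 < x0 ->
  1 - s ^+ 2 / 2 * ((x / x0) ^+ 2 - 2 + (x / x0) ^- 2) <= cos (s * ln x - s * ln x0).
Proof.
move=> xp x0p; apply: le_trans (cos_ge_parabola _).
rewrite lerD2l lerN2 -mulrBr -ln_div ?posrE// exprMn mulrAC.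
rewrite ler_wpM2l ?divr_ge0 ?sqr_ge0//.
by apply: sqr_ln_le; rewrite divr_gt0.
Qed.

(** Multiplying by x0^(-is) rotates the phase of x^(is) to zero at x0. *)
Lemma Re_rotated_mellin (s x x0 w : R) : 0 < x -> 0 < x0 ->
  Re (cpow x0 (0 +i* - s) * (w%:C * cpow x (2^-1 +i* s - 1))) =
  w * (Num.sqrt x)^-1 * cos (s * ln x - s * ln x0).
Proof.
move=> xp x0p.
rewrite (_ : 2^-1 +i* s - 1 = (0 +i* s) + (- 2^-1)%:C); last first.
  have e1 : 2^-1 - 1 = 0 + - 2^-1 :> R by field.
  have e2 : s - 0 = s + 0 :> R by rewrite subr0 addr0.
  by apply: complex_eq; rewrite ?ReD ?ImD; [exact: e1|exact: e2].
rewrite cpowD cpow_real// powRN powR12_sqrt ?(ltW xp)//.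
rewrite (_ : _ * _ = (w * (Num.sqrt x)^-1)%:C * (cpow x0 (0 +i* - s) * cpow x (0 +i* s))); last first.
  by rewrite rmorphM /=; ring.
rewrite [LHS]ReM ImC mul0r subr0 ReC; congr (_ * _).
rewrite ReM !Re_cpow// !Im_cpow//= !powRr0 !mul1r mulNr cosN sinN.
by rewrite cosB; ring.
Qed.

(** With p = m + 1 and x0^2 = p, the weight x^(2p) exp(-x^2) is centred at x0.
    The lower bound [cos_shift_ge] integrates to a combination of three
    moments, which the recurrence reduces to a positive multiple of
      p - 3/4 - s^2/2 + (3/32) s^2/p,
    and this is positive as soon as p > s^2 + 1. *)
Lemma gauss_mellin_neq0 (s : R) : exists m : nat,
  cintegral pos (fun x : R => (x ^+ (m.*2).+2 * expR (- x ^+ 2))%:C * cpow x (2^-1 +i* s - 1)) != 0.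
Proof.
pose m := (Num.truncn (s ^+ 2)).+1; exists m; apply/negP => /eqP N0.
pose p : R := m.+1%:R.
have ps : s ^+ 2 + 1 < p by rewrite /p -natr1 ltrD2r; exact: truncnS_gt.
have s2 := sqr_ge0 s; have p0 : 0 < p by rewrite /p.
set j := m.*2 in N0.
have jE : j%:R = 2 * p - 2 :> R by rewrite /j /p -natr1 -mul2n natrM; ring.
have kE : j.+2%:R = 2 * p :> R by rewrite -addn2 natrD jE; ring.
pose V : R := gmoment j.
have V0 : 0 < V := gmoment_gt0 j.
have W1 : gmoment j.+2 = (p - 3 / 4) * V by rewrite gmoment_rec jE /V; field.
have W2 : gmoment j.+4 = (p + 1 / 4) * ((p - 3 / 4) * V).
  by rewrite (gmoment_rec j.+2) kE W1; field.
pose x0 := Num.sqrt p; have x00 : 0 < x0 by rewrite sqrtr_gt0.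
have x02 : x0 ^+ 2 = p by rewrite sqr_sqrtr// ltW.
have mP := @measurable_pos R.
have iN := cintegrable_gauss_mellin s j.+2.
have H : \int[leb]_(x in pos) Re (cpow x0 (0 +i* - s) * ((x ^+ j.+2 * expR (- x ^+ 2))%:C * cpow x (2^-1 +i* s - 1))) = 0.
  have := congr1 Re (cintegralZ (cpow x0 (0 +i* - s)) mP iN).
  by rewrite N0 mulr0.
have iH := (cintegrableZ (cpow x0 (0 +i* - s)) mP iN).1.
pose low (x : R) := (1 + s ^+ 2) * gmom j.+2 x
  + ((- (s ^+ 2 / (2 * p))) * gmom j.+4 x + (- (s ^+ 2 * p / 2)) * gmom j x).
have iZ (c : R) k : leb.-integrable pos (EFin \o (fun x => c * gmom k x)).
  exact: (integrableZl mP c (@integrable_gmom R k)).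
have i23 : leb.-integrable pos (EFin \o (fun x =>
    (- (s ^+ 2 / (2 * p))) * gmom j.+4 x + (- (s ^+ 2 * p / 2)) * gmom j x)).
  exact: (integrableD mP (iZ _ _) (iZ _ _)).
have ilow : leb.-integrable pos (EFin \o low).
  exact: (integrableD mP (iZ _ _) i23).
have lowE : \int[leb]_(x in pos) low x = (1 + s ^+ 2) * gmoment j.+2
  + ((- (s ^+ 2 / (2 * p))) * gmoment j.+4 + (- (s ^+ 2 * p / 2)) * gmoment j).
  rewrite /low (RintegralD mP (iZ _ _) i23) (RintegralD mP (iZ _ _) (iZ _ _)).
  by rewrite !(RintegralZl _ mP (integrable_gmom _)).
have lowle x : pos x -> low x <= Re (cpow x0 (0 +i* - s) * ((x ^+ j.+2 * expR (- x ^+ 2))%:C * cpow x (2^-1 +i* s - 1))).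
  move=> px; have xp : 0 < x by move: px; rewrite /= in_itv /= andbT.
  rewrite Re_rotated_mellin// -/(gmom j.+2 x).
  apply: le_trans (ler_wpM2l (ltW (gmom_gt0 _ xp)) (cos_shift_ge s xp x00)).
  rewrite le_eqVlt; apply/orP; left; apply/eqP.
  rewrite /low /gmom !exprMn !exprVn x02.
  have -> : x ^+ j.+4 = x ^+ 2 * (x ^+ 2 * x ^+ j) by rewrite -!exprD.
  have -> : x ^+ j.+2 = x ^+ 2 * x ^+ j by rewrite -!exprD.
  set r := (Num.sqrt x)^-1; set e := expR _; set y := x ^+ j.
  by field; rewrite !gt_eqF.
have := le_Rintegral mP ilow iH lowle; rewrite H lowE W1 W2 -/V.
have -> : (1 + s ^+ 2) * ((p - 3 / 4) * V) + (- (s ^+ 2 / (2 * p)) * ((p + 1 / 4) * ((p - 3 / 4) * V)) + - (s ^+ 2 * p / 2) * V)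
  = V * (p - 3 / 4 - s ^+ 2 / 2 + 3 / 32 * (s ^+ 2 / p)) by field; rewrite gt_eqF.
apply/negP; rewrite -ltNge mulr_gt0//.
have : 0 <= s ^+ 2 / p by rewrite divr_ge0// ltW.
move: (s ^+ 2) (s ^+ 2 / p) ps s2 => a b *; lra.
Qed.

(** The function [gauss P] vanishes at both infinities. *)
Lemma gauss_derivative_integral0 (P : {poly R}) :
  \int[leb]_(x in setT) gauss (dgauss P) x = 0.
Proof.
set q := gauss (dgauss P).
have mT : (@measurable _ (measurableTypeR R)) [set: R] by exact: measurableT.
have cq (x : R) : {for x, continuous q} := derivable_continuous (is_derive_gauss (dgauss P) x).
have mq : measurable_fun [set: R] q by apply: continuous_measurable_fun => x; exact: cq.
have [K K0 qK] := rapid_decay_oneDsqr (fun m => (schwartz_gauss (dgauss P)).2 m 0%N).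
have iK : leb.-integrable setT (EFin \o (fun x : R => K / oneDsqr x)).
  exact: (integrableZl mT K integrable_oneDsqrV).
pose I (n : nat) : set R := `[- n.+1%:R, n.+1%:R]%classic.
have mI n : (@measurable _ (measurableTypeR R)) (I n) by exact: measurable_itv.
have [||||_ h] := @real_dct R setT (fun n => q \_ (I n)) q (fun x => K / oneDsqr x) mT.
- move=> n; apply: (measurable_restrict q _ _).1; [exact: mI|exact: measurableT|exact: measurable_funTS].
- move=> x _; apply: cvg_near_cst; exists (Num.truncn `|x|) => // n /= xn.
  rewrite patchE mem_set// /I /= in_itv /= -ler_norml ltW//.
  by rewrite (lt_le_trans (truncnS_gt _))// ler_nat ltnS.
- exact: iK.
- move=> n x _; rewrite patchE; case: ifP => _; first exact: qK.
  by rewrite normr0 (le_trans _ (qK x)).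
have E n : \int[leb]_(x in setT) (q \_ (I n)) x = gauss P n.+1%:R - gauss P (- n.+1%:R).
  apply: etrans (esym (@Rintegral_mkcondr _ (measurableTypeR R) R leb setT (I n) q)) _.
  rewrite setTI; have nn : - n.+1%:R < n.+1%:R :> R by rewrite gtrN.
  exact: (integral_is_derive nn (fun x _ => is_derive_gauss P x) (fun x _ => cq x)).2.
suff H : \int[leb]_(x in setT) (q \_ (I n)) x @[n --> \oo] --> (0 : R).
  exact: (cvg_unique _ h H).
rewrite (eq_cvg _ _ E); apply/norm_cvg0P.
have [M M0 hM] := gauss_bound ('X * P).
apply: (@squeeze_cvgr _ _ _ _ (fun=> 0) (fun n => 2 * M * n.+1%:R^-1)).
- apply: nearW => n; rewrite normr_ge0/= (le_trans (ler_normB _ _))//.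
  have key (x : R) : `|x| = n.+1%:R -> `|gauss P x| <= M * n.+1%:R^-1.
    move=> xn; rewrite ler_pdivlMr// -xn mulrC -normrM.
    by have := hM x; rewrite /gauss hornerM hornerX mulrA.
  have -> : 2 * M * n.+1%:R^-1 = M * n.+1%:R^-1 + M * n.+1%:R^-1 by ring.
  by apply: lerD; apply: key; rewrite ?normrN normr_nat.
- exact: cvg_cst.
- rewrite -[X in _ --> X](mulr0 (2 * M)); apply: cvgM; first exact: cvg_cst.
  exact: cvg_harmonic.
Qed.

(** The derivative of x^(k+1) exp(-x^2) with k even.  Integration by parts turns
    its Mellin transform at z into 1 - z times that of x^k exp(-x^2). *)
Theorem test_function (s : R) : exists2 f : R -> C, S0ev f &
  cintegral pos (fun u => f u * cpow u (2^-1 +i* s - 1)) != 0.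
Proof.
have [m N0] := gauss_mellin_neq0 s.
pose k := (m.*2).+2; pose P : {poly R} := 'X^(k.+1).
pose f (x : R) : C := (gauss (dgauss P) x)%:C.
have fE x : gauss (dgauss P) x = (k.+1%:R * x ^+ k - 2 * x * x ^+ k.+1) * expR (- x ^+ 2).
  by rewrite /gauss horner_dgauss /P derivXn hornerMn !hornerXn -mulr_natl.
have keven (x : R) : (- x) ^+ k = x ^+ k.
  by rewrite /k -doubleS -mul2n !exprM sqrrN.
exists f.
- split.
  + split; first exact: schwartz_gauss.
    exact: real_schwartz0.
  + by move=> x; rewrite /f !fE sqrrN exprS keven [x ^+ k.+1]exprS; congr (_%:C); ring.
  + by rewrite /f fE exprS mulr0 mul0r subr0 /k exprS mul0r mulr0 mul0r.
  + rewrite /cintegral (_ : Im_fun f = fun=> 0)//; congr (_ +i* _).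
      exact: gauss_derivative_integral0.
    by rewrite /Rintegral integral0.
set z : C := 2^-1 +i* s.
have [M M0 hM] := @monomial_gauss_dom R k.
have mP := @measurable_pos R.
pose G (x : R) := gauss P x.
pose g1 (x : R) := f x * cpow x (z - 1).
pose g2 (x : R) := (z - 1) * ((x ^+ k * expR (- x ^+ 2))%:C * cpow x (z - 1)).
have i1 : cintegrable pos g1.
  have ik n := cintegrable_gauss_mellin s n.
  apply: (eq_cintegrable mP _ (cintegrableD mP (cintegrableZ (k.+1%:R%:C) mP (ik k))
    (cintegrableZ ((- 2)%:C) mP (ik k.+2)))) => x _.
  rewrite /g1 !mulrA -mulrDl; congr (_ * _).
  rewrite /f fE -!rmorphM -rmorphD; congr (_%:C).
  by rewrite [x ^+ k.+2]exprS [x ^+ k.+1]exprS; move: (x ^+ k) => y; ring.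
have i2 : cintegrable pos g2 := cintegrableZ (z - 1) mP (cintegrable_gauss_mellin s k).
have H : cintegral pos (fun x => g1 x + g2 x) = 0.
  apply: (@cFTC0 R (fun u => (G u)%:C * cpow u (z - 1)) _ M).
  - move=> x xp; apply: (cderiv_eq (cderivM (cderiv_real (is_derive_gauss P x)) (cderiv_cpow (z - 1) xp))).
    rewrite /g1 /g2 /f; congr (_ + _); rewrite [cpow x (z - 1 - 1)]cpowB1//.
    rewrite /G /gauss hornerXn exprS.
    rewrite mulrCA; congr (_ * _); rewrite mulrA -rmorphM; congr (_%:C * _).
    by field; rewrite gt_eqF.
  - move=> x xp; apply: ccontD; apply: ccontM.
    + by apply: ccont_real; exact: derivable_continuous (is_derive_gauss (dgauss P) x).
    + exact: ccont_cpow.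
    + exact: ccont_cst.
    + apply: ccontM; last exact: ccont_cpow.
      by apply: ccont_real; exact: cont_gauss_monomial.
  - exact: cintegrableD.
  - move=> x xp; rewrite normcM normc_real normc_half//.
    rewrite /G /gauss hornerXn exprS -mulrA normrM (gtr0_norm xp).
    have -> : M * (x * dom x) = x * (M / (1 + x)) * (Num.sqrt x)^-1.
      by rewrite /dom invfM; ring.
    by rewrite ler_wpM2r ?invr_ge0 ?sqrtr_ge0// ler_wpM2l ?(ltW xp)// hM.
move: H; rewrite (cintegralD mP i1 i2) /g2 (cintegralZ _ mP (cintegrable_gauss_mellin s k)).
move=> /eqP; rewrite addr_eq0 => /eqP E.
apply/negP => /eqP E0; move: E; rewrite /g1 E0 => /esym/eqP.
rewrite oppr_eq0 mulf_eq0 (negbTE N0) orbF subr_eq0 => /eqP /(congr1 Re) /=.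
by clear; move=> ?; lra.
Qed.

End TestFunction.

(** * Functions invariant under almost all dilations *)

Section Eigenfunctions.
Context {R : realType}.
Local Notation C := R[i].
Local Notation Re := (@complex.Re R).
Local Notation Im := (@complex.Im R).
Local Notation leb := (@lebesgue_measure R).
Local Notation pos := (`]0, +oo[%classic : set R).
Local Notation mR := (measurableTypeR R).

Lemma aeS (P Q : R -> Prop) : (forall u, P u -> Q u) ->
  {ae leb, forall u, P u} -> {ae leb, forall u, Q u}.
Proof. by move=> PQ; apply: negligibleS => u /= nQ /PQ. Qed.

Lemma aeT (P : R -> Prop) : (forall u, P u) -> {ae leb, forall u, P u}.
Proof. by move=> h; exists set0; split => // u /=; apply. Qed.

Lemma ae_pos_exists (P : R -> Prop) : {ae leb, forall u : R, 0 < u -> P u} -> exists2 u, 0 < u & P u.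
Proof.
move=> [A [mA A0 sA]]; apply: contrapT => nP.
have : (leb `[1%R, 2%R] <= leb A)%E.
  apply: le_measure; rewrite ?inE//.
  move=> u /=; rewrite in_itv /= => /andP[u1 _]; apply: sA => /= h.
  by apply: nP; have u0 := lt_le_trans ltr01 u1; exists u => //; exact: h.
rewrite A0 lebesgue_measure_itv /= lte_fin ltr1n /= -EFinD lee_fin.
by rewrite leNgt subr_gt0 ltr1n.
Qed.

(** Dilations preserve null sets. *)
Lemma ae_scale (a : R) (P : R -> Prop) : 0 < a ->
  {ae leb, forall u, P (a * u)} -> {ae leb, forall u, P u}.
Proof.
move=> a0 [A [mA A0 sA]].
have a'0 : 0 < a^-1 by rewrite invr_gt0.
have aK u : a * (a^-1 * u) = u by rewrite mulrA divff ?gt_eqF// mul1r.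
exists ((fun x : R => a^-1 * x) @^-1` A); split.
- rewrite -[X in measurable X]setTI; exact: measurable_scale.
- have := lebesgue_measure_scale a'0 mA.
  move=> e; apply/eqP; move/esym/eqP: e; rewrite A0 mule_eq0 => /orP[|//].
  by rewrite eqe gt_eqF.
- by move=> u nPu; apply: sA => /=; rewrite aK.
Qed.

(** By Tonelli, the measure of the set can be computed by slicing in either
    direction. *)
Lemma null_ysections (A : set (mR * mR)) : measurable A ->
  (forall x, leb (xsection A x) = 0) -> {ae leb, forall y, leb (ysection A y) = 0}.
Proof.
move=> mA A0.
have := indic_fubini_tonelli leb leb mA.
rewrite (indic_fubini_tonelli_FE leb mA) (indic_fubini_tonelli_GE leb mA).
rewrite integral0_eq; last by move=> x _; exact: A0.
move=> /esym e.
have mG : measurable_fun setT (leb \o ysection A) by exact: measurable_fun_ysection.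
have : (\int[leb]_x `|(leb \o ysection A) x|)%E = 0%E.
  by rewrite -e; apply: eq_integral => y _; rewrite gee0_abs.
move/(ae_eq_integral_abs leb measurableT mG).
by apply: filterS => y /= h; exact: h.
Qed.

(** The extension by zero makes the dilated function measurable in both
    variables jointly, as a composition with the product. *)
Lemma measurable_dilation_diff (g : R -> R) : measurable_fun pos g ->
  measurable_fun [set: mR * mR] (fun p => (g \_ pos) (p.1 * p.2) - (g \_ pos) p.2).
Proof.
move=> mg.
have mp : measurable_fun [set: mR] (g \_ pos : mR -> mR).
  by apply/(measurable_restrictT g (@measurable_pos R)).
apply: measurable_funB; last exact: measurableT_comp mp measurable_snd.
apply: (measurableT_comp mp).
by apply: measurable_funM; [exact: measurable_fst|exact: measurable_snd].
Qed.

(** Exchange of quantifiers: the set of pairs (lam, u) where invariance fails is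
    measurable with null slices at fixed lam, so almost all its slices at
    fixed u are null. *)
Lemma ae_dilation_invariant_point (eta : R -> C) : cmeasurable pos eta ->
  (forall lam, 0 < lam -> {ae leb, forall u, 0 < u -> eta (lam * u) = eta u}) ->
  exists2 u, 0 < u & {ae leb, forall lam, 0 < lam -> eta (lam * u) = eta u}.
Proof.
move=> [mr mi] inv.
have posP u : 0 < u -> pos u by rewrite /= in_itv /= andbT.
pose Dr p := (Re_fun eta \_ pos) (p.1 * p.2) - (Re_fun eta \_ pos) p.2.
pose Di p := (Im_fun eta \_ pos) (p.1 * p.2) - (Im_fun eta \_ pos) p.2.
have mDr : measurable_fun [set: mR * mR] Dr by exact: measurable_dilation_diff.
have mDi : measurable_fun [set: mR * mR] Di by exact: measurable_dilation_diff.
pose A : set (mR * mR) := (pos `*` pos) `&` (Dr @^-1` [set~ 0] `|` Di @^-1` [set~ 0]).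
have patch_in (g : R -> R) u : 0 < u -> (g \_ pos) u = g u.
  by move=> u0; rewrite patchE mem_set//; exact: posP.
have AP lam u : 0 < lam -> 0 < u -> A (lam, u) <-> eta (lam * u) <> eta u.
  move=> l0 u0; have lu0 : 0 < lam * u by rewrite mulr_gt0.
  rewrite /A /Dr /Di /= !patch_in// /Re_fun /Im_fun; split.
    by move=> [_ [] h /(congr1 (fun z => (Re z, Im z))) [e1 e2]]; apply: h; rewrite ?e1 ?e2 subrr.
  move=> ne; split; first by split; exact: posP.
  apply: contrapT => /not_orP[/contrapT /eqP h1 /contrapT /eqP h2].
  by apply: ne; apply: complex_eq; apply/eqP; rewrite -subr_eq0.
have mA : measurable A.
  apply: measurableI; first by apply: measurableX; exact: measurable_pos.
  have m0 : measurable ([set~ 0] : set mR) by apply: measurableC; exact: measurable_set1.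
  apply: measurableU; rewrite -[X in measurable X]setTI; [exact: mDr|exact: mDi].
have A0 lam : leb (xsection A lam) = 0.
  have [l0|l0] := ltP 0 lam; last first.
    rewrite (_ : xsection A lam = set0) ?measure0//.
    apply/seteqP; split => // u; rewrite xsectionP => -[[/=]].
    by rewrite in_itv /= andbT ltNge l0.
  apply/negligibleP; first exact: measurable_xsection.
  apply: negligibleS (inv _ l0) => u /=; rewrite xsectionP => Alu h.
  have u0 : 0 < u by case: Alu => -[/= _]; rewrite in_itv /= andbT.
  by move/(AP _ _ l0 u0): Alu; apply; exact: h.
have [u u0 Au] : exists2 u, 0 < u & leb (ysection A u) = 0.
  by apply: ae_pos_exists; apply: filterS (null_ysections mA A0).
exists u => //.
exists (ysection A u); split => //; first exact: measurable_ysection.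
move=> lam /= h; rewrite ysectionP.
have [l0 ne] : 0 < lam /\ eta (lam * u) <> eta u by apply/not_implyP.
exact/AP.
Qed.

(** Almost every v > 0 is of the form lam * u with lam outside of a null set. *)
Lemma ae_dilation_invariant_cst (eta : R -> C) : cmeasurable pos eta ->
  (forall lam, 0 < lam -> {ae leb, forall u, 0 < u -> eta (lam * u) = eta u}) ->
  exists c, {ae leb, forall u, 0 < u -> eta u = c}.
Proof.
move=> meta /(ae_dilation_invariant_point meta)[u u0 h]; exists (eta u).
refine (@ae_scale u (fun v => 0 < v -> eta v = eta u) u0 _).
apply: aeS h => v h uv0.
by rewrite mulrC; apply: h; rewrite pmulr_rgt0 in uv0.
Qed.

End Eigenfunctions.

(** * Eigenvectors in the orthogonal complement *)

Section Spectrum.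
Context {R : realType}.
Local Notation C := R[i].
Local Notation Re := (@complex.Re R).
Local Notation Im := (@complex.Im R).
Local Notation normc := (@ComplexField.Normc.normc R).
Local Notation leb := (@lebesgue_measure R).
Local Notation pos := (`]0, +oo[%classic : set R).
Implicit Types (D : set R) (f g xi : R -> C) (mu s : R).

Lemma Re_cintegral D f : Re (cintegral D f) = (\int[leb]_(x in D) Re (f x))%R.
Proof. by []. Qed.

Lemma ae_eq_cintegral D f g : (@measurable _ (measurableTypeR R)) D ->
  cmeasurable D f -> cmeasurable D g -> {ae leb, forall u : R, D u -> f u = g u} ->
  cintegral D f = cintegral D g.
Proof.
move=> mD [rf jf] [rg jg] fg; rewrite /cintegral /Rintegral.
congr (fine _ +i* fine _); apply: ae_eq_integral => //; try exact/measurable_EFinP.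
- by apply: aeS fg => u h Du; rewrite /Re_fun h.
- by apply: aeS fg => u h Du; rewrite /Im_fun h.
Qed.
Local Opaque cintegral.

Lemma cintegrable_conj D f : (@measurable _ (measurableTypeR R)) D ->
  cintegrable D f -> cintegrable D (fun x => conjc (f x)).
Proof.
move=> mD [rf jf]; split.
- by apply: eq_integrable rf => // x _; rewrite /= /Re_fun Re_conj.
- apply: eq_integrable (integrableZl mD (-1) jf) => // x _.
  by rewrite /= /Im_fun Im_conj -EFinM mulN1r.
Qed.

Lemma conjc_triple (a b : C) (r : R) : conjc (a * b * r%:C) = conjc a * conjc b * r%:C.
Proof.
rewrite !rmorphM; congr (_ * _).
by apply: complex_eq; rewrite /= ?oppr0.
Qed.

Lemma cpow_im_cancel (u s : R) : cpow u (0 +i* - s) * cpow u (0 +i* s) = 1.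
Proof.
rewrite -cpowD (_ : _ + _ = 0) ?cpow0//.
by apply: complex_eq; rewrite ?ReD ?ImD /= ?addNr ?addr0.
Qed.

Lemma cpow_inv (u : R) z : 0 < u -> cpow u^-1 z * cpow u z = 1.
Proof. by move=> u0; rewrite -cpowMl ?invr_gt0// mulVf ?gt_eqF// cpow_one. Qed.

(** The square |b|^2 is dropped from the expansion of |a - b|^2. *)
Lemma sqr_normcB_ge (a b : C) : normc a = 1 -> 1 - 2 * Re (a * conjc b) <= normc (a - b) ^+ 2.
Proof.
move=> a1; have := congr1 (fun x => x ^+ 2) a1; rewrite !sqr_normc expr1n !ReImE.
move: (Re a) (Im a) (Re b) (Im b) => x y p q n1.
rewrite -subr_ge0 (_ : _ - _ = p ^+ 2 + q ^+ 2 + (x ^+ 2 + y ^+ 2 - 1)); last by ring.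
by rewrite n1 subrr addr0 addr_ge0 ?sqr_ge0.
Qed.

(** On the circle the dilation by mu is the identity, so xi and mu^(is) xi agree
    almost everywhere. *)
Lemma eigenvector_period mu s xi : 1 < mu -> L2 mu xi -> ~ L2_eq xi (fun=> 0) ->
  L2_eq (theta mu xi) (fun x => cpow mu (0 +i* s) * xi x) -> cpow mu (0 +i* s) = 1.
Proof.
move=> mu1 [inv _ _ _] xi0 eig; apply: contrapT => /eqP ne; apply: xi0.
have mu0 : 0 < mu by exact: lt_trans mu1.
apply: (aeS _ eig) => u h u0; have := h u0; rewrite /theta.
rewrite -inv ?mulr_gt0 ?invr_gt0// mulrA divff ?gt_eqF// mul1r => e.
have /eqP : (1 - cpow mu (0 +i* s)) * xi u = 0 by rewrite mulrBl mul1r -e subrr.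
by rewrite mulf_eq0 subr_eq0 eq_sym (negbTE ne) /= => /eqP.
Qed.

(** The eigenvalue equation says that u^(is) xi(u) is invariant under each
    dilation almost everywhere. *)
Lemma eigenvector_power mu s xi : L2 mu xi -> ~ L2_eq xi (fun=> 0) ->
  (forall lam, 0 < lam -> L2_eq (theta lam xi) (fun x => cpow lam (0 +i* s) * xi x)) ->
  exists2 c, c != 0 & L2_eq xi (fun u => c * cpow u (0 +i* - s)).
Proof.
move=> [_ mr mi _] xi0 eig.
pose eta u := cpow u (0 +i* s) * xi u.
have meta : cmeasurable pos eta by apply: cmeasurableM; [exact: cmeasurable_cpow|split].
have etaK u : cpow u (0 +i* - s) * eta u = xi u.
  by rewrite /eta mulrA cpow_im_cancel mul1r.
have inv lam : 0 < lam -> {ae leb, forall u, 0 < u -> eta (lam * u) = eta u}.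
  move=> l0; have l'0 : 0 < lam^-1 by rewrite invr_gt0.
  apply: (aeS _ (eig _ l'0)) => u h u0; have := h u0.
  rewrite /theta invrK /eta => ->; rewrite cpowMl//.
  have e := cpow_inv (0 +i* s) l0.
  rewrite (_ : _ * _ * (_ * _) = (cpow lam^-1 (0 +i* s) * cpow lam (0 +i* s)) * (cpow u (0 +i* s) * xi u)).
    by rewrite e mul1r.
  by ring.
have [c etac] := ae_dilation_invariant_cst meta inv.
exists c; last by apply: (aeS _ etac) => u h u0; rewrite -etaK h// mulrC.
apply/eqP => c0; apply: xi0; apply: (aeS _ etac) => u h u0.
by rewrite -etaK h// c0 mulr0.
Qed.

Lemma L2_dot_scale_ae mu c f g h : L2 mu f -> cmeasurable `[1, mu[ h ->
  cintegrable `[1, mu[ (fun u => g u * conjc (h u) * (u^-1)%:C) ->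
  L2_eq f (fun u => c * g u) -> L2_dot mu f h = c * L2_dot mu g h.
Proof.
move=> [_ mr mj _] mh ig fg; rewrite /L2_dot /circle_integral.
have mD : (@measurable _ (measurableTypeR R)) `[1, mu[%classic by exact: measurable_itv.
have D0 := @itv_pos R 1 mu ltr01.
have mi : cmeasurable `[1, mu[ (fun u : R => (u^-1)%:C).
  by apply: cmeasurableS D0 _ => //; apply: cmeasurable_real; exact: measurable_inv.
have mf : cmeasurable `[1, mu[ f by apply: cmeasurableS D0 _ => //; split.
rewrite -(cintegralZ c mD ig).
apply: (ae_eq_cintegral mD (cmeasurableM (cmeasurableM mf (cmeasurable_conj mh)) mi)
  (cintegrable_measurable (cintegrableZ c mD ig))).
apply: (aeS _ fg) => u fgu /D0; rewrite /= in_itv /= andbT => u0.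
by rewrite fgu// !mulrA.
Qed.

Section Character.
Variables (zeta : C -> C) (zetaP : is_riemann_zeta zeta) (mu s : R).
Hypotheses (mu1 : 1 < mu) (mus : cpow mu (0 +i* s) = 1).
Let mu0 : 0 < mu. Proof. exact: lt_trans mu1. Qed.
Let D := (`[1, mu[%classic : set R).
Let chi (u : R) : C := cpow u (0 +i* - s).
Let mD : (@measurable _ (measurableTypeR R)) D. Proof. exact: measurable_itv. Qed.
Let D0 u : D u -> 0 < u.
Proof. by move=> /(@itv_pos R 1 mu ltr01); rewrite /= in_itv /= andbT. Qed.
Let mchi : cmeasurable D chi.
Proof. by apply: cmeasurableS (@itv_pos R 1 mu ltr01) _ => //; exact: cmeasurable_cpow. Qed.

(** Recovered from the measurability of the integrand of the pairing, by dividing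
    out the character and du/u. *)
Lemma Sigma_E_measurable f : S0ev f -> cmeasurable D (Sigma_map mu (E_map f)).
Proof.
move=> /(S0ev_pairing zetaP mu1 mus)[iP _].
have mid : cmeasurable D (fun u : R => u%:C).
  by apply: cmeasurable_real; exact: measurable_id.
have := cmeasurableM (cmeasurableM mchi mid) (cintegrable_measurable iP).
case=> mr mj.
have E u : D u ->
  chi u * u%:C * (cpow u (0 +i* s) * Sigma_map mu (E_map f) u * (u^-1)%:C) = Sigma_map mu (E_map f) u.
  move=> /D0 u0.
  transitivity ((cpow u (0 +i* - s) * cpow u (0 +i* s)) * (u%:C * (u^-1)%:C) * Sigma_map mu (E_map f) u).
    by rewrite /chi; ring.
  by rewrite cpow_im_cancel -rmorphM divff ?gt_eqF// mul1r mul1r.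
by split; [apply: eq_measurable_fun mr|apply: eq_measurable_fun mj] => u /set_mem Du;
  rewrite /Re_fun /Im_fun E.
Qed.

Lemma L2_dot_character f : S0ev f ->
  cintegrable D (fun u => chi u * conjc (Sigma_map mu (E_map f) u) * (u^-1)%:C) /\
  L2_dot mu chi (Sigma_map mu (E_map f)) =
    conjc (zeta (2^-1 +i* s) * cintegral pos (fun u => f u * cpow u (2^-1 +i* s - 1))).
Proof.
move=> /(S0ev_pairing zetaP mu1 mus)[iP eP].
have E u : D u -> conjc (cpow u (0 +i* s) * Sigma_map mu (E_map f) u * (u^-1)%:C) =
    chi u * conjc (Sigma_map mu (E_map f) u) * (u^-1)%:C.
  move=> _; rewrite conjc_triple /chi; congr (_ * _ * _).
  by rewrite conj_cpow.
split; first exact: (eq_cintegrable mD E (cintegrable_conj mD iP)).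
by rewrite -eP (conj_cintegral mD iP) /L2_dot /circle_integral -(eq_cintegral E).
Qed.

Let inv_integral : leb.-integrable D (EFin \o (fun u : R => u^-1)) /\
  (\int[leb]_(u in D) (u^-1)%:E)%E = (ln mu)%:E.
Proof.
have p0 x : 1 <= x <= mu -> 0 < x by move=> /andP[h _]; exact: lt_le_trans h.
have [i1 e1] : leb.-integrable `[1, mu] (EFin \o (fun u : R => u^-1)) /\
    \int[leb]_(x in `[1, mu]) x^-1 = ln mu - ln 1.
  apply: integral_is_derive => // x /p0 x0; first exact: is_derive1_ln.
  by apply: continuousV; [rewrite gt_eqF|exact: cvg_id].
have i2 : leb.-integrable D (EFin \o (fun u : R => u^-1)).
  apply: (integrableS _ mD _ i1); first exact: measurable_itv.
  by move=> x; rewrite /D /= !in_itv /= => /andP[-> /ltW].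
split => //; rewrite -[LHS]fineK; last exact: (integrable_fin_num mD i2).
congr (_%:E); rewrite ln1 subr0 in e1; rewrite -e1.
exact: (@Rintegral_itv_bndo_bndc _ (BLeft 1) mu (fun u : R => u^-1)).
Qed.

Let circle_norm2_chi : circle_norm2 mu chi = (ln mu)%:E.
Proof.
rewrite -inv_integral.2 /circle_norm2; apply: eq_integral => u /set_mem /D0 u0.
by rewrite normc_cpow_im// expr1n mul1r.
Qed.

Lemma character_L2 : L2 mu chi.
Proof.
split.
- move=> u u0; rewrite /chi cpowMl//.
  have -> : cpow mu (0 +i* - s) = 1.
    by have := cpow_im_cancel mu s; rewrite mus mulr1.
  by rewrite mul1r.
- by have [] := cmeasurable_cpow (0 +i* - s).
- by have [] := cmeasurable_cpow (0 +i* - s).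
- by rewrite circle_norm2_chi ltry.
Qed.

Lemma character_eigen lam : 0 < lam -> L2_eq (theta lam chi) (fun x => cpow lam (0 +i* s) * chi x).
Proof.
move=> l0; apply: aeT => x x0; rewrite /theta /chi cpowMl ?invr_gt0//; congr (_ * _).
have e := cpow_im_cancel lam s; have e' := cpow_inv (0 +i* - s) l0.
by apply: (mulIf (cpow_neq0 lam (0 +i* - s))); rewrite e' mulrC e.
Qed.

Lemma character_neq0 : ~ L2_eq chi (fun=> 0).
Proof. by move=> /ae_pos_exists[u _]; apply/eqP; exact: cpow_neq0. Qed.

(** Integrate |chi - h|^2 >= 1 - 2 Re(chi conj(h)), whose last term has integral
    zero by orthogonality. *)
Lemma far_of_orthogonal h : cmeasurable D h ->
  cintegrable D (fun u => chi u * conjc (h u) * (u^-1)%:C) -> L2_dot mu chi h = 0 ->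
  ((ln mu)%:E <= circle_norm2 mu (fun u => chi u - h u)%R)%E.
Proof.
move=> mh ih dot0.
have [//|fin] := leP (ln mu)%:E (circle_norm2 mu (fun u => chi u - h u)%R).
suff : ((ln mu)%:E <= circle_norm2 mu (fun u => chi u - h u)%R)%E by rewrite leNgt fin.
pose N u := normc (chi u - h u) ^+ 2 / u.
pose P u := Re (chi u * conjc (h u) * (u^-1)%:C).
have mN : measurable_fun D N.
  apply: measurable_funM; last first.
    by apply: measurable_funS measurable_inv => //; exact: itv_pos.
  have [mr mj] := cmeasurableD mchi (cmeasurableM (cmeasurable_cst D (-1)) mh).
  rewrite (_ : (fun _ => _) = fun u => Re_fun (fun u => chi u + -1 * h u) u ^+ 2 +
      Im_fun (fun u => chi u + -1 * h u) u ^+ 2).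
    by apply: measurable_funD; exact: measurable_funX.
  by apply/funext => u; rewrite sqr_normc /Re_fun /Im_fun mulN1r.
have iN : leb.-integrable D (EFin \o N).
  apply/integrableP; split; first exact/measurable_EFinP.
  rewrite (_ : integral _ _ _ = circle_norm2 mu (fun u => chi u - h u)%R).
    exact: lt_trans fin (ltry _).
  apply: eq_integral => u /set_mem /D0 u0; rewrite gee0_abs// lee_fin.
  by rewrite divr_ge0 ?sqr_ge0// ltW.
have [iV eV] := inv_integral.
have iP : leb.-integrable D (EFin \o P) by case: ih.
have i2P : leb.-integrable D (fun u => 2%:E * (P u)%:E)%E by exact: integrableZl.
have <- : (\int[leb]_(u in D) ((u^-1)%:E - 2%:E * (P u)%:E))%E = (ln mu)%:E.
  rewrite integralB// eV integralZl//.
  have -> : (\int[leb]_(u in D) (P u)%:E)%E = 0%E.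
    rewrite -[LHS]fineK; last exact: (integrable_fin_num mD iP).
    have : Re (L2_dot mu chi h) = 0 by rewrite dot0.
    by rewrite /L2_dot /circle_integral Re_cintegral => e; congr (_%:E).
  by rewrite mule0 sube0.
apply: le_integral => //; first exact: integrableB.
move=> u /set_mem Du; have u0 := D0 Du.
rewrite -EFinM -EFinB lee_fin /N /P.
have Re_scale (z : C) (r : R) : Re (z * r%:C) = Re z * r by rewrite !ReImE mulr0 subr0.
rewrite Re_scale mulrA -[X in X - _]mul1r -mulrBl ler_pM2r ?invr_gt0//.
by apply: sqr_normcB_ge; exact: normc_cpow_im.
Qed.

Lemma zero_orthogonal : zeta (2^-1 +i* s) = 0 -> L2_orth mu (SigmaE mu) chi.
Proof.
move=> z0; split; first exact: character_L2.
move=> _ [f S0f <-].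
by rewrite (L2_dot_character S0f).2 z0 mul0r conjc0.
Qed.

Lemma zero_cycle : zeta (2^-1 +i* s) = 0 ->
  zeta_cycle mu /\ spectrum (L2_orth mu (SigmaE mu)) s.
Proof.
move=> z0; have orth := zero_orthogonal z0; split; last first.
  by exists chi; split => //; [exact: character_neq0|exact: character_eigen].
split => // dense.
have [|_ [f S0f <-]] := dense chi character_L2 (ln mu); first exact: ln_gt0.
apply/negP; rewrite -leNgt; apply: far_of_orthogonal.
- exact: Sigma_E_measurable.
- exact: (L2_dot_character S0f).1.
- by apply: orth.2; exists f.
Qed.

End Character.

Theorem spectrum_sub_zeros (zeta : C -> C) (zetaP : is_riemann_zeta zeta) mu s :
  1 < mu -> spectrum (L2_orth mu (SigmaE mu)) s -> zeta (2^-1 +i* s) = 0.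
Proof.
move=> mu1 [xi [[L2xi orth] xi0 eig]].
have mus := eigenvector_period mu1 L2xi xi0 (eig _ (lt_trans ltr01 mu1)).
have [c c0 xiE] := eigenvector_power L2xi xi0 eig.
have [f S0f Mf0] := test_function s.
have [iP eP] := L2_dot_character zetaP mu1 mus S0f.
have := orth _ (ex_intro2 _ _ f S0f erefl).
rewrite (L2_dot_scale_ae L2xi (Sigma_E_measurable zetaP mu1 mus S0f) iP xiE) eP => /eqP.
by rewrite mulf_eq0 (negbTE c0) /= conjc_eq0 mulf_eq0 (negbTE Mf0) orbF => /eqP.
Qed.

Lemma cos_sin_2pi (m : nat) : cos (m%:R * (2 * pi)) = 1 :> R /\ sin (m%:R * (2 * pi)) = 0 :> R.
Proof.
elim: m => [|m [ihc ihs]]; first by rewrite mul0r cos0 sin0.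
have -> : m.+1%:R * (2 * pi) = m%:R * (2 * pi) + pi *+ 2 :> R.
  by rewrite -natr1 mulrDl mul1r [2 * pi]mulr_natl.
by rewrite cosD2pi sinD2pi.
Qed.

Lemma cpow_period mu s (m : nat) : 0 < s -> 1 < mu -> ln mu = m%:R * (2 * pi / s) ->
  cpow mu (0 +i* s) = 1.
Proof.
move=> s0 mu1 e; have [c1 s1] := cos_sin_2pi m.
have e' : s * ln mu = m%:R * (2 * pi).
  by rewrite e; field; rewrite gt_eqF.
by rewrite cpowE /= e' c1 s1 mul0r expR0 mulr0 mulr1; apply: complex_eq.
Qed.

End Spectrum.

Theorem theorem1p1 (R : realType) (zeta : R[i] -> R[i])
    (zetaP : is_riemann_zeta zeta) :
  (forall mu : R, 1 < mu ->
     forall s : R, spectrum (L2_orth mu (SigmaE mu)) s ->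
       zeta (2^-1 +i* s) = 0)
  /\
  (forall s : R, 0 < s -> zeta (2^-1 +i* s) = 0 ->
     forall mu : R, 1 < mu ->
       (exists2 m : nat, (0 < m)%N & ln mu = m%:R * (2 * pi / s)) ->
       zeta_cycle mu /\ spectrum (L2_orth mu (SigmaE mu)) s).
Proof.
split => [mu mu1 s|s s0 z0 mu mu1 [m _ e]].
  exact: spectrum_sub_zeros zetaP _ _ mu1.
exact: zero_cycle zetaP _ _ mu1 (cpow_period s0 mu1 e) z0.
Qed.
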